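(* Let $s,t$ be positive integers and assume that $2s\le t+1$. Let $\alpha_{ij}$ be positive integers for all $1\le i\le s$ and $1\le j\le t$. Suppose that $S$ is a Gorenstein local ring and that $\{x_{ij}\}_{1\le i\le s,\,1\le j\le t}$ forms a regular sequence on $S$. Let $I=I_s(x_{ij}^{\alpha_{ij}})$ be the ideal of $S$ generated by the $s\times s$ minors of the $s\times t$ matrix $(x_{ij}^{\alpha_{ij}})$. Set $R=S/I$. Then $S$ satisfies (SAC) if and only if $R$ satisfies (SAC).
   Context: All rings are commutative Noetherian with identity. A regular sequence on a local ring consists of elements of its maximal ideal. A ring $R$ satisfies (SAC) if for each finitely generated $R$-module $M$: whenever $\mathrm{Ext}_R^i(M,R)=0$ for all $i>0$ and $\mathrm{Ext}_R^i(M,M)=0$ for all sufficiently large $i$, one has $\mathrm{Ext}_R^i(M,M)=0$ for all $i>0$. *)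

(* Defs.v *)
From HB Require Import structures.
From mathcomp Require Import all_boot all_order all_algebra.
From mathcomp Require Import boolp classical_sets functions.

Set Implicit Arguments.
Unset Strict Implicit.
Unset Printing Implicit Defensive.

Import GRing.Theory.
Local Open Scope classical_set_scope.
Local Open Scope ring_scope.
Local Open Scope quotient_scope.

Section Ideals.
Variable R : comPzRingType.
Implicit Types (G I J m : set R).

Definition is_ideal I : Prop :=
  I 0 /\ forall a u v, I u -> I v -> I (a * u + v).

Definition ideal_span G : set R := smallest is_ideal G.

Lemma ideal_span_ideal G : is_ideal (ideal_span G).
Proof.
split=> [I [[I0 _] _] //|a u v Gu Gv I IG].
by case: (IG) => -[_ Iax] _; apply: Iax; [exact: Gu|exact: Gv].
Qed.

Definition noetherian : Prop :=
  forall I, is_ideal I -> exists s : seq R, I = ideal_span [set` s].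

Definition maximal_ideal m : Prop :=
  [/\ is_ideal m, ~ m 1 &
      forall J, is_ideal J -> ~ J 1 -> m `<=` J -> J = m].

(* Not necessarily Noetherian. *)
Definition local_ring m : Prop :=
  maximal_ideal m /\ forall n, maximal_ideal n -> n = m.

(* [R / (xs)] is automatically nonzero when [m] is proper. *)
Definition regular_sequence m (xs : seq R) : Prop :=
  {in xs, forall x, m x} /\
  forall k, (k < size xs)%N ->
    forall a, ideal_span [set` take k xs] (a * xs`_k) ->
      ideal_span [set` take k xs] a.

End Ideals.

(* [quotient_ring G] is R / (G), also when (G) = R: the quotient rings of the
   library's [ring_quotient] require a proof that the ideal is
   proper; [comPzRingType] allows the quotient by an arbitrary ideal. *)
Section QuotientRing.
Variables (R : comPzRingType) (G : set R).

Definition ideal_spanb : {pred R} := fun x => `[< ideal_span G x >].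

Lemma ideal_spanbE x : (x \in ideal_spanb) = `[< ideal_span G x >].
Proof. by []. Qed.

Lemma ideal_spanb_zmod_closed : zmod_closed ideal_spanb.
Proof.
have [I0 Iax] := ideal_span_ideal G.
split=> [|x y /asboolP Ix /asboolP Iy]; apply/asboolP => //.
by rewrite addrC -mulN1r; apply: Iax.
Qed.

HB.instance Definition _ :=
  GRing.isZmodClosed.Build R ideal_spanb ideal_spanb_zmod_closed.

Definition quotient_ring : Type := Quotient.quot ideal_spanb.

HB.instance Definition _ := GRing.Zmodule.on quotient_ring.
HB.instance Definition _ := ZmodQuotient.on quotient_ring.

Lemma ideal_spanbM a x : x \in ideal_spanb -> a * x \in ideal_spanb.
Proof.
have [I0 Iax] := ideal_span_ideal G.
by move=> /asboolP Ix; apply/asboolP; rewrite -[a * x]addr0; apply: Iax.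
Qed.

Definition quotient_ring_one : quotient_ring := \pi_quotient_ring 1.
Definition quotient_ring_mul (x y : quotient_ring) : quotient_ring :=
  \pi_quotient_ring (repr x * repr y).

Let pi_surj (x : quotient_ring) : exists a, x = \pi_quotient_ring a.
Proof. by exists (repr x); rewrite reprK. Qed.

Let pi_eq (x y : R) :
  (\pi_quotient_ring x == \pi_quotient_ring y) = (x - y \in ideal_spanb).
Proof. exact/esym/Quotient.idealrBE. Qed.

Let pi_mul (x y : R) :
  quotient_ring_mul (\pi_quotient_ring x) (\pi_quotient_ring y) =
  \pi_quotient_ring (x * y).
Proof.
apply/eqP; rewrite pi_eq.
set x' := repr _; set y' := repr _.
have x'x : x' - x \in ideal_spanb by rewrite -pi_eq reprK.
have y'y : y' - y \in ideal_spanb by rewrite -pi_eq reprK.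
have -> : x' * y' - x * y = x' * (y' - y) + y * (x' - x).
  by rewrite !mulrBr [y * x']mulrC [y * x]mulrC addrA subrK.
by rewrite rpredD ?ideal_spanbM.
Qed.

Let mulA : associative quotient_ring_mul.
Proof.
move=> x y z; have [a ->] := pi_surj x; have [b ->] := pi_surj y.
by have [c ->] := pi_surj z; rewrite !pi_mul mulrA.
Qed.

Let mulC : commutative quotient_ring_mul.
Proof.
move=> x y; have [a ->] := pi_surj x; have [b ->] := pi_surj y.
by rewrite !pi_mul mulrC.
Qed.

Let mul1 : left_id quotient_ring_one quotient_ring_mul.
Proof. by move=> x; have [a ->] := pi_surj x; rewrite pi_mul mul1r. Qed.

Let pi_add (x y : R) :
  \pi_quotient_ring x + \pi_quotient_ring y = \pi_quotient_ring (x + y).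
Proof. by rewrite [RHS]pi_addr. Qed.

Let mulDl : left_distributive quotient_ring_mul +%R.
Proof.
move=> x y z; have [a ->] := pi_surj x; have [b ->] := pi_surj y.
by have [c ->] := pi_surj z; rewrite pi_add !pi_mul pi_add mulrDl.
Qed.

HB.instance Definition _ :=
  GRing.Zmodule_isComPzRing.Build quotient_ring mulA mulC mul1 mulDl.

Lemma quotient_ring_pi_is_monoid_morphism :
  monoid_morphism (\pi_quotient_ring : R -> quotient_ring).
Proof. by split=> // x y; rewrite -pi_mul. Qed.

Lemma quotient_ring_pi_is_zmod_morphism :
  zmod_morphism (\pi_quotient_ring : R -> quotient_ring).
Proof. by move=> x y; rewrite -[LHS]/(\pi_quotient_ring _) !piE. Qed.

Lemma quotient_ring_pi_eq0 (x : R) :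
  \pi_quotient_ring x = 0 :> quotient_ring <-> ideal_span G x.
Proof.
have -> : 0 = \pi_quotient_ring 0 :> quotient_ring by rewrite piE.
split=> [/eqP|Gx]; [|apply/eqP]; rewrite pi_eq subr0.
  by move/asboolP.
exact/asboolP.
Qed.

End QuotientRing.

Definition increasing_ord (r n : nat) (f : 'I_r -> 'I_n) : Prop :=
  forall i j : 'I_r, (i < j)%N -> (f i < f j)%N.

Definition minors (R : comPzRingType) (p q r : nat) (A : 'M[R]_(p, q)) : set R :=
  [set d | exists (f : 'I_r -> 'I_p) (g : 'I_r -> 'I_q),
     [/\ increasing_ord f, increasing_ord g & d = \det (mxsub f g A)]].

Definition determinantal_ideal (R : comPzRingType) (p q r : nat)
    (A : 'M[R]_(p, q)) : set R := ideal_span (minors r A).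

Definition fin_gen (R : pzRingType) (M : lmodType R) : Prop :=
  exists (n : nat) (v : 'I_n -> M), forall m : M,
    exists c : 'I_n -> R, m = \sum_i c i *: v i.

Definition projective_module (R : pzRingType) (P : lmodType R) : Prop :=
  forall (A B : lmodType R) (g : {linear A -> B}),
    (forall b, exists a, g a = b) ->
    forall f : {linear P -> B}, exists h : {linear P -> A}, g \o h =1 f.

Definition injective_module (R : pzRingType) (E : lmodType R) : Prop :=
  forall (A B : lmodType R) (g : {linear A -> B}), injective g ->
    forall f : {linear A -> E}, exists h : {linear B -> E}, h \o g =1 f.

Definition exact_at (R : pzRingType) (A B C : lmodType R)
    (f : {linear A -> B}) (g : {linear B -> C}) : Prop :=
  forall b, g b = 0 <-> exists a, f a = b.

(* There is an injective resolution [0 -> M -> E 0 -> ... -> E n -> 0]. *)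
Definition injdim_le (R : pzRingType) (M : lmodType R) (n : nat) : Prop :=
  exists (E : nat -> lmodType R) (e : {linear M -> E 0%N})
         (d : forall k, {linear E k -> E k.+1}),
    [/\ forall k, injective_module (E k), injective e, exact_at e (d 0%N),
        forall k, exact_at (d k) (d k.+1) &
        forall k, (n < k)%N -> forall y : E k, y = 0].

Definition gorenstein_local (R : comPzRingType) (m : set R) : Prop :=
  [/\ noetherian R, local_ring m & exists n, injdim_le (R^o : lmodType R) n].

Record proj_resolution (R : pzRingType) (M : lmodType R) := ProjResolution {
  res_mod : nat -> lmodType R;
  res_diff : forall n, {linear res_mod n.+1 -> res_mod n};
  res_aug : {linear res_mod 0%N -> M};
  res_proj : forall n, projective_module (res_mod n);
  res_aug_surj : forall x, exists p, res_aug p = x;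
  res_exact0 : exact_at (res_diff 0%N) res_aug;
  res_exactS : forall n, exact_at (res_diff n.+1) (res_diff n) }.

Arguments res_proj [R M] p n [A B g].
Arguments res_exact0 [R M] p b.
Arguments res_exactS [R M] p n b.

Definition cocycle (R : comPzRingType) (M N : lmodType R)
    (P : proj_resolution M) (i : nat) (f : {linear res_mod P i -> N}) : Prop :=
  forall p, f (res_diff P i p) = 0.

Definition coboundary (R : comPzRingType) (M N : lmodType R)
    (P : proj_resolution M) (i : nat) : {linear res_mod P i -> N} -> Prop :=
  if i is j.+1 then fun f =>
    exists g : {linear res_mod P j -> N}, f =1 g \o res_diff P j
  else fun f => forall p, f p = 0.

(* [H^i(Hom(P, N)) = 0] *)
Definition cohomology_eq0 (R : comPzRingType) (M N : lmodType R)
    (P : proj_resolution M) (i : nat) : Prop :=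
  forall f : {linear res_mod P i -> N}, cocycle f -> coboundary f.

(* [Ext^i_R(M, N) = 0]; by [proj_resolution_exists] and [ext_eq0P] below, some
   projective resolution of [M] exists and any of them can be used. *)
Definition ext_eq0 (R : comPzRingType) (i : nat) (M N : lmodType R) : Prop :=
  forall P : proj_resolution M, cohomology_eq0 N P i.

Definition SAC (R : comPzRingType) : Prop :=
  forall M : lmodType R, fin_gen M ->
    (forall i, (0 < i)%N -> ext_eq0 i M (R^o : lmodType R)) ->
    (exists n, forall i, (n <= i)%N -> ext_eq0 i M M) ->
    forall i, (0 < i)%N -> ext_eq0 i M M.

Section Kernel.
Variables (R : pzRingType) (A B : lmodType R) (f : {linear A -> B}).

Definition ker_pred : {pred A} := fun a => f a == 0.

Lemma ker_submod_closed : submod_closed ker_pred.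
Proof.
split=> [|a x y]; rewrite !unfold_in ?linear0 // => /eqP fx /eqP fy.
by rewrite linearP fx fy scaler0 addr0.
Qed.
HB.instance Definition _ :=
  GRing.isSubmodClosed.Build R A ker_pred ker_submod_closed.

Record ker_mod := KerMod { ker_val : A; ker_valP : ker_pred ker_val }.
HB.instance Definition _ := [isSub of ker_mod for ker_val].
HB.instance Definition _ := [Choice of ker_mod by <:].
HB.instance Definition _ := [SubChoice_isSubLmodule of ker_mod by <:].
End Kernel.

Section FreeModule.
Variables (R : pzRingType) (T : choiceType).

Definition finsupp : {pred T -> R^o} :=
  fun u => `[< exists s : seq T, forall x, u x != 0 -> x \in s >].

Lemma finsupp_submod_closed : @GRing.submod_closed R (T -> R^o) finsupp.
Proof.
split=> [|a u v /asboolP [s us] /asboolP [r vr]]; apply/asboolP.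
  by exists [::] => x; rewrite /= eqxx.
exists (s ++ r) => x; rewrite mem_cat.
have -> : (a *: u + v) x = a * u x + v x by [].
apply: contraR.
rewrite negb_or => /andP [xs xr].
have /eqP -> : v x == 0 by apply: contraNT xr; exact: vr.
have /eqP -> : u x == 0 by apply: contraNT xs; exact: us.
by rewrite mulr0 addr0.
Qed.
HB.instance Definition _ :=
  GRing.isSubmodClosed.Build R (T -> R^o) finsupp finsupp_submod_closed.

Record free_mod := FreeMod { free_val : T -> R^o; free_valP : finsupp free_val }.
HB.instance Definition _ := [isSub of free_mod for free_val].
HB.instance Definition _ := [Choice of free_mod by <:].
HB.instance Definition _ := [SubChoice_isSubLmodule of free_mod by <:].

Lemma free_supp (u : free_mod) :
  exists s : seq T, uniq s /\ forall x, free_val u x != 0 -> x \in s.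
Proof.
have /asboolP [s us] := free_valP u; exists (undup s).
by split=> [|x /us]; rewrite ?undup_uniq ?mem_undup.
Qed.

Definition free_basis_fun (t : T) : T -> R^o := fun x => (x == t)%:R.

Lemma free_basis_subproof t : finsupp (free_basis_fun t).
Proof.
apply/asboolP; exists [:: t] => x; rewrite inE /free_basis_fun.
by case: (x == t); rewrite ?eqxx.
Qed.

Definition free_basis t : free_mod := FreeMod (free_basis_subproof t).

Section Extension.
Variables (B : lmodType R) (e : T -> B).

Definition free_ext_fun (u : free_mod) : B :=
  \sum_(x <- projT1 (cid (free_supp u))) (free_val u x : R) *: e x.

Lemma free_ext_funE u s : uniq s -> (forall x, free_val u x != 0 -> x \in s) ->
  free_ext_fun u = \sum_(x <- s) (free_val u x : R) *: e x.
Proof.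
have red (r : seq T) : \sum_(x <- r) (free_val u x : R) *: e x =
    \sum_(x <- [seq x <- r | free_val u x != 0]) (free_val u x : R) *: e x.
  rewrite big_filter [LHS](bigID (fun x => free_val u x != 0)) /=.
  by rewrite [X in _ + X]big1 ?addr0 // => x /negPn /eqP ->; rewrite scale0r.
rewrite /free_ext_fun; case: cid => r /= [ur rs] us ss.
rewrite red [RHS]red; apply/perm_big/uniq_perm; rewrite ?filter_uniq // => x.
by rewrite !mem_filter; case: (boolP (_ != 0)) => //= ux; rewrite rs ?ss.
Qed.

Lemma free_ext_is_linear : linear free_ext_fun.
Proof.
move=> a u v; have [s [_ us]] := free_supp u; have [r [_ vr]] := free_supp v.
pose w := undup (s ++ r).
have uw x : free_val u x != 0 -> x \in w.
  by move=> /us xs; rewrite mem_undup mem_cat xs.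
have vw x : free_val v x != 0 -> x \in w.
  by move=> /vr xr; rewrite mem_undup mem_cat xr orbT.
rewrite !(@free_ext_funE _ w) ?undup_uniq //.
  rewrite scaler_sumr -big_split /=; apply: eq_bigr => x _.
  by rewrite -[LHS]/((a * free_val u x + free_val v x : R) *: e x) scalerDl scalerA.
move=> x; apply: contraNT => xw.
rewrite -[X in X == 0]/(a * free_val u x + free_val v x : R).
have /eqP -> : free_val v x == 0 by apply: contraNT xw; exact: vw.
have /eqP -> : free_val u x == 0 by apply: contraNT xw; exact: uw.
by rewrite mulr0 addr0.
Qed.
HB.instance Definition _ :=
  GRing.isLinear.Build R free_mod B *:%R free_ext_fun free_ext_is_linear.

Definition free_ext : {linear free_mod -> B} := free_ext_fun.

Lemma free_ext_basis t : free_ext (free_basis t) = e t.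
Proof.
rewrite /free_ext /= (@free_ext_funE _ [:: t]) //.
  by rewrite big_seq1 /= /free_basis_fun eqxx scale1r.
by move=> x; rewrite inE /= /free_basis_fun; case: (x == t); rewrite ?eqxx.
Qed.
End Extension.

Lemma free_decomp (u : free_mod) : exists s : seq T,
  u = \sum_(x <- s) (free_val u x : R) *: free_basis x.
Proof.
have [s [us uP]] := free_supp u; exists s; apply: val_inj; apply/funext => y.
have valD (r : seq T) : val (\sum_(x <- r) (free_val u x : R) *: free_basis x) y
   = \sum_(x <- r) (free_val u x : R) * (y == x)%:R.
  elim: r => [|x r IH]; first by rewrite !big_nil.
  by rewrite !big_cons -IH.
rewrite valD -[LHS]/(free_val u y); have [ys|ys] := boolP (y \in s).
  rewrite (bigD1_seq y) //= eqxx mulr1 big1 ?addr0 // => x xy.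
  by rewrite eq_sym (negbTE xy) mulr0.
have /eqP -> : free_val u y == 0 by apply: contraNT ys; exact: uP.
rewrite big1_seq // => x /= xs.
by case: eqP ys => [->|]; rewrite ?xs ?mulr0.
Qed.

Lemma free_mod_projective : projective_module (free_mod : lmodType R).
Proof.
move=> A B g g_surj f.
have [a ga] := choice (fun t => g_surj (f (free_basis t))).
exists (free_ext a) => u /=; have [s us] := free_decomp u.
have linE (h : {linear free_mod -> B}) :
    h u = \sum_(x <- s) (free_val u x : R) *: h (free_basis x).
  by rewrite {1}us linear_sum; apply: eq_bigr => x _; rewrite linearZ.
rewrite -[LHS]/((g \o free_ext a) u) !linE; apply: eq_bigr => x _.
by rewrite -ga -[in RHS](free_ext_basis a).
Qed.

End FreeModule.

Section FreeResolution.
Variables (R : pzRingType) (M : lmodType R).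

Definition free_cover (N : lmodType R) : {linear free_mod R N -> N} :=
  free_ext (id : N -> N).

Lemma free_cover_surj (N : lmodType R) x : exists p, free_cover N p = x.
Proof. by exists (free_basis R x); rewrite /free_cover free_ext_basis. Qed.

Fixpoint syzygy n : lmodType R :=
  if n is n'.+1 then ker_mod (free_cover (syzygy n')) else M.

Definition free_res_diff n :
    {linear free_mod R (syzygy n.+1) -> free_mod R (syzygy n)} :=
  (val : ker_mod (free_cover (syzygy n)) -> _) \o free_cover (syzygy n.+1).

Lemma free_res_exact n : exact_at (free_res_diff n) (free_cover (syzygy n)).
Proof.
move=> b; split=> [/eqP gb|[a <-]].
  by have [a fa] := free_cover_surj (KerMod gb : syzygy n.+1); exists a;
    rewrite /free_res_diff /= fa.
exact/eqP/(ker_valP (free_cover (syzygy n.+1) a)).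
Qed.

Lemma proj_resolution_exists : inhabited (proj_resolution M).
Proof.
constructor; apply: (@ProjResolution R M (fun n => free_mod R (syzygy n) : lmodType R)
          free_res_diff (free_cover M)).
- by move=> n; exact: free_mod_projective.
- exact: free_cover_surj.
- exact: (@free_res_exact 0%N).
- move=> n b; apply: iff_trans (@free_res_exact n.+1 b).
  rewrite /free_res_diff /=; split=> [fb|-> //]; exact: val_inj.
Qed.
End FreeResolution.


Section Comparison.
Variable R : comPzRingType.

Lemma projective_lift (P A B C : lmodType R) (d : {linear A -> B})
    (d' : {linear B -> C}) (f : {linear P -> B}) :
  projective_module P -> exact_at d d' -> (forall p, d' (f p) = 0) ->
  exists h : {linear P -> A}, forall p, d (h p) = f p.
Proof.
move=> projP ex f0.
have dK a : ker_pred d' (d a) by apply/eqP/ex; exists a.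
have fK p : ker_pred d' (f p) by apply/eqP.
pose dk a : ker_mod d' := KerMod (dK a).
pose fk p : ker_mod d' := KerMod (fK p).
have dk_lin : linear dk by move=> a x y; apply: val_inj; exact: linearP.
have fk_lin : linear fk by move=> a x y; apply: val_inj; exact: linearP.
pose dkM := GRing.isLinear.Build R A (ker_mod d') *:%R dk dk_lin.
pose fkM := GRing.isLinear.Build R P (ker_mod d') *:%R fk fk_lin.
pose dkL : {linear A -> ker_mod d'} := HB.pack dk dkM.
pose fkL : {linear P -> ker_mod d'} := HB.pack fk fkM.
have dk_surj b : exists a, dkL a = b.
  have /eqP/ex [a da] := ker_valP b.
  by exists a; apply: val_inj; exact: da.
have [h hE] := projP _ _ dkL dk_surj fkL.
by exists h => p; have /(congr1 val) := hE p.
Qed.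

Lemma res_aug_diff (M : lmodType R) (P : proj_resolution M) p : res_aug P (res_diff P 0%N p) = 0.
Proof. by apply/res_exact0; exists p. Qed.

Lemma res_diff_diff (M : lmodType R) (P : proj_resolution M) n p : res_diff P n (res_diff P n.+1 p) = 0.
Proof. by apply/res_exactS; exists p. Qed.

Variables (M : lmodType R) (P Q : proj_resolution M).

Lemma comparison : exists u : forall n, {linear res_mod P n -> res_mod Q n},
  (forall p, res_aug Q (u 0%N p) = res_aug P p) /\
  forall n p, res_diff Q n (u n.+1 p) = u n (res_diff P n p).
Proof.
have [u0 u0E] := res_proj P 0 (res_aug_surj Q) (res_aug P).
have [u1 u1E] : exists u1 : {linear res_mod P 1 -> res_mod Q 1},
    forall p, res_diff Q 0 (u1 p) = (u0 \o res_diff P 0%N) p.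
  apply: (projective_lift (res_proj P 1) (res_exact0 Q)) => p.
  by rewrite [LHS](u0E _) res_aug_diff.
pose T n := {w : {linear res_mod P n -> res_mod Q n} *
                 {linear res_mod P n.+1 -> res_mod Q n.+1} |
             forall p, res_diff Q n (w.2 p) = w.1 (res_diff P n p)}.
have step n (w : T n) : {w' : T n.+1 | (sval w').1 = (sval w).2}.
  case: w => -[w1 w2] /= wE; apply: cid.
  have [w3 w3E] : exists w3 : {linear res_mod P n.+2 -> res_mod Q n.+2},
      forall p, res_diff Q n.+1 (w3 p) = (w2 \o res_diff P n.+1) p.
    apply: (projective_lift (res_proj P n.+2) (res_exactS Q n)) => p /=.
    by rewrite wE res_diff_diff linear0.
  by exists (exist _ (w2, w3) w3E).
pose w := fix w n : T n := if n is n'.+1 then sval (step n' (w n'))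
                           else exist _ (u0, u1) u1E.
exists (fun n => (sval (w n)).1); split=> [p|n p]; first exact: u0E.
by rewrite [(sval (w n.+1)).1](svalP (step n (w n))) (svalP (w n)).
Qed.

End Comparison.

Section Homotopy.
Variables (R : comPzRingType) (M : lmodType R) (P : proj_resolution M).

(* A chain endomorphism lifting the identity is homotopic to the identity. *)
Lemma homotopy (w : forall n, {linear res_mod P n -> res_mod P n}) :
    (forall p, res_aug P (w 0%N p) = res_aug P p) ->
    (forall n p, res_diff P n (w n.+1 p) = w n (res_diff P n p)) ->
  exists h : forall n, {linear res_mod P n -> res_mod P n.+1},
    (forall p, w 0%N p - p = res_diff P 0%N (h 0%N p)) /\
    forall n p, w n.+1 p - p =
      res_diff P n.+1 (h n.+1 p) + h n (res_diff P n p).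
Proof.
move=> w0 wd.
pose e n : {linear res_mod P n -> res_mod P n} := w n \- idfun.
have eE n p : e n p = w n p - p by [].
have [h0 h0E] : exists h0 : {linear res_mod P 0 -> res_mod P 1},
    forall p, res_diff P 0 (h0 p) = e 0%N p.
  apply: (projective_lift (res_proj P 0) (res_exact0 P)) => p.
  by rewrite eE linearB /= w0 subrr.
pose good n (hn : {linear res_mod P n -> res_mod P n.+1}) :=
  forall p, res_diff P n (e n.+1 p - hn (res_diff P n p)) = 0.
have good0 : good 0%N h0.
  by move=> p; rewrite eE !linearB /= wd h0E eE subrr.
pose T n := {hn | good n hn}.
have step n (hn : T n) : {hn' : T n.+1 | forall p, e n.+1 p =
    res_diff P n.+1 (sval hn' p) + sval hn (res_diff P n p)}.
  apply: cid; have [k kE] : exists k : {linear res_mod P n.+1 -> res_mod P n.+2},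
      forall p, res_diff P n.+1 (k p) =
                (e n.+1 \- (sval hn \o res_diff P n)) p.
    apply: (projective_lift (res_proj P n.+1) (res_exactS P n)) => p.
    exact: (svalP hn).
  have kP : good n.+1 k.
    move=> p; rewrite linearB kE /= res_diff_diff linear0 subr0.
    by rewrite linearB /= wd subrr.
  by exists (exist _ k kP) => p; rewrite kE /= subrK.
pose h := fix h n : T n := if n is n'.+1 then sval (step n' (h n'))
                           else exist _ h0 good0.
exists (fun n => sval (h n)); split=> [p|n p]; first by rewrite h0E.
exact: (svalP (step n (h n))).
Qed.

End Homotopy.

Section Independence.
Variables (R : comPzRingType) (M N : lmodType R).

Lemma cohomology_eq0_indep (P Q : proj_resolution M) i :
  cohomology_eq0 N Q i -> cohomology_eq0 N P i.
Proof.
have [u [u0 ud]] := comparison P Q; have [v [v0 vd]] := comparison Q P.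
have [|n p|h [h0 hd]] := homotopy (w := fun n => v n \o u n).
- by move=> p /=; rewrite v0 u0.
- by rewrite /= vd ud.
move=> HQ f fc.
have fvc : cocycle (f \o v i : {linear res_mod Q i -> N}).
  by move=> q; rewrite /= -vd fc.
have := HQ _ fvc; case: i f fc fvc HQ => [|i] f fc _ _ /=.
  move=> fv p; rewrite -[p](subKr (v 0%N (u 0%N p))).
  by rewrite linearB /= fv h0 fc subr0.
move=> [g gE]; exists ((g \o u i) \- (f \o h i)) => p /=.
have -> : f p = f (v i.+1 (u i.+1 p)) - f (v i.+1 (u i.+1 p) - p).
  by rewrite linearB /= opprB addrC subrK.
by rewrite [f (v _ _)]gE /= ud hd linearD /= fc add0r.
Qed.

Lemma ext_eq0P (P : proj_resolution M) i : ext_eq0 i M N <-> cohomology_eq0 N P i.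
Proof. by split=> [|HP Q]; [exact|exact: (cohomology_eq0_indep HP)]. Qed.

End Independence.

(* Main.v *)
(* Let y run over the st - n differences between the entries of the matrix and
   those of the s x t Toeplitz matrix on z_0, ..., z_{n-1}, the first n = t - s + 1
   entries of its first row.  Powers and permutations of regular sequences in a local
   ring are regular, so y, z is regular on S whatever the exponents.  Modulo y the
   ideal I becomes (z)^s.

   (1) If y in m is regular on a local ring R, then (SAC) holds for R iff it holds
   for R/y.  Downwards, an R/y-module M has the R-resolution given by the cone of y
   on a lifted R/y-resolution, and its first R-syzygy inherits the hypotheses.
   Upwards, y is regular on every syzygy, and Nakayama's lemma concludes.

   (2) Put S' = S/(y), Q = (z) and R' = S'/Q^s, where s <= n.  If N has a filtration
   N = N_0 > N_1 > ... > N_s = 0 with N_k/N_{k+1} a direct sum of C(n+k-1, k) copies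
   of N_0/N_1, and Ext^i(M, N) = 0 for i >= a, then the lengths e_i of
   Ext^i(M, N/QN) at a suitable prime satisfy
     C(n+s-2, s-1) e_{i+1} <= C(n+s-2, s-2) e_i,
   so they decrease strictly, hence vanish eventually and then for all i >= a.
   With N = R' this gives Ext^i(M, S'/Q) = 0; as S is Gorenstein, the resolution of M
   stays exact modulo Q, so that N = M has such a filtration as well and (SAC)
   passes from S'/Q to R'.  The passage from R' to S' is similar.

   (3) y is regular on S/I: modulo y, the relations among the maximal minors are
   generated by the Eagon-Northcott relations (peel off the first column, then the
   first row, of the Toeplitz matrix).  These lift to S, so by Nakayama's lemma they
   generate the relations at each stage between S and S/(y). *)

Require Import Defs.
From HB Require Import structures.
From mathcomp Require Import all_boot all_order all_algebra.
From mathcomp Require Import perm.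
From mathcomp Require Import boolp classical_sets functions.
From mathcomp Require Import ring zify.

Set Implicit Arguments.
Unset Strict Implicit.
Unset Printing Implicit Defensive.

Import GRing.Theory.
Local Open Scope classical_set_scope.
Local Open Scope ring_scope.

(** * Identities in abelian groups *)

(** Quotient rings and their modules occur only at the two ends. In between everything lives over
    [S]: a module over S/J is the cokernel of a matrix modulo [J], and a cochain with values in U/W
    is a matrix with rows in [U], taken modulo [W]. Changing the ring then means changing the set
    [J], and one family [D] of matrices can be exact modulo several ideals at once. The estimate in
    (2) counts monomials. The step N_{s-1} is a sum of copies of N_0/N_1, one for each monomial of
    degree s - 1; N/N_{s-1} is filtered by copies indexed by the C(n+s-2, s-2) monomials of lower
    degree. Since Ext(M, N) vanishes, the connecting map from the cohomology of N/N_{s-1} to the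
    next cohomology of N_{s-1} is onto. The first number is the larger one exactly when s <= n. For
    N = M the obstacle is Tor(M, S'/Q), which must vanish before M can be filtered by copies of
    M/QM. Once Ext(M, S'/Q) = 0, the dual of [D] modulo Q is exact; finite injective dimension
    dualises this back to exactness of [D] in high degrees, and passing to a syzygy disposes of the
    low ones. *)

Section ZmodSolver.

(** Proof by reflection: an identity holds in every abelian group once both sides have the same
    integer coefficient at each atom, which is decided by computation. *)
Inductive zexpr :=
  | ZVar of nat | ZZero | ZAdd of zexpr & zexpr | ZOpp of zexpr.

Fixpoint zcoef (e : zexpr) (i : nat) : int :=
  match e with
  | ZVar j => (i == j)%:R
  | ZZero => 0
  | ZAdd e1 e2 => zcoef e1 i + zcoef e2 i
  | ZOpp e1 => - zcoef e1 i
  end.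

Fixpoint zbound (e : zexpr) : nat :=
  match e with
  | ZVar j => j.+1
  | ZZero => 0
  | ZAdd e1 e2 => maxn (zbound e1) (zbound e2)
  | ZOpp e1 => zbound e1
  end.

Variable V : zmodType.

Fixpoint zeval (env : seq V) (e : zexpr) : V :=
  match e with
  | ZVar j => env`_j
  | ZZero => 0
  | ZAdd e1 e2 => zeval env e1 + zeval env e2
  | ZOpp e1 => - zeval env e1
  end.

Lemma zeval_coef env e n : (zbound e <= n)%N ->
  zeval env e = \sum_(i < n) env`_i *~ zcoef e i.
Proof.
elim: e => [j|||] /=.
- move=> jn; rewrite (bigD1 (Ordinal jn)) //= eqxx mulr1z big1 ?addr0 // => i.
  by rewrite -val_eqE /= => /negbTE ->; rewrite mulr0z.
- by move=> _; rewrite big1 // => i _; rewrite mulr0z.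
- move=> e1 IH1 e2 IH2; rewrite geq_max => /andP [b1 b2].
  rewrite IH1 // IH2 // -big_split; apply: eq_bigr => i _.
  by rewrite mulrzDr.
- move=> e IH b; rewrite IH // -sumrN; apply: eq_bigr => i _.
  by rewrite mulrNz.
Qed.

Lemma zeval_eq env e1 e2 :
  (let n := maxn (zbound e1) (zbound e2) in
   all (fun i => zcoef e1 i == zcoef e2 i) (iota 0 n)) ->
  zeval env e1 = zeval env e2.
Proof.
move=> /= /allP eqc; rewrite (@zeval_coef _ e1 (maxn (zbound e1) (zbound e2))).
  rewrite (@zeval_coef _ e2 (maxn (zbound e1) (zbound e2))) ?leq_maxr //.
  by apply: eq_bigr => i _; congr (_ *~ _); apply/eqP/eqc; rewrite mem_iota /=.
by rewrite leq_maxl.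
Qed.

End ZmodSolver.

(** Each known atom is compared syntactically and then by unification, since one term may be reached
    through different canonical structures. *)
Ltac zmod_index env x :=
  match env with
  | ?y :: ?l => let _ := match tt with
                     | _ => constr_eq x y
                     | _ => unify x y
                     end in constr:(0%N)
  | _ :: ?l => let n := zmod_index l x in constr:(n.+1)
  end.

Ltac zmod_atoms env t :=
  match t with
  | (?a + ?b)%R => let env := zmod_atoms env a in zmod_atoms env b
  | (- ?a)%R => zmod_atoms env a
  | 0%R => env
  | _ => match tt with
         | _ => let _ := zmod_index env t in env
         | _ => constr:(t :: env)
         end
  end.

Ltac zmod_reify env t :=
  match t with
  | (?a + ?b)%R => let e := zmod_reify env a in let f := zmod_reify env b in
                   constr:(ZAdd e f)
  | (- ?a)%R => let e := zmod_reify env a in constr:(ZOpp e)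
  | 0%R => constr:(ZZero)
  | _ => let n := zmod_index env t in constr:(ZVar n)
  end.

Ltac zmod :=
  match goal with
  | |- @eq ?T ?a ?b =>
    let env := zmod_atoms (@nil T) a in
    let env := zmod_atoms env b in
    let e := zmod_reify env a in
    let f := zmod_reify env b in
    refine (@zeval_eq _ env e f _); vm_compute; reflexivity
  end.

(** * Noetherian modules and Nakayama's lemma *)

Section Submodules.
Variable S : comPzRingType.
Implicit Types (X Y K : lmodType S).

Definition submod X (G : set X) : Prop :=
  G 0 /\ forall a u v, G u -> G v -> G (a *: u + v).

Section Closure.
Variables (X : lmodType S) (G : set X).
Hypothesis sG : submod G.

Lemma sub0 : G 0. Proof. exact: sG.1. Qed.

Lemma subD u v : G u -> G v -> G (u + v).
Proof. by move=> Gu Gv; rewrite -[u]scale1r; apply: sG.2. Qed.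

Lemma subZ a u : G u -> G (a *: u).
Proof. by move=> Gu; rewrite -[_ *: _]addr0; apply: sG.2 => //; exact: sub0. Qed.

Lemma subN u : G u -> G (- u).
Proof. by move=> Gu; rewrite -scaleN1r; exact: subZ. Qed.

Lemma subB u v : G u -> G v -> G (u - v).
Proof. by move=> Gu Gv; apply: subD => //; exact: subN. Qed.

Lemma sub_sum I (r : seq I) (P : pred I) (F : I -> X) :
  (forall i, P i -> G (F i)) -> G (\sum_(i <- r | P i) F i).
Proof. by move=> GF; apply: (big_ind G) => //; [exact: sub0|exact: subD]. Qed.

End Closure.

Lemma submodT X : submod [set: X].
Proof. by []. Qed.

Lemma submodI X (G H : set X) : submod G -> submod H -> submod (G `&` H).
Proof.
move=> sG sH; split=> [|a u v [Gu Hu] [Gv Hv]].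
  by split; [exact: sub0 sG|exact: sub0 sH].
by split; [apply: sG.2|apply: sH.2].
Qed.

Lemma submod_preimage X Y (f : {linear X -> Y}) (G : set Y) :
  submod G -> submod (f @^-1` G).
Proof.
move=> sG; split=> [|a u v Gu Gv] /=; first by rewrite linear0; exact: sub0.
by rewrite linearP; apply: sG.2.
Qed.

Definition addsm X (G H : set X) : set X :=
  [set x | exists g h, [/\ G g, H h & x = g + h]].

Lemma submod_addsm X (G H : set X) :
  submod G -> submod H -> submod (addsm G H).
Proof.
move=> sG sH; split=> [|a _ _ [g [h [Gg Hh ->]]] [g' [h' [Gg' Hh' ->]]]].
  by exists 0, 0; split; [exact: sub0 sG|exact: sub0 sH|rewrite addr0].
exists (a *: g + g'), (a *: h + h'); split; [exact: sG.2|exact: sH.2|].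
by rewrite scalerDr; zmod.
Qed.

Lemma addsml X (G H : set X) : submod H -> G `<=` addsm G H.
Proof. by move=> sH x Gx; exists x, 0; split=> //; [exact: sub0|rewrite addr0]. Qed.

Lemma addsmr X (G H : set X) : submod G -> H `<=` addsm G H.
Proof. by move=> sG x Hx; exists 0, x; split=> //; [exact: sub0|rewrite add0r]. Qed.

Lemma addsm_sub X (G H L : set X) :
  submod L -> G `<=` L -> H `<=` L -> addsm G H `<=` L.
Proof. by move=> sL GL HL _ [g [h [/GL Lg /HL Lh ->]]]; exact: subD. Qed.

Definition noethm X : Prop :=
  forall G : set X, submod G -> exists (n : nat) (v : 'I_n -> X),
    (forall i, G (v i)) /\ forall x, G x -> exists c : 'I_n -> S, x = \sum_i c i *: v i.

(** Otherwise dependent choice gives a strictly ascending chain; finitely many generators of its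
    union lie in one member, where the chain must stop. *)
Lemma noethm_max X (F : set (set X)) : noethm X -> (forall G, F G -> submod G) ->
  (exists G, F G) -> exists G, F G /\ forall G', F G' -> G `<=` G' -> G' `<=` G.
Proof.
move=> nX Fs [G0 FG0]; apply: contrapT => noG.
have step (G : {G | F G}) : {G' : {G' | F G'} | sval G `<=` sval G' /\ ~ sval G' `<=` sval G}.
  apply: cid; apply: contrapT => no; apply: noG; exists (sval G); split.
    exact: svalP.
  move=> G' FG' GG'; apply: contrapT => nG'; apply: no.
  by exists (exist _ G' FG').
pose G := fix G n := if n is n'.+1 then sval (step (G n'))
                     else exist _ G0 FG0 : {G | F G}.
have GS n : sval (G n) `<=` sval (G n.+1) /\ ~ sval (G n.+1) `<=` sval (G n).
  exact: (svalP (step (G n))).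
have Gle i j : (i <= j)%N -> sval (G i) `<=` sval (G j).
  elim: j => [|j IH]; first by rewrite leqn0 => /eqP ->.
  rewrite leq_eqVlt => /orP [/eqP -> //|/IH Gij].
  by apply: subset_trans Gij _; have [] := GS j.
have sGn n : submod (sval (G n)) by apply: Fs; exact: svalP.
have [n [v [Gv vG]]] : exists n (v : 'I_n -> X),
    (forall i, exists k, sval (G k) (v i)) /\
    forall x, (exists k, sval (G k) x) -> exists c : 'I_n -> S, x = \sum_i c i *: v i.
  apply: (nX [set x | exists k, sval (G k) x]); split=> [|a x y [k Gx] [l Gy]].
    by exists 0%N; exact: sub0.
  exists (maxn k l); apply: (sGn _).2.
    by apply: Gle Gx; exact: leq_maxl.
  by apply: Gle Gy; exact: leq_maxr.
have [k kv] := choice Gv.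
pose N := \max_i k i.
have [_] := GS N; apply => x Gx.
have [|c ->] := vG x; first by exists N.+1.
apply: (sub_sum (sGn N)) => i _; apply: (subZ (sGn N)).
by apply: Gle (kv i); exact: (@leq_bigmax _ k i).
Qed.

Lemma noethm_ext X Y K (f : {linear X -> Y}) (g : {linear K -> X}) :
  noethm Y -> noethm K -> (forall x, f x = 0 -> exists k, g k = x) -> noethm X.
Proof.
move=> nY nK fg G sG.
have [|n [v [Gv vG]]] := nY [set y | exists2 x, G x & f x = y].
  split=> [|a _ _ [x Gx <-] [y Gy <-]]; first by exists 0; rewrite ?linear0 //; exact: sub0.
  by exists (a *: x + y); [exact: sG.2|rewrite linearP].
have [m [w [Gw wG]]] := nK (g @^-1` G) (submod_preimage g sG).
have [x Gx fx] : exists2 x : 'I_n -> X, (forall i, G (x i)) & forall i, f (x i) = v i.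
  have /choice [x xP] : forall i, exists x, G x /\ f x = v i.
    by move=> i; have [x] := Gv i; exists x.
  by exists x => i; have [] := xP i.
pose h (i : 'I_(n + m)) := match fintype.split i with inl j => x j | inr j => g (w j) end.
exists (n + m)%N, h; split=> [i|y Gy].
  by rewrite /h; case: fintype.split => j; [exact: Gx|exact: Gw].
have [c fy] := vG (f y) (ex_intro2 _ _ y Gy erefl).
have [k gk] : exists k, g k = y - \sum_i c i *: x i.
  apply: fg; rewrite linearB linear_sum fy; apply/eqP; rewrite subr_eq0; apply/eqP.
  by apply: eq_bigr => i _; rewrite linearZ /= fx.
have [|d kd] := wG k.
  by rewrite /= gk; apply: (subB sG) => //; apply: (sub_sum sG) => i _; exact: subZ.
exists (fun i => match fintype.split i with inl j => c j | inr j => d j end).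
rewrite big_split_ord /=.
have -> : y = \sum_i c i *: x i + g k by rewrite gk; zmod.
congr (_ + _); last rewrite kd linear_sum; apply: eq_bigr => i _.
  by rewrite /h (unsplitK (inl _ i)).
by rewrite /h (unsplitK (inr _ i)) linearZ.
Qed.

Lemma noethm_surj X Y (f : {linear X -> Y}) :
  noethm X -> (forall y, exists x, f x = y) -> noethm Y.
Proof.
move=> nX fsurj G sG; have [n [v [Gv vG]]] := nX _ (submod_preimage f sG).
exists n, (f \o v); split=> [//|y Gy]; have [x fx] := fsurj y.
have [|c xc] := vG x; first by rewrite /= fx.
by exists c; rewrite -fx xc linear_sum; apply: eq_bigr => i _; rewrite linearZ.
Qed.

Hypothesis nS : noetherian S.

Lemma noethm_regular : noethm S^o.
Proof.
move=> G sG; have [s Gs] := nS (sG : is_ideal G).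
exists (size s), (fun i => s`_i); split=> [i|x].
  by rewrite Gs => I [_]; apply; rewrite /= mem_nth.
rewrite Gs => /(_ [set x | exists c : 'I_(size s) -> S, x = \sum_i c i *: (s`_i : S^o)]).
apply; split; last first.
  move=> y /= ys; have i := index_mem y s; rewrite ys in i.
  exists (fun j => (j == Ordinal i)%:R); rewrite (bigD1 (Ordinal i)) //= eqxx scale1r.
  by rewrite nth_index // big1 ?addr0 // => j /negbTE ->; rewrite scale0r.
split; first by exists (fun=> 0); rewrite big1 // => i _; rewrite scale0r.
move=> a _ _ [c ->] [d ->]; exists (fun i => a * c i + d i).
rewrite mulr_sumr -big_split; apply: eq_bigr => i _ /=.
by rewrite scalerDl -scalerA.
Qed.

Lemma noethm_rV n : noethm 'rV[S]_n.
Proof.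
elim: n => [|n IH].
  move=> G sG; exists 0%N, (fun=> 0); split=> [[]//|x _]; exists (fun=> 0).
  by apply/matrixP => i [].
pose f (v : 'rV[S]_n.+1) : S^o := v 0 0.
have f_lin : linear f by move=> a u v; rewrite /f !mxE.
pose g (v : 'rV[S]_n) : 'rV[S]_n.+1 := row_mx (0 : 'rV_1) v.
have g_lin : linear g.
  move=> a u v; apply/matrixP => i j; rewrite !mxE.
  by case: splitP => k _; rewrite !mxE ?mulr0 ?addr0.
pose fM := GRing.isLinear.Build S _ _ _ f f_lin.
pose gM := GRing.isLinear.Build S _ _ _ g g_lin.
pose fL : {linear 'rV[S]_n.+1 -> S^o} := HB.pack f fM.
pose gL : {linear 'rV[S]_n -> 'rV[S]_n.+1} := HB.pack g gM.
apply: (@noethm_ext _ _ _ fL gL noethm_regular IH) => x fx0.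
exists (rsubmx (x : 'rV_(1 + n))); apply/matrixP => i j; rewrite /= /g mxE !ord1.
case: splitP => k jk; last by rewrite mxE; congr (x _ _); apply: val_inj.
rewrite mxE -[LHS]fx0 /= /f; congr (x _ _); apply: val_inj.
by rewrite /= jk ord1.
Qed.

Lemma noethm_M p q : noethm 'M[S]_(p, q).
Proof.
apply: (@noethm_surj _ _ (vec_mx : {linear 'rV_(p * q) -> 'M_(p, q)}) (@noethm_rV _)).
by move=> A; exists (mxvec A); rewrite /= mxvecK.
Qed.

Lemma noethm_fun (T : finType) : noethm (T -> S^o : lmodType S).
Proof.
pose f (v : 'rV[S]_#|T|) : T -> S^o := fun x => v 0 (enum_rank x).
have f_lin : linear f by move=> a u v; apply/funext => x; rewrite /f !mxE.
pose fM := GRing.isLinear.Build S _ _ _ f f_lin.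
pose fL : {linear 'rV[S]_#|T| -> (T -> S^o)} := HB.pack f fM.
apply: (@noethm_surj _ _ fL (@noethm_rV _)) => y.
by exists (\row_i y (enum_val i)); apply/funext => x; rewrite /= /f mxE enum_rankK.
Qed.

Variable m : set S.
Hypothesis lm : local_ring m.

(** Were [1 - a] not invertible, an ideal maximal among the proper ones containing it would be [m],
    and [m] would contain [(1 - a) + a]. *)
Lemma local_unit a : m a -> exists b, b * (1 - a) = 1.
Proof.
case: lm => -[im m1 _] uniq_m ma; apply: contrapT => nu.
pose F : set (set S^o) :=
  [set I | [/\ @submod S^o I, I (1 - a) & ~ I (1 : S)]].
have [||M [[sM Ma M1] Mmax]] := @noethm_max _ F noethm_regular.
- by move=> G [].
- exists [set x | exists b : S, x = b * (1 - a)]; split=> /=; last 1 first.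
  + by move=> [b b1]; apply: nu; exists b.
  + split=> [|c _ _ [b ->] [b' ->]]; first by exists 0; rewrite mul0r.
    by exists (c * b + b'); rewrite mulrDl -mulrA.
  + by exists 1; rewrite mul1r.
have Mm : m = M.
  apply/esym/uniq_m; split=> // I iI I1 MI; apply/seteqP; split=> //.
  by apply: Mmax => //; split=> //; exact: MI.
apply: m1; have -> : 1 = (1 - a) + a by zmod.
by apply: (@subD S^o) => //; rewrite Mm.
Qed.

(* A submodule [G] maximal among those containing [B] and not [Z] satisfies
   [y Z <= G], because [z = g + a y z] forces [z] into [G]. *)
Lemma nakayama X (Z B : set X) y : noethm X -> submod Z -> submod B -> m y ->
  (forall z, Z z -> exists b z', [/\ B b, Z z' & z = b + y *: z']) -> Z `<=` B.
Proof.
move=> nX sZ sB my ZB; apply: contrapT => nZB.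
pose F : set (set X) := [set G | [/\ submod G, B `<=` G & ~ Z `<=` G]].
have [||G [[sG BG nZG] Gmax]] := @noethm_max X F nX; first by move=> G [].
  by exists B; split.
apply: nZG => z /ZB [b [z' [/BG Gb Zz' ->]]]; apply: (subD sG) => //.
apply: contrapT => nGz'.
pose L := [set x | exists a : S, x = a *: (y *: z')].
have sL : submod L.
  split=> [|a _ _ [c ->] [d ->]]; first by exists 0; rewrite scale0r.
  by exists (a * c + d); rewrite scalerDl !scalerA ?mulrA.
have sGL := submod_addsm sG sL.
have LG : L (y *: z') by (exists 1; rewrite scale1r).
have ZGL : Z `<=` addsm G L.
  apply: contrapT => nZ; apply: nGz'.
  have /Gmax FG : F (addsm G L) by split=> //; apply: subset_trans BG _; exact: addsml.
  by apply: FG; [exact: addsml|exact: addsmr].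
have [g [_ [Gg [a ->] z'E]]] := ZGL z' Zz'.
have [|u u1] := @local_unit (a * y).
  by case: lm => -[im _ _] _; apply: (@subZ S^o m).
apply: nGz'; apply: (subZ sG).
have -> : z' = u *: g; last exact: subZ.
have -> : g = (1 - a * y) *: z' by rewrite scalerBl scale1r -scalerA {1}z'E addrK.
by rewrite scalerA u1 scale1r.
Qed.

End Submodules.

Section AddMultiples.
Variables (S : comPzRingType) (X : lmodType S).
Implicit Types (W : set X) (y : S).

Definition addy W y : set X := [set x | exists n, W (x - y *: n)].

Lemma submod_addy W y : submod W -> submod (addy W y).
Proof.
move=> sW; split=> [|a u v [n Wn] [k Wk]].
  by exists 0; rewrite scaler0 subr0; exact: sub0.
exists (a *: n + k).
have -> : a *: u + v - y *: (a *: n + k) = a *: (u - y *: n) + (v - y *: k).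
  by rewrite scalerDr scalerBr !scalerA [y * a]mulrC; zmod.
exact: sW.2.
Qed.

Lemma addyl W y : W `<=` addy W y.
Proof. by move=> x Wx; exists 0; rewrite scaler0 subr0. Qed.

Lemma addyr W y n : submod W -> addy W y (y *: n).
Proof. by move=> sW; exists n; rewrite subrr; exact: sub0. Qed.

Lemma addyC W y z : addy (addy W y) z = addy (addy W z) y.
Proof.
by apply/seteqP; split=> x [n [k Wx]]; exists k, n; move: Wx;
  rewrite -!addrA [- _ - _]addrC.
Qed.

Definition reg_mod W y : Prop := forall n, W (y *: n) -> W n.

End AddMultiples.

(** * Complexes of matrices and their cohomology *)

Section Rows.
Variable S : comPzRingType.
Implicit Types (J : set S).

Definition rowsin p c (V : set 'rV[S]_c) (A : 'M[S]_(p, c)) : Prop :=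
  forall i, V (row i A).

Definition JV J c : set 'rV[S]_c := [set v | forall j, J (v 0 j)].

(** Vectors are rows and matrices act on the right: ['rV_q] modulo [imJ J A] is the cokernel of [A]
    over S/J. *)
Definition imJ J p q (A : 'M[S]_(p, q)) : set 'rV[S]_q :=
  [set u | exists w, JV J (u - w *m A)].

Lemma rowB p c i (A B : 'M[S]_(p, c)) : row i (A - B) = row i A - row i B.
Proof. exact: linearB. Qed.

Lemma rowZ p c i y (A : 'M[S]_(p, c)) : row i (y *: A) = y *: row i A.
Proof. exact: linearZ. Qed.

Lemma rowsin_submod p c (V : set 'rV[S]_c) :
  submod V -> submod [set A : 'M[S]_(p, c) | rowsin V A].
Proof.
move=> sV; split=> [i|a A B VA VB i]; first by rewrite row0; exact: sub0.
by rewrite linearP; apply: sV.2; [exact: VA|exact: VB].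
Qed.

Lemma rowsin_sub p c (V W : set 'rV[S]_c) (A : 'M[S]_(p, c)) :
  V `<=` W -> rowsin V A -> rowsin W A.
Proof. by move=> VW VA i; apply: VW; exact: VA. Qed.

Lemma rowsinT p c (A : 'M[S]_(p, c)) : rowsin [set: _] A.
Proof. by []. Qed.
Hint Resolve rowsinT : core.

Lemma rowsin1 c (V : set 'rV[S]_c) (u : 'rV[S]_c) : rowsin V u <-> V u.
Proof.
split=> [/(_ 0)|Vu i]; first by rewrite (_ : row 0 u = u) //; apply/rowP => j; rewrite mxE.
by rewrite (_ : row i u = u) //; apply/rowP => j; rewrite mxE ord1.
Qed.

Lemma rowsinMl p q c (V : set 'rV[S]_c) (A : 'M[S]_(p, q)) (B : 'M[S]_(q, c)) :
  submod V -> rowsin V B -> rowsin V (A *m B).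
Proof.
move=> sV VB i; rewrite row_mul mulmx_sum_row; apply: (sub_sum sV) => k _.
by apply: (subZ sV); exact: VB.
Qed.

Lemma rowsin_addy p c (V : set 'rV[S]_c) y (A : 'M[S]_(p, c)) :
  rowsin (addy V y) A <-> exists B : 'M[S]_(p, c), rowsin V (A - y *: B).
Proof.
split=> [/choice [f fV]|[B VB] i]; last by exists (row i B); move: (VB i); rewrite rowB rowZ.
exists (\matrix_i f i) => i; move: (fV i).
by rewrite rowB rowZ rowK.
Qed.

Section Ideal.
Variable J : set S.
Hypothesis iJ : is_ideal J.
Let sJ : submod (J : set S^o) := iJ.

Lemma submod_JV c : submod (JV J (c := c)).
Proof.
split=> [j|a u v Ju Jv j]; rewrite !mxE; first exact: (sub0 sJ).
by apply: sJ.2; [exact: Ju|exact: Jv].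
Qed.

Lemma rowsin_JV p c (A : 'M[S]_(p, c)) :
  rowsin (JV J (c := c)) A <-> forall i j, J (A i j).
Proof. by split=> JA i j; have := JA i j; rewrite mxE. Qed.

Lemma rowsin_JVr p q c (A : 'M[S]_(p, q)) (B : 'M[S]_(q, c)) :
  rowsin (JV J (c := q)) A -> rowsin (JV J (c := c)) (A *m B).
Proof.
move=> /rowsin_JV JA; apply/rowsin_JV => i j; rewrite mxE.
by apply: (sub_sum sJ) => k _; rewrite mulrC; apply: (subZ sJ).
Qed.

Lemma JVr q c (u : 'rV[S]_q) (B : 'M[S]_(q, c)) :
  JV J (c := q) u -> JV J (c := c) (u *m B).
Proof. by move=> /rowsin1 Ju; apply/rowsin1; exact: rowsin_JVr. Qed.

Lemma JV_addy c y : JV (addy (J : set S^o) y) (c := c) = addy (JV J (c := c)) y.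
Proof.
apply/seteqP; split=> v; last first.
  by move=> [n Jn] j; exists (n 0 j); have := Jn j; rewrite !mxE.
move=> /choice [f fJ]; exists (\row_j f j) => j; rewrite !mxE; exact: fJ.
Qed.

Lemma reg_JV c y : reg_mod (J : set S^o) y -> reg_mod (JV J (c := c)) y.
Proof. by move=> ry n Jn j; apply: ry; have := Jn j; rewrite mxE. Qed.

Section Image.
Variables (p q : nat) (A : 'M[S]_(p, q)).

Lemma submod_imJ : submod (imJ J A).
Proof.
split=> [|a u v [w Jw] [x Jx]].
  by exists 0; rewrite mul0mx subrr; exact: (sub0 (submod_JV _)).
exists (a *: w + x).
have -> : a *: u + v - (a *: w + x) *m A = a *: (u - w *m A) + (v - x *m A).
  by rewrite mulmxDl -scalemxAl scalerBr; zmod.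
exact: (submod_JV _).2.
Qed.

Lemma JV_imJ : JV J (c := q) `<=` imJ J A.
Proof. by move=> u Ju; exists 0; rewrite mul0mx subr0. Qed.

Lemma imJ_row w : imJ J A (w *m A).
Proof. by exists w; rewrite subrr; exact: (sub0 (submod_JV _)). Qed.

Lemma rowsin_imJ r (M : 'M[S]_(r, q)) :
  rowsin (imJ J A) M <-> exists W : 'M[S]_(r, p), rowsin (JV J (c := q)) (M - W *m A).
Proof.
split=> [/choice [f fJ]|[W JW] i].
  exists (\matrix_i f i) => i; move: (fJ i).
  by rewrite rowB row_mul rowK.
by exists (row i W); move: (JW i); rewrite rowB row_mul.
Qed.

Lemma imJ_addy y : imJ (addy (J : set S^o) y) A = addy (imJ J A) y.
Proof.
apply/seteqP; split=> u.
  move=> [w]; rewrite JV_addy => -[n Jn]; exists n, w.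
  by move: Jn; rewrite -!addrA [- _ - _]addrC.
move=> [n [w Jw]]; exists w; rewrite JV_addy; exists n.
by move: Jw; rewrite -!addrA [- _ - _]addrC.
Qed.

End Image.
End Ideal.
End Rows.
#[global] Hint Resolve rowsinT : core.

Section Complexes.
Variable S : comPzRingType.
Variables (b : nat -> nat) (D : forall i, 'M[S]_(b i.+1, b i)).

Definition Jres (J : set S) : Prop :=
  forall i u, JV J (u *m D i) <-> imJ J (D i.+1) u.

Definition cpx (J : set S) : Prop :=
  forall i, rowsin (JV J (c := _)) (D i.+1 *m D i).

(* [Hz i U W] is the vanishing of H^{i+1} of the complex Hom(D, U / W). *)
Definition Hz i c (U W : set 'rV[S]_c) : Prop :=
  forall v : 'M[S]_(b i.+1, c), rowsin U v -> rowsin W (D i.+1 *m v) ->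
  exists w : 'M[S]_(b i, c), rowsin U w /\ rowsin W (v - D i *m w).

(** Coefficients in all free modules [(S/J)^c], so that cocycles with several columns need no
    splitting; [HzJ_col] reduces this to [c = 1]. *)
Definition HzJ (J : set S) i : Prop :=
  forall c, Hz i [set: 'rV[S]_c] (JV J (c := c)).

Section Ideal.
Variable J : set S.
Hypothesis iJ : is_ideal J.

Lemma Jres_cpx : Jres J -> cpx J.
Proof.
move=> res i k; rewrite row_mul; apply/res; exists (delta_mx 0 k).
by rewrite -rowE subrr; exact: (sub0 (submod_JV iJ _)).
Qed.

Lemma cpxW c (W : set 'rV[S]_c) i (w : 'M[S]_(b i, c)) : cpx J ->
  submod W -> JV J (c := c) `<=` W -> rowsin W (D i.+1 *m (D i *m w)).
Proof.
move=> cD sW JW; rewrite mulmxA; apply: rowsin_sub JW _.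
by apply: rowsin_JVr => //; exact: cD.
Qed.

Hypothesis cD : cpx J.
Variables (c : nat) (W : set 'rV[S]_c).
Hypotheses (sW : submod W) (JW : JV J (c := c) `<=` W).

Let rD r (U : set 'rV[S]_c) (A B : 'M[S]_(r, c)) :
  submod U -> rowsin U A -> rowsin U B -> rowsin U (A + B).
Proof. by move=> sU; exact: (subD (rowsin_submod r sU)). Qed.

Let rB r (U : set 'rV[S]_c) (A B : 'M[S]_(r, c)) :
  submod U -> rowsin U A -> rowsin U B -> rowsin U (A - B).
Proof. by move=> sU; exact: (subB (rowsin_submod r sU)). Qed.

(** Middle term of the long exact sequence of [0 -> V/W -> U/W -> U/V -> 0]. *)
Lemma Hz_ext i (U V : set 'rV[S]_c) : submod U -> submod V ->
  V `<=` U -> W `<=` V -> Hz i V W -> Hz i U V -> Hz i U W.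
Proof.
move=> sU sV VU WV hVW hUV v Uv Wv.
have [w [Uw Vw]] := hUV v Uv (rowsin_sub WV Wv).
have [|x [Vx Wx]] := hVW (v - D i *m w) Vw.
  by rewrite mulmxBr; apply: rB => //; exact: cpxW.
exists (w + x); split; first by apply: rD => //; exact: rowsin_sub VU Vx.
by rewrite mulmxDr opprD addrA.
Qed.

(** Third term of the same sequence: the obstruction to correcting [v] into a cocycle modulo [W]
    lies in the next cohomology of V/W. *)
Lemma Hz_quot i (U V : set 'rV[S]_c) : submod U -> submod V ->
  V `<=` U -> W `<=` V -> Hz i U W -> Hz i.+1 V W -> Hz i U V.
Proof.
move=> sU sV VU WV hUW hVW v Uv Vv.
have [|w [Vw Ww]] := hVW _ Vv; first exact: cpxW.
have [||x [Ux Wx]] := hUW (v - w).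
- by apply: rB => //; exact: rowsin_sub VU Vw.
- by rewrite mulmxBr.
exists x; split=> //.
have -> : v - D i *m x = (v - w - D i *m x) + w by zmod.
by apply: rD => //; exact: rowsin_sub WV Wx.
Qed.

(** Multiplication by [u] identifies ['rV_c / V] with [addy W u / W]. *)
Lemma Hz_mul i (V : set 'rV[S]_c) u : submod V ->
  (forall n, W (u *: n) <-> V n) -> Hz i setT V -> Hz i (addy W u) W.
Proof.
move=> sV WuV hV v /rowsin_addy [v' Wv'] Wv.
have rV r (n : 'M[S]_(r, c)) : rowsin W (u *: n) <-> rowsin V n.
  split=> H k; first by apply/WuV; rewrite -rowZ; exact: H.
  by rewrite rowZ; apply/WuV; exact: H.
have [//||w [_ Vw]] := hV v'.
  apply/rV; rewrite scalemxAr.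
  have -> : D i.+1 *m (u *: v') = D i.+1 *m v - D i.+1 *m (v - u *: v').
    by rewrite mulmxBr; zmod.
  by apply: rB => //; exact: rowsinMl.
exists (u *: w); split.
  by apply/rowsin_addy; exists w; rewrite subrr; exact: (sub0 (rowsin_submod _ sW)).
have -> : v - D i *m (u *: w) = (v - u *: v') + u *: (v' - D i *m w).
  by rewrite -scalemxAr scalerBr; zmod.
by apply: rD => //; apply/rV.
Qed.

Lemma Hz_addy i y : reg_mod W y -> Hz i setT W -> Hz i.+1 setT W ->
  Hz i setT (addy W y).
Proof.
move=> ry hi hi1; apply: (@Hz_quot i setT (addy W y)) => //.
- exact: submod_addy.
- exact: addyl.
by apply: (@Hz_mul _ W) => // n; split=> [|Wn]; [exact: ry|exact: subZ].
Qed.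

(** Nakayama is applied to cocycles and coboundaries modulo [W]: a cocycle differs from a coboundary
    by some [y *: n], and [n] is again a cocycle because [y] is regular. *)
Lemma Hz_nakayama (m : set S) i y : noetherian S -> local_ring m -> m y ->
  reg_mod W y -> Hz i setT (addy W y) -> Hz i setT W.
Proof.
move=> nS lm my ry hy v _ Wv.
pose Z := [set v : 'M[S]_(b i.+1, c) | rowsin W (D i.+1 *m v)].
pose B := [set v : 'M[S]_(b i.+1, c) | exists w, rowsin W (v - D i *m w)].
have sZ : submod Z.
  exact: (submod_preimage (mulmx (D i.+1)) (rowsin_submod _ sW)).
have sB : submod B.
  split=> [|a u u' [w Ww] [w' Ww']].
    by exists 0; rewrite mulmx0 subrr; exact: (sub0 (rowsin_submod _ sW)).
  exists (a *: w + w').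
  have -> : a *: u + u' - D i *m (a *: w + w') =
            a *: (u - D i *m w) + (u' - D i *m w').
    by rewrite mulmxDr -scalemxAr scalerBr; zmod.
  exact: (rowsin_submod _ sW).2.
suff /(_ v Wv) [w Ww] : Z `<=` B by exists w.
refine (@nakayama S nS m lm _ Z B y (@noethm_M S nS _ _) sZ sB my _) => z Wz.
have [//||w [_ /rowsin_addy [n Wn]]] := hy z.
  by apply: rowsin_sub Wz; exact: addyl.
exists (z - y *: n), n; split; last by zmod.
  exists w; have -> : z - y *: n - D i *m w = z - D i *m w - y *: n by zmod.
  exact: Wn.
suff Wyn : rowsin W (D i.+1 *m (y *: n)).
  by move=> k; apply: ry; rewrite -rowZ scalemxAr; exact: Wyn.
have -> : D i.+1 *m (y *: n) =
    D i.+1 *m z - D i.+1 *m (D i *m w) - D i.+1 *m (z - D i *m w - y *: n).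
  by rewrite !mulmxBr; zmod.
apply: (rB sW); last exact: rowsinMl.
by apply: (rB sW) => //; exact: cpxW.
Qed.

End Ideal.
End Complexes.

(* [D] is a free resolution, modulo [J], of M = coker (D 0) = S^(b 0) / imJ J (D 0);
   [SACrel J] is (SAC) for S/J. *)
Definition SACrel (S : comPzRingType) (J : set S) : Prop :=
  forall b (D : forall i, 'M[S]_(b i.+1, b i)), Jres D J ->
    (forall i, HzJ D J i) ->
    (exists n, forall i, (n <= i)%N -> Hz D i setT (imJ J (D 0%N))) ->
    forall i, Hz D i setT (imJ J (D 0%N)).

Definition mx_expand := (mulmxBr, mulmxBl, mulmxDr, mulmxDl, mulmxN, mulNmx,
  scalerBr, scalerDr, scalerN, mulmxA, scalerA).

Ltac mx_zmod := rewrite ?mx_expand -?scalemxAl -?scalemxAr ?mx_expand; zmod.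

Section RowsClosure.
Variables (S : comPzRingType) (c : nat) (W : set 'rV[S]_c).
Hypothesis sW : submod W.

Lemma rowsinD r (A B : 'M[S]_(r, c)) :
  rowsin W A -> rowsin W B -> rowsin W (A + B).
Proof. exact: (subD (rowsin_submod r sW)). Qed.

Lemma rowsinN r (A : 'M[S]_(r, c)) : rowsin W A -> rowsin W (- A).
Proof. exact: (subN (rowsin_submod r sW)). Qed.

Lemma rowsinB r (A B : 'M[S]_(r, c)) :
  rowsin W A -> rowsin W B -> rowsin W (A - B).
Proof. exact: (subB (rowsin_submod r sW)). Qed.

Lemma rowsin_col p q (A : 'M[S]_(p, c)) (B : 'M[S]_(q, c)) :
  rowsin W (col_mx A B) <-> rowsin W A /\ rowsin W B.
Proof.
split=> [H|[HA HB] i].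
  by split=> i; [rewrite -(rowKu i A B)|rewrite -(rowKd i A B)]; exact: H.
by rewrite -(splitK i); case: (fintype.split i) => j /=; rewrite ?rowKu ?rowKd.
Qed.

End RowsClosure.

(** * Dimension shifting in the coefficients *)

Section Syzygy.
Variables (S : comPzRingType) (J : set S).
Hypothesis iJ : is_ideal J.
Variables (b : nat -> nat) (D : forall i, 'M[S]_(b i.+1, b i)).
Hypotheses (cD : cpx D J) (hJ : forall i, HzJ D J i).
Variables (o p q : nat) (A : 'M[S]_(p, q)) (B : 'M[S]_(o, p)).
Hypothesis AB : forall u, JV J (u *m A) <-> imJ J B u.

Let sJ c : submod (JV J (c := c)) := submod_JV iJ c.
#[local] Hint Resolve sJ : core.

Let rowsAB r (M : 'M[S]_(r, p)) :
  rowsin (JV J (c := _)) (M *m A) <-> rowsin (imJ J B) M.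
Proof. by split=> H i; [apply/AB|rewrite row_mul; apply/AB]; rewrite -?row_mul. Qed.

(** By [AB], the cokernel of [B] is the image of [A] modulo [J], the first syzygy of the cokernel of
    [A]. The middle term of that sequence is free, and its cohomology vanishes by [hJ]. *)
Lemma Hz_syzygy i :
  Hz D i setT (imJ J A) <-> Hz D i.+1 setT (imJ J B).
Proof.
split=> H v _.
  move=> /rowsAB Bv; have [//||x [_ Jx]] := @hJ i.+1 _ (v *m A).
    by rewrite mulmxA.
  have [//||w [_ /rowsin_imJ [u Ju]]] := H x.
    by apply/rowsin_imJ; exists v; rewrite -opprB; exact: rowsinN.
  exists u; split=> //; apply/rowsAB.
  have -> : (v - D i.+1 *m u) *m A = (v *m A - D i.+1 *m x) +
     (D i.+1 *m (x - D i *m w - u *m A) + D i.+1 *m (D i *m w)) by mx_zmod.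
  apply: rowsinD => //; apply: rowsinD => //; first exact: rowsinMl.
  exact: (cpxW iJ).
move=> /rowsin_imJ [z Jz]; have [//||w [_ /rowsAB Bw]] := H z.
  apply/rowsAB.
  have -> : D i.+2 *m z *m A = D i.+2 *m (D i.+1 *m v) -
     D i.+2 *m (D i.+1 *m v - z *m A) by mx_zmod.
  by apply: rowsinB => //; [exact: (cpxW iJ)|exact: rowsinMl].
have [//||x [_ Jx]] := @hJ i _ (v - w *m A).
  have -> : D i.+1 *m (v - w *m A) =
    (D i.+1 *m v - z *m A) + (z - D i.+1 *m w) *m A by mx_zmod.
  exact: rowsinD.
exists x; split=> //; apply/rowsin_imJ; exists w.
by have -> : v - D i *m x - w *m A = v - w *m A - D i *m x by zmod.
Qed.

End Syzygy.

(** * Change of rings along a regular element *)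

Section Resolutions.
Variables (S : comPzRingType) (J : set S) (y : S).
Hypotheses (iJ : is_ideal J) (ry : reg_mod (J : set S^o) y).
Let sJ c : submod (JV J (c := c)) := submod_JV iJ c.
#[local] Hint Resolve sJ : core.
Variables (b : nat -> nat) (D : forall i, 'M[S]_(b i.+1, b i)).

(** The map [D i] embeds this cokernel into a free module over S/J, where [y] is regular. *)
Lemma Jres_reg i : Jres D J -> reg_mod (imJ J (D i.+1)) y.
Proof.
move=> res u /res; rewrite -scalemxAl => Ju; apply/res; exact: (reg_JV ry).
Qed.

(** Since [y] is regular on S/J, Tor with its quotient by [y] can be nonzero only in degrees 0 and
    1, which costs one shift. *)
Lemma Jres_shift_addy : Jres D J -> Jres (fun i => D i.+1) (addy (J : set S^o) y).
Proof.
move=> res i u; rewrite (JV_addy J _ y) (imJ_addy J (D i.+2) y).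
have cD := Jres_cpx iJ res; split=> [[n Jn]|[n /res Jn]].
  have /res [w Jw] : JV J (n *m D i).
    apply: (reg_JV ry); rewrite scalemxAl.
    have -> : (y *: n) *m D i = u *m (D i.+1 *m D i) - (u *m D i.+1 - y *: n) *m D i.
      by mx_zmod.
    apply: (subB (sJ _)); last exact: JVr.
    by apply/rowsin1; apply: rowsinMl => //; exact: cD.
  exists w; apply/res.
  have -> : (u - y *: w) *m D i.+1 =
    (u *m D i.+1 - y *: n) + y *: (n - w *m D i.+1) by mx_zmod.
  by apply: (subD (sJ _)) => //; exact: (subZ (sJ _)).
exists (n *m D i.+1); move: Jn; rewrite mulmxBl -scalemxAl; exact.
Qed.

End Resolutions.

Lemma ideal_addy (S : comPzRingType) (J : set S) y :
  is_ideal J -> is_ideal (addy (J : set S^o) y).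
Proof. exact: (@submod_addy S S^o J y). Qed.

Lemma SACrel_lift (S : comPzRingType) (m J : set S) y :
  noetherian S -> local_ring m -> m y -> is_ideal J ->
  reg_mod (J : set S^o) y -> SACrel (addy (J : set S^o) y) -> SACrel J.
Proof.
move=> nS lm my iJ ry sac b D res hJ [n hM].
have cD := Jres_cpx iJ res.
(* The right-hand side concerns the self-extensions of the first syzygy, in the same degree with
   respect to the shifted resolution; hypothesis and goal are both moved there. *)
have syz i := Hz_syzygy iJ cD hJ (res 0%N) i.
have sV' := submod_imJ iJ (D 1).
have JV' := @JV_imJ _ J _ _ (D 1).
have rV' := @Jres_reg _ _ _ ry _ _ 0%N res.
pose D' i := D i.+1; have cD' : cpx D' J by move=> i; exact: cD.
move=> i; apply/syz.
apply: (@Hz_nakayama _ _ D' _ iJ cD' _ _ sV' JV' m i y nS lm my rV').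
rewrite -imJ_addy; apply: (sac _ D'); first exact: Jres_shift_addy.
  move=> j c; rewrite JV_addy.
  apply: (@Hz_addy _ _ D' _ iJ cD' _ _ (submod_JV iJ c)) => //.
  - exact: reg_JV.
  - exact: hJ.
  - exact: hJ.
exists n => j nj; rewrite imJ_addy.
apply: (@Hz_addy _ _ D' _ iJ cD' _ _ sV' JV' _ _ rV'); apply/syz; apply: hM => //.
exact: leqW.
Qed.

Section Cone.
Variables (S : comPzRingType) (J : set S) (y : S).
Hypotheses (iJ : is_ideal J) (ry : reg_mod (J : set S^o) y).
Let sJ c : submod (JV J (c := c)) := submod_JV iJ c.
#[local] Hint Resolve sJ : core.
Variables (b : nat -> nat) (D : forall i, 'M[S]_(b i.+1, b i)).
Variable h : forall i, 'M[S]_(b i.+2, b i).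
Hypothesis hD : forall i, rowsin (JV J (c := _)) (D i.+1 *m D i - y *: h i).

(* If [D] is a complex modulo [(J, y)] with [D^2 = y h], then the cone of [y]
   corrected by the homotopy [h] is a complex modulo [J]. *)
Definition cone i : 'M[S]_(b i.+2 + b i.+1, b i.+1 + b i) :=
  block_mx (D i.+1) (- h i) y%:M (- D i).

Lemma cone_row i (u : 'rV_(b i.+2)) (v : 'rV_(b i.+1)) :
  row_mx u v *m cone i =
  row_mx (u *m D i.+1 + y *: v) (- (u *m h i) - v *m D i).
Proof. by rewrite mul_row_block mul_mx_scalar !mulmxN. Qed.

Lemma cone_col i c (p : 'M_(b i.+1, c)) (q : 'M_(b i, c)) :
  cone i *m col_mx p q =
  col_mx (D i.+1 *m p - h i *m q) (y *: p - D i *m q).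
Proof. by rewrite mul_block_col mul_scalar_mx !mulNmx. Qed.

(** Both bracketings of the triple product of the [D] agree, so [y] times the difference lies in
    [J], and [y] cancels. *)
Lemma cone_comm i :
  rowsin (JV J (c := _)) (h i.+1 *m D i - D i.+2 *m h i).
Proof.
suff H : rowsin (JV J (c := _)) (y *: (h i.+1 *m D i - D i.+2 *m h i)).
  by move=> k; apply: (reg_JV ry); rewrite -rowZ; exact: H.
have -> : y *: (h i.+1 *m D i - D i.+2 *m h i) =
  D i.+2 *m (D i.+1 *m D i - y *: h i) -
  (D i.+2 *m D i.+1 - y *: h i.+1) *m D i by mx_zmod.
apply: rowsinB => //; first exact: rowsinMl.
exact: rowsin_JVr.
Qed.

Lemma JV_row p q (u : 'rV[S]_p) (v : 'rV[S]_q) :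
  JV J (row_mx u v) <-> JV J u /\ JV J v.
Proof.
split=> [H|[Hu Hv] j].
  by split=> j; [rewrite -(row_mxEl u v)|rewrite -(row_mxEr u v)]; exact: H.
by rewrite mxE; case: splitP.
Qed.

Lemma cone_cpx : cpx cone J.
Proof.
move=> i k; rewrite rowE mulmxA; move: (delta_mx 0 k) => w.
rewrite -[w]hsubmxK; move: (lsubmx w) (rsubmx w) => u v {w}.
rewrite !cone_row; apply/JV_row.
have JuD j l (w : 'rV_l) (M : 'M_(l, j)) :
    rowsin (JV J (c := _)) M -> JV J (w *m M).
  by move=> JM; apply/rowsin1; exact: rowsinMl.
split.
  have -> : (u *m D i.+2 + y *: v) *m D i.+1 + y *: (- (u *m h i.+1) - v *m D i.+1)
    = u *m (D i.+2 *m D i.+1 - y *: h i.+1) by mx_zmod.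
  exact: JuD.
have -> : - ((u *m D i.+2 + y *: v) *m h i) - (- (u *m h i.+1) - v *m D i.+1) *m D i
  = u *m (h i.+1 *m D i - D i.+2 *m h i) + v *m (D i.+1 *m D i - y *: h i).
  by mx_zmod.
by apply: (subD (sJ _)); apply: JuD => //; exact: cone_comm.
Qed.

(** The lower block [q] of a cocycle is a cocycle modulo [y]. A primitive [D i *m r + y *: r'] of it
    yields one of the whole cochain, since the identity for the upper block holds after
    multiplication by [y]. *)
Lemma cone_HzJ i : HzJ D (addy (J : set S^o) y) i -> HzJ cone J i.
Proof.
move=> hi c v _; rewrite -[v]vsubmxK; move: (usubmx v) (dsubmx v) => p q {v}.
rewrite cone_col => /rowsin_col [Jp Jq].
have [//||r [_]] := hi c q.
  rewrite JV_addy; apply/rowsin_addy; exists p.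
  by rewrite -opprB; exact: rowsinN.
rewrite JV_addy => /rowsin_addy [r' Jr].
exists (col_mx r' (- r)); split=> //; rewrite cone_col opp_col_mx add_col_mx.
apply/rowsin_col; split; last first.
  by have -> : q - (y *: r' - D i *m - r) = q - D i *m r - y *: r' by mx_zmod.
suff H : rowsin (JV J (c := c)) (y *: (p - (D i.+1 *m r' - h i *m - r))).
  by move=> k; apply: (reg_JV ry); rewrite -rowZ; exact: H.
have -> : y *: (p - (D i.+1 *m r' - h i *m - r)) =
    (y *: p - D i.+1 *m q) + (D i.+1 *m (q - D i *m r - y *: r') +
    (D i.+1 *m D i - y *: h i) *m r) by mx_zmod.
apply: rowsinD => //; apply: rowsinD => //; first exact: rowsinMl.
exact: rowsin_JVr.
Qed.

(** A vector killed by [D i.+1] modulo [y], say with value [y *: n], completes to the vector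
    [(u, -n)] killed by the cone. *)
Lemma cone_rows i : (forall u, JV J (u *m cone i) -> imJ J (cone i.+1) u) ->
  forall u, JV (addy (J : set S^o) y) (u *m D i.+1) ->
    imJ (addy (J : set S^o) y) (D i.+2) u.
Proof.
move=> ex u; rewrite JV_addy => -[n Jn].
have [|w] := ex (row_mx u (- n)).
  rewrite cone_row; apply/JV_row; split.
    by have -> : u *m D i.+1 + y *: - n = u *m D i.+1 - y *: n by mx_zmod.
  apply: (reg_JV ry).
  have -> : y *: (- (u *m h i) - - n *m D i) = u *m (D i.+1 *m D i - y *: h i)
    - (u *m D i.+1 - y *: n) *m D i by mx_zmod.
  apply: (subB (sJ _)); last exact: JVr.
  by apply/rowsin1; exact: rowsinMl.
rewrite -[w]hsubmxK; move: (lsubmx w) (rsubmx w) => s t.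
rewrite cone_row opp_row_mx add_row_mx => /JV_row [Js _].
rewrite imJ_addy; exists t, s.
by have -> : u - y *: t - s *m D i.+2 = u - (s *m D i.+2 + y *: t) by mx_zmod.
Qed.

Lemma cone_res : Jres D (addy (J : set S^o) y) -> Jres cone J.
Proof.
move=> res i u; split; last first.
  move=> [w Jw]; rewrite -[u](subrK (w *m cone i.+1)) mulmxDl.
  apply: (subD (sJ _)); first exact: JVr.
  by rewrite -mulmxA; apply/rowsin1; apply: rowsinMl => //; exact: cone_cpx.
rewrite -[u]hsubmxK; move: (lsubmx u) (rsubmx u) => {}u v.
rewrite cone_row => /JV_row [Ju _].
have : JV (addy (J : set S^o) y) (u *m D i.+1).
  by rewrite JV_addy; exists (- v); move: Ju; rewrite scalerN opprK.
move=> /res; rewrite imJ_addy => -[t [s Js]].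
exists (row_mx s t); rewrite cone_row opp_row_mx add_row_mx; apply/JV_row.
have J1 : JV J (u - (s *m D i.+2 + y *: t)).
  by have -> : u - (s *m D i.+2 + y *: t) = u - y *: t - s *m D i.+2 by mx_zmod.
split=> //; apply: (reg_JV ry).
have -> : y *: (v - (- (s *m h i.+1) - t *m D i.+1)) =
    (u *m D i.+1 + y *: v) - (u - (s *m D i.+2 + y *: t)) *m D i.+1 -
    s *m (D i.+2 *m D i.+1 - y *: h i.+1) by mx_zmod.
apply: (subB (sJ _)); first by apply: (subB (sJ _)) => //; exact: JVr.
by apply/rowsin1; exact: rowsinMl.
Qed.

Section Coefficients.
Variables (c : nat) (W : set 'rV[S]_c).
Hypotheses (sW : submod W) (JW : JV J (c := c) `<=` W) (yW : forall n, W (y *: n)).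

Let Wl r s (M : 'M_(r, s)) (v : 'M_(s, c)) :
  rowsin (JV J (c := _)) M -> rowsin W (M *m v).
Proof. by move=> JM; apply: rowsin_sub JW _; exact: rowsin_JVr. Qed.

Let Wy r (v : 'M_(r, c)) : rowsin W (y *: v).
Proof. by move=> i; rewrite rowZ. Qed.

Lemma cone_Hz i : Hz D i setT W -> Hz D i.+1 setT W -> Hz cone i setT W.
Proof.
move=> hi hi1 v _; rewrite -[v]vsubmxK; move: (usubmx v) (dsubmx v) => p q {v}.
rewrite cone_col => /rowsin_col [Wp Wq].
have [//||r [_ Wr]] := hi q.
  have -> : D i.+1 *m q = y *: p - (y *: p - D i.+1 *m q) by zmod.
  exact: rowsinB.
have [//||s [_ Ws]] := hi1 (p - h i *m r).
  have -> : D i.+2 *m (p - h i *m r) = (D i.+2 *m p - h i.+1 *m q) +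
     (h i.+1 *m (q - D i *m r) + (h i.+1 *m D i - D i.+2 *m h i) *m r) by mx_zmod.
  apply: rowsinD => //; apply: rowsinD => //; first exact: rowsinMl.
  by apply: Wl; exact: cone_comm.
exists (col_mx s (- r)); split=> //; rewrite cone_col opp_col_mx add_col_mx.
apply/rowsin_col; split.
  by have -> : p - (D i.+1 *m s - h i *m - r) = p - h i *m r - D i.+1 *m s by mx_zmod.
have -> : q - (y *: s - D i *m - r) = (q - D i *m r) - y *: s by mx_zmod.
exact: rowsinB.
Qed.

(** As [y] kills the coefficients, the cohomology of the cone and that of [D] in two shifts form a
    change-of-rings sequence whose connecting map is multiplication by [h]; vanishing two degrees
    higher makes that map zero. *)
Lemma Hz_cone i : Hz cone i setT W -> Hz D i.+2 setT W -> Hz D i setT W.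
Proof.
move=> hC hi2 q _ Wq.
have [//||p [_ Wp]] := hi2 (h i.+1 *m q).
  have -> : D i.+3 *m (h i.+1 *m q) = h i.+2 *m (D i.+1 *m q) -
    (h i.+2 *m D i.+1 - D i.+3 *m h i.+1) *m q by mx_zmod.
  by apply: rowsinB => //; [exact: rowsinMl|apply: Wl; exact: cone_comm].
have [//||w [_]] := hC (col_mx p q).
  rewrite cone_col; apply/rowsin_col; split; last exact: rowsinB.
  by rewrite -opprB; exact: rowsinN.
rewrite -[w]vsubmxK; move: (usubmx w) (dsubmx w) => s t.
rewrite cone_col opp_col_mx add_col_mx => /rowsin_col [_ Wst].
exists (- t); split=> //.
have -> : q - D i *m - t = (q - (y *: s - D i *m t)) + y *: s by mx_zmod.
exact: rowsinD.
Qed.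

End Coefficients.
End Cone.

Lemma cone_homotopy (S : comPzRingType) (J : set S) y b
    (D : forall i, 'M[S]_(b i.+1, b i)) : is_ideal J -> cpx D (addy (J : set S^o) y) ->
  exists h : forall i, 'M[S]_(b i.+2, b i),
    forall i, rowsin (JV J (c := _)) (D i.+1 *m D i - y *: h i).
Proof.
move=> iJ cD.
have H i : exists h : 'M[S]_(b i.+2, b i), rowsin (JV J (c := _)) (D i.+1 *m D i - y *: h).
  by apply/rowsin_addy => k; rewrite -JV_addy; exact: cD.
exists (fun i => sval (cid (H i))) => i; exact: (svalP (cid (H i))).
Qed.

Lemma SACrel_descend (S : comPzRingType) (J : set S) y : is_ideal J ->
  reg_mod (J : set S^o) y -> SACrel J -> SACrel (addy (J : set S^o) y).
Proof.
move=> iJ ry sac b D res hJ [n hM].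
have iJy := ideal_addy y iJ.
have [h hD] := cone_homotopy iJ (Jres_cpx iJy res).
pose C := cone y D h.
have resC : Jres C J := cone_res iJ ry hD res.
have hC i : HzJ C J i by apply: (cone_HzJ iJ ry hD); exact: hJ.
have cC := Jres_cpx iJ resC.
pose V0 := imJ (addy (J : set S^o) y) (D 0%N).
have sV0 : submod V0 by exact: submod_imJ.
have yV0 u : V0 (y *: u) by rewrite /V0 imJ_addy; apply: addyr; exact: submod_imJ.
have JV0 : JV J (c := _) `<=` V0.
  by rewrite /V0 imJ_addy => u Ju; apply: addyl; exact: JV_imJ.
(* The last map of the full cone, which presents the module over S/J. The family [C] starts one step
   later and therefore resolves the first syzygy. *)
pose A : 'M[S]_(b 1 + b 0%N, b 0%N) := col_mx (D 0%N) y%:M.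
have AV0 : imJ J A = V0.
  rewrite /V0 imJ_addy; apply/seteqP; split=> u.
    move=> [w]; rewrite -[w]hsubmxK mul_row_col mul_mx_scalar => Jw.
    exists (rsubmx w), (lsubmx w).
    by move: Jw; rewrite opprD addrA addrAC.
  move=> [t [s Js]]; exists (row_mx s t); rewrite mul_row_col mul_mx_scalar.
  by move: Js; rewrite opprD addrA addrAC.
have AB u : JV J (u *m A) <-> imJ J (C 0%N) u.
  rewrite -[u]hsubmxK; move: (lsubmx u) (rsubmx u) => s t.
  rewrite mul_row_col mul_mx_scalar; split=> [Ju|[w]].
    have : JV (addy (J : set S^o) y) (s *m D 0%N).
      by rewrite JV_addy; exists (- t); move: Ju; rewrite scalerN opprK.
    move=> /res; rewrite imJ_addy => -[x [w Jw]].
    exists (row_mx w x); rewrite cone_row opp_row_mx add_row_mx; apply/JV_row.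
    have J1 : JV J (s - (w *m D 1 + y *: x)).
      by have -> : s - (w *m D 1 + y *: x) = s - y *: x - w *m D 1 by zmod.
    split=> //; apply: (reg_JV ry).
    have -> : y *: (t - (- (w *m h 0%N) - x *m D 0%N)) =
      (s *m D 0%N + y *: t) - (s - (w *m D 1 + y *: x)) *m D 0%N -
      w *m (D 1 *m D 0%N - y *: h 0%N) by mx_zmod.
    apply: (subB (submod_JV iJ _)).
      by apply: (subB (submod_JV iJ _)) => //; exact: JVr.
    by apply/rowsin1; apply: rowsinMl; [exact: submod_JV|exact: hD].
  rewrite -[w]hsubmxK; move: (lsubmx w) (rsubmx w) => w1 w2.
  rewrite cone_row opp_row_mx add_row_mx => /JV_row [J1 J2].
  have -> : s *m D 0%N + y *: t = (s - (w1 *m D 1 + y *: w2)) *m D 0%N +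
     (y *: (t - (- (w1 *m h 0%N) - w2 *m D 0%N)) +
      w1 *m (D 1 *m D 0%N - y *: h 0%N)) by mx_zmod.
  apply: (subD (submod_JV iJ _)); first exact: JVr.
  apply: (subD (submod_JV iJ _)); first exact: (subZ (submod_JV iJ _)).
  by apply/rowsin1; apply: rowsinMl; [exact: submod_JV|exact: hD].
have syz i : Hz C i setT V0 <-> Hz C i.+1 setT (imJ J (C 0%N)).
  by rewrite -AV0; exact: Hz_syzygy.
have hCN i : Hz C i setT (imJ J (C 0%N)).
  apply: sac => //; exists n.+1 => -[//|j] nj; apply/syz.
  by apply: (cone_Hz iJ ry hD) => //; apply: hM => //; exact: leqW.
(* Descending induction on the degree: [Hz_cone] reaches [i] from [i.+2]. *)
suff H k i : (n <= i + k)%N -> Hz D i setT V0.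
  by move=> i; apply: (H n); rewrite leq_addl.
elim: k i => [|k IH] i; first by rewrite addn0; exact: hM.
rewrite addnS -addSn => nik; apply: (Hz_cone iJ ry hD) => //.
  by apply/syz; exact: hCN.
by apply: IH; apply: leq_trans nik _; rewrite leq_add2r.
Qed.

(** * Length at a prime *)

Section Chains.
Variables (S : comPzRingType) (E : set S).
Hypothesis EM : forall s t, E s -> E t -> E (s * t).
Implicit Types (X Y : lmodType S).

(* Strict inclusion after inverting the elements of [E]; hence [ch B Z n] says
   that the localisation of Z / B at [E] has length at least [n]. *)
Definition big X (G G' : set X) : Prop :=
  exists2 e, G' e & forall s, E s -> ~ G (s *: e).

Fixpoint ch X (B Z : set X) n : Prop :=
  if n is n'.+1 then exists G, [/\ submod G, ch B G n', G `<=` Z & big G Z]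
  else B `<=` Z.

Lemma ch_sub X (B Z : set X) n : ch B Z n -> B `<=` Z.
Proof.
elim: n Z => [//|n IH] Z [G [_ /IH BG GZ _]]; exact: subset_trans BG GZ.
Qed.

Lemma ch_mono X (B Z Z' : set X) n : Z `<=` Z' -> ch B Z n -> ch B Z' n.
Proof.
case: n => [|n] ZZ' /=; first by move=> BZ; exact: subset_trans BZ ZZ'.
move=> [G [sG cG GZ [e /ZZ' Ze He]]]; exists G; split=> //; last by exists e.
exact: subset_trans GZ ZZ'.
Qed.

Lemma ch_anti X (B B' Z : set X) n : B' `<=` B -> ch B Z n -> ch B' Z n.
Proof.
move=> BB; elim: n Z => [|n IH] Z /=; first exact: subset_trans.
by move=> [G [sG /IH cG GZ bG]]; exists G.
Qed.

Lemma ch_cat X (A B C : set X) n k : ch A B n -> ch B C k -> ch A C (k + n).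
Proof.
move=> AB; elim: k C => [|k IH] C /=; first by move=> BC; exact: ch_mono BC AB.
by move=> [G [sG /IH cG GZ bG]]; exists G.
Qed.

Lemma ch_leq X (B Z : set X) n k : ch B Z n -> (k <= n)%N -> ch B Z k.
Proof.
elim: n Z => [|n IH] Z; first by rewrite leqn0 => cB /eqP ->.
move=> /= [G [sG cG GZ bG]]; rewrite leq_eqVlt => /orP [/eqP ->|]; first by exists G.
by rewrite ltnS => kn; apply: (ch_mono GZ); exact: IH.
Qed.

Lemma ch1 X (B Z : set X) e : submod B -> B `<=` Z -> Z e ->
  (forall s, E s -> ~ B (s *: e)) -> ch B Z 1.
Proof. by move=> sB BZ Ze He; exists B; split=> //; exists e. Qed.

(** Subadditivity of length. A strict step with witness [e] stays strict modulo [K] unless some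
    [s *: e] falls into [G + K]; its [K]-part then witnesses strictness after intersection with
    [K]. *)
Lemma ch_split X (B Z K : set X) n : submod Z -> submod K -> ch B Z n ->
  exists n1 n2, [/\ (n <= n1 + n2)%N, ch (B `&` K) (Z `&` K) n1 &
    ch (addsm B K) (addsm Z K) n2].
Proof.
move=> sZ sK; elim: n Z sZ => [|n IH] Z sZ /=.
  move=> BZ; exists 0%N, 0%N; split=> //= x.
    by move=> [/BZ Zx Kx].
  by move=> [g [h [/BZ Zg Kh ->]]]; exists g, h.
move=> [G [sG cG GZ [e Ze He]]]; have [n1 [n2 [nn c1 c2]]] := IH G sG cG.
have GKZK : addsm G K `<=` addsm Z K by move=> _ [g [h [/GZ Zg Kh ->]]]; exists g, h.
have GKZK' : G `&` K `<=` Z `&` K by move=> x [/GZ].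
have [[s Es [g [k [Gg Kk se]]]]|no] := pselect (exists2 s, E s & addsm G K (s *: e)).
  exists n1.+1, n2; split; [by rewrite addSn ltnS| |exact: ch_mono GKZK c2].
  exists (G `&` K); split=> //; first exact: submodI.
  have kE : k = s *: e - g by rewrite se; zmod.
  exists k; first by split=> //; rewrite kE; apply: (subB sZ); [exact: subZ|exact: GZ].
  move=> t Et [Gtk _]; apply: (He (t * s)); first exact: EM.
  by rewrite -scalerA se scalerDr; apply: (subD sG) => //; exact: subZ.
exists n1, n2.+1; split; [by rewrite addnS ltnS|exact: ch_mono GKZK' c1|].
exists (addsm G K); split=> //; first exact: submod_addsm.
exists e; first exact: addsml.
by move=> s Es GKs; apply: no; exists s.
Qed.

(** The map [f] sends [A] onto [Z] modulo [B], so preimages of a strict chain remain strict. *)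
Lemma ch_pull X Y (f : {linear X -> Y}) (A : set X) (B Z : set Y) n :
  submod A -> submod Z -> (forall z, Z z -> exists2 a, A a & B (z - f a)) ->
  ch B Z n -> ch (A `&` f @^-1` B) (A `&` f @^-1` Z) n.
Proof.
move=> sA; elim: n Z => [|n IH] Z sZ /= fZ; first by move=> BZ x [Ax /BZ].
move=> [G [sG cG GZ [e Ze He]]]; have BG := ch_sub cG.
exists (A `&` f @^-1` G); split.
- by apply: submodI => //; exact: submod_preimage.
- by apply: IH => // z /GZ; exact: fZ.
- by move=> x [Ax /GZ].
have [a Aa Ba] := fZ e Ze; have faE : f a = e - (e - f a) by zmod.
exists a; first by split=> //=; rewrite faE; apply: (subB sZ) => //; apply: GZ; exact: BG.
move=> s Es [_ /=]; rewrite linearZ /= => Gsa; apply: (He s Es).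
have -> : s *: e = s *: f a + s *: (e - f a) by rewrite -scalerDr; congr (_ *: _); zmod.
by apply: (subD sG) => //; apply: (subZ sG); exact: BG.
Qed.

Definition addmul X (K Z : set X) u : set X :=
  [set x | exists2 n, Z n & K (x - u *: n)].

Lemma submod_addmul X (K Z : set X) u :
  submod K -> submod Z -> submod (addmul K Z u).
Proof.
move=> sK sZ; split=> [|a x x' [n Zn Kn] [n' Zn' Kn']].
  by exists 0; [exact: sub0|rewrite scaler0 subr0; exact: sub0].
exists (a *: n + n'); first exact: sZ.2.
have -> : a *: x + x' - u *: (a *: n + n') = a *: (x - u *: n) + (x' - u *: n').
  by rewrite scalerBr scalerDr !scalerA [u * a]mulrC; zmod.
exact: sK.2.
Qed.

(** Multiplication by [u] has kernel inside [B], so images of a strict chain above [B] remain strict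
    above [K]. *)
Lemma ch_push X (K B Z : set X) u n : submod K -> submod Z ->
  (forall x, Z x -> K (u *: x) -> B x) -> ch B Z n -> ch K (addmul K Z u) n.
Proof.
move=> sK; elim: n Z => [|n IH] Z sZ uZ /=.
  move=> BZ x Kx; exists 0; first exact: sub0.
  by rewrite scaler0 subr0.
move=> [G [sG cG GZ [e Ze He]]]; have BG := ch_sub cG.
exists (addmul K G u); split.
- exact: submod_addmul.
- by apply: IH => // x /GZ; exact: uZ.
- by move=> x [k /GZ Zk Kk]; exists k.
exists (u *: e); first by exists e => //; rewrite subrr; exact: sub0.
move=> s Es [k Gk Kk]; apply: (He s Es).
have -> : s *: e = (s *: e - k) + k by zmod.
apply: (subD sG) => //; apply: BG; apply: uZ.
  by apply: (subB sZ); [exact: subZ|exact: GZ].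
by rewrite scalerBr scalerA [u * s]mulrC -scalerA.
Qed.

End Chains.

Section FiniteLength.
Variables (S : comPzRingType) (p : set S).
Hypothesis p1 : ~ p 1.
Hypothesis prime_p : forall a b, p (a * b) -> p a \/ p b.
Variables (X : lmodType S) (B Z : set X).
Hypotheses (nS : noetherian S) (nX : noethm X).
Hypotheses (sB : submod B) (sZ : submod Z) (BZ : B `<=` Z).
Hypothesis nilp : forall e x, Z e -> p x -> exists s k, ~ p s /\ B (s *: (x ^+ k *: e)).

#[local] Notation E := (~` p).
Let EM s t : E s -> E t -> E (s * t).
Proof. by move=> Es Et /prime_p []. Qed.

#[local] Notation bounded G := (exists k, forall n, ch E B G n -> (n <= k)%N).

(** Let [G] be maximal among the submodules of bounded length. If Z/G survives at [p], an element
    with maximal annihilator is killed by [p] there, and adjoining it adds at most one to the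
    length. *)
Lemma ch_bounded : bounded Z.
Proof.
pose F : set (set X) := [set G | [/\ submod G, B `<=` G, G `<=` Z & bounded G]].
have [||G [[sG BG GZ [k kG]] Gmax]] := @noethm_max S X F nX; first by move=> G [].
  exists B; split=> //; exists 0%N => -[//|n] /= [G [sG cG GB [e Be He]]].
  by case: (He 1); rewrite ?scale1r //; exact: (ch_sub cG).
suff noe e : Z e -> exists2 s, E s & G (s *: e).
  exists k => n /(ch_split EM sZ sG) [n1 [n2 [nn c1 c2]]].
  have {}c1 : (n1 <= k)%N.
    apply: kG; apply: (@ch_mono _ _ _ _ (Z `&` G)); first by move=> x [].
    by apply: ch_anti c1 => x Bx; split=> //; exact: BG.
  suff n20 : n2 = 0%N by rewrite n20 addn0 in nn; exact: leq_trans nn c1.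
  case: n2 c2 {nn} => // n2 /= [H [sH /ch_sub cH _ [_ [z [g [Zz Gg ->]]] He]]].
  have [s Es Gs] := noe z Zz; case: (He s Es).
  apply: cH; rewrite scalerDr; apply: addsmr => //.
  by apply: (subD sG) => //; exact: subZ.
apply: contrapT => nGe.
pose bg e := Z e /\ forall s, E s -> ~ G (s *: e).
have bge : bg e.
  by apply: contrapT => nb; apply: nGe => Ze; apply: contrapT => ns; apply: nb;
    split=> // s Es Gs; apply: ns; exists s.
(* The annihilator of [x] in the localisation of Z/G at [p], contracted to [S]. *)
pose quo (x : X) : set S^o := [set a | exists2 s, E s & G (s *: (a *: x))].
have squo x : submod (quo x).
  split=> [|a u v [s Es Gs] [t Et Gt]]; first by exists 1; rewrite // scale0r scaler0; exact: sub0.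
  exists (s * t); first exact: EM.
  have -> : (s * t) *: ((a *: u + v) *: x) =
      (t * a) *: (s *: (u *: x)) + s *: (t *: (v *: x)).
    rewrite scalerDl scalerDr !scalerA; congr (_ *: _ + _ *: _).
    by rewrite -[a *: u]/(a * u); ring.
  by apply: (subD sG); exact: subZ.
have [||_ [[e' be' ->] e'max]] :=
    @noethm_max S S^o [set I | exists2 x, bg x & I = quo x] (noethm_regular nS).
- by move=> _ [x _ ->].
- by exists (quo e), e.
have pquo x : p x -> quo e' x.
  move=> px; have [Ze' He'] := be'.
  have [s [k0 [ps Bk]]] := nilp Ze' px.
  have exk : exists k, `[< exists2 s, E s & G (s *: (x ^+ k *: e')) >].
    by exists k0; apply/asboolP; exists s => //; exact: BG.
  (* For the least exponent [j.+1] that kills [e'], the element [x ^+ j *: e'] survives, and its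
     annihilator contains [x] and that of [e']; by maximality [x] kills [e'] already. *)
  case: (ex_minnP exk) => -[|j] /asboolP [t Et Gt] jmin.
    by case: (He' t Et); rewrite expr0 scale1r in Gt.
  apply: (e'max (quo (x ^+ j *: e'))).
  - exists (x ^+ j *: e') => //; split; first exact: subZ.
    move=> r Er Gr; suff : (j.+1 <= j)%N by rewrite ltnn.
    by apply: jmin; apply/asboolP; exists r.
  - move=> a [r Er Gr]; exists r => //.
    have -> : r *: (a *: (x ^+ j *: e')) = x ^+ j *: (r *: (a *: e')).
      by rewrite !scalerA -[in RHS]mulrA [in RHS]mulrC.
    exact: subZ.
  - by exists t => //; move: Gt; rewrite exprS -scalerA.
have [Ze' He'] := be'.
pose L := [set x | exists a : S, x = a *: e'].
have sL : submod L.
  split=> [|a _ _ [c ->] [d ->]]; first by exists 0; rewrite scale0r.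
  by exists (a * c + d); rewrite scalerDl !scalerA.
have Le' : L e' by exists 1; rewrite scale1r.
have sG' := submod_addsm sG sL.
apply: (He' 1) => //; rewrite scale1r; apply: (Gmax (addsm G L)); last 2 first.
- exact: addsml.
- exact: addsmr.
split=> //.
- by apply: subset_trans BG _; exact: addsml.
- apply: addsm_sub => // _ [a ->]; exact: subZ.
exists k.+1 => n /(ch_split EM sG' sG) [n1 [n2 [nn c1 c2]]].
have {}c1 : (n1 <= k)%N.
  apply: kG; apply: (@ch_mono _ _ _ _ (addsm G L `&` G)); first by move=> x [].
  by apply: ch_anti c1 => x Bx; split=> //; exact: BG.
suff n21 : (n2 <= 1)%N by rewrite -addn1; apply: leq_trans nn _; exact: leq_add.
(* Two strict steps are witnessed by [a1 *: e'] and [a2 *: e'] modulo [G]. Here [a1] is outside [p],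
   so [H1] contains [e'] up to a denominator and the second step is not strict. *)
rewrite leqNgt; apply/negP => n22; have /= := ch_leq c2 n22.
move=> [H1 [sH1 [H0 [_ cH0 H01 [e1 H1e1 b1]]] H1G' [e2 G'e2 b2]]].
have GH0 : G `<=` H0 by apply: subset_trans cH0; exact: addsmr.
have GH1 := subset_trans GH0 H01.
have GG' x : addsm (addsm G L) G x -> exists g a, G g /\ x = g + a *: e'.
  move=> [_ [g' [[g [_ [Gg [a ->] ->]]] Gg' ->]]]; exists (g + g'), a.
  by split; [exact: subD|zmod].
have [g1 [a1 [Gg1 e1E]]] := GG' _ (H1G' _ H1e1).
have [g2 [a2 [Gg2 e2E]]] := GG' _ G'e2.
have [/pquo [s Es Gs]|Ea1] := pselect (p a1).
  apply: (b1 s Es); rewrite e1E scalerDr; apply: GH0.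
  by apply: (subD sG) => //; exact: subZ.
apply: (b2 a1 Ea1); rewrite e2E scalerDr; apply: (subD sH1).
  by apply: (subZ sH1); exact: GH1.
rewrite scalerA mulrC -scalerA; apply: (subZ sH1).
have -> : a1 *: e' = e1 - g1 by rewrite e1E; zmod.
by apply: (subB sH1) => //; exact: GH1.
Qed.

End FiniteLength.

Section Decay.
Unset Implicit Arguments.
Variables (S : comPzRingType) (X : nat -> lmodType S) (B Z : forall i, set (X i)).
Hypotheses (nS : noetherian S) (nX : forall i, noethm (X i)).
Hypotheses (sB : forall i, submod (B i)) (sZ : forall i, submod (Z i)).
Hypothesis BZ : forall i, B i `<=` Z i.
Variables (r N : nat).
Hypothesis ltNr : (N < r)%N.
Hypothesis decay : forall E : set S, E 1 -> (forall s t, E s -> E t -> E (s * t)) ->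
  forall i n, ch E (B i.+1) (Z i.+1) n ->
  exists n', ch E (B i) (Z i) n' /\ (r * n <= N * n')%N.
Set Implicit Arguments.

(** A chain of length 1 in degree [i.+1] would force one of positive length in degree [i], where
    inverting [E] leaves nothing. *)
Lemma decay1 (E : set S) i : E 1 -> (forall s t, E s -> E t -> E (s * t)) ->
  (forall e, Z i e -> exists2 s, E s & B i (s *: e)) ->
  forall e, Z i.+1 e -> exists2 s, E s & B i.+1 (s *: e).
Proof.
move=> E1 EM Ei e Ze; apply: contrapT => ne.
have := @ch1 S E _ _ _ e (sB i.+1) (BZ i.+1) Ze.
case=> [s Es Bs|G [sG cG GZ bG]]; first by apply: ne; exists s.
have c1 : ch E (B i.+1) (Z i.+1) 1 by exists G.
have [[|n'] [c' rn]] := decay _ E1 EM _ _ c1.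
  by move: rn; rewrite muln1 muln0 leqNgt (leq_ltn_trans _ ltNr).
have [H [sH BH HZ [e' Ze' He']]] := ch_leq c' (isT : (1 <= n'.+1)%N).
by have [s Es Bs] := Ei e' Ze'; case: (He' s Es); exact: BH.
Qed.

(* The ideals [T i] of elements acting nilpotently on [Z i / B i] stabilise; a prime
   [p = (T : u)] is minimal over the stable ideal, so that lengths at [p] are finite. *)
Let T i : set S^o := [set x : S | forall e, Z i e -> exists k, B i (x ^+ k *: e)].

Let sT i : submod (T i).
Proof.
split=> [e Ze|a x y Tx Ty e Ze].
  by exists 1%N; rewrite expr1 scale0r; exact: sub0.
have [k Bk] := Tx e Ze; have [l Bl] := Ty e Ze.
exists (k + l)%N; rewrite -[a *: x]/((a : S) * x) exprDn scaler_suml.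
apply: (sub_sum (sB i)) => -[j jlt] _ /=.
rewrite -scalerMnl -scaler_nat; apply: (subZ (sB i)).
case: (leqP l j) => lj.
  by rewrite -(subnK lj) exprD mulrA -scalerA; exact: subZ.
have kj : (k <= k + l - j)%N by lia.
rewrite exprMn -(subnK kj) !exprD.
have -> : a ^+ (k + l - j - k) * a ^+ k * (x ^+ (k + l - j - k) * x ^+ k) * y ^+ j
  = (a ^+ (k + l - j - k) * a ^+ k * x ^+ (k + l - j - k) * y ^+ j) * x ^+ k by ring.
by rewrite -scalerA; exact: subZ.
Qed.

Lemma eventually_zero : exists i, Z i `<=` B i.
Proof.
apply: contrapT => nZ.
have TS i : T i `<=` T i.+1.
  (* Membership of [x] in [T i] says that inverting [x] kills [Z i / B i]; hence [decay1] for the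
     powers of [x]. *)
  move=> x Tx e Ze; have [|||_ [k ->] Bk] := @decay1 [set s | exists k, s = x ^+ k] i _ _ _ e Ze.
  - by exists 0%N.
  - by move=> _ _ [k ->] [l ->]; exists (k + l)%N; rewrite exprD.
  - by move=> e' /Tx [k Bk]; exists (x ^+ k) => //; exists k.
  - by exists k.
have Tle i j : (i <= j)%N -> T i `<=` T j.
  elim: j => [|j IH]; first by rewrite leqn0 => /eqP ->.
  rewrite leq_eqVlt => /orP [/eqP -> //|/IH Tij]; exact: subset_trans Tij (TS j).
have [||_ [[i0 _ <-] Tmax]] :=
    @noethm_max S S^o [set I | exists2 i, True & T i = I] (noethm_regular nS).
- by move=> _ [i _ <-].
- by exists (T 0%N), 0%N.
have T1 i : ~ T i 1.
  move=> Ti; apply: nZ; exists i => e /Ti [k]; by rewrite expr1n scale1r.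
(* A colon ideal maximal among the proper ones is prime, and it avoids [u] because [T i0] is
   radical. *)
have [||_ [[u Tu ->] umax]] := @noethm_max S S^o
    [set I | exists2 u : S, ~ T i0 u & I = [set a : S^o | T i0 ((a : S) * u)]]
    (noethm_regular nS).
- move=> _ [u Tu ->]; split=> [|a x y Tx Ty] /=; first by rewrite mul0r; exact: (sub0 (sT i0)).
  have -> : ((a *: x + y : S^o) : S) * u = (a : S) * (x * u) + y * u.
    by rewrite -[a *: x]/((a : S) * x); ring.
  by apply: ((sT i0).2 a (x * u) (y * u)).
- by eexists; exists 1; [exact: T1|reflexivity].
pose p : set S := [set a | T i0 (a * u)].
have p1 : ~ p 1 by rewrite /p /= mul1r.
have Trad x : T i0 (x * x) -> T i0 x.
  move=> Tx e /Tx [k Bk]; exists (k + k)%N; move: Bk.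
  by rewrite exprMn exprD.
have pu : ~ p u by move=> /Trad.
have prime_p a c : p (a * c) -> p a \/ p c.
  move=> pac; have [|npa] := pselect (p a); [by left|right].
  apply: (umax [set x : S^o | T i0 ((x : S) * (a * u))]).
  - by exists (a * u).
  - by move=> x /= Tx; rewrite mulrCA; exact: (subZ (sT i0)).
  - by rewrite /= mulrA [c * a]mulrC.
have EM s t : (~` p) s -> (~` p) t -> (~` p) (s * t) by move=> ps pt /prime_p [].
have pX s k : ~ p s -> ~ p (s ^+ k).
  by move=> ps; elim: k => [|k IH]; rewrite ?expr0 // exprS; exact: EM.
(* For [x] in [p] the product [x * u] acts nilpotently, and the powers of [u] are denominators at
   [p]. *)
have [k kmax] : exists k, forall n, ch (~` p) (B i0) (Z i0) n -> (n <= k)%N.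
  apply: (ch_bounded p1 prime_p nS) => // e x Ze px.
  have [k] := px e Ze; rewrite mulrC exprMn -scalerA => Bk.
  by exists (u ^+ k), k; split=> //; exact: pX.
(* A positive length drops by at least one per degree, since [N < r]; after [k] degrees nothing is
   left at [p]. *)
have len j n : ch (~` p) (B (i0 + j)%N) (Z (i0 + j)%N) n -> (n <= k - j)%N.
  elim: j n => [|j IH] n; first by rewrite addn0 subn0; exact: kmax.
  rewrite addnS => /(decay _ p1 EM) [n' [/IH n'k rn]].
  case: n rn => // n rn; nia.
have Ei0 e : Z (i0 + k)%N e -> exists2 s, ~ p s & B (i0 + k)%N (s *: e).
  move=> Ze; apply: contrapT => ne.
  have := @ch1 S (~` p) _ _ _ e (sB (i0 + k)%N) (BZ (i0 + k)%N) Ze.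
  have H s : (~` p) s -> ~ B (i0 + k)%N (s *: e) by move=> ps Bs; apply: ne; exists s.
  by move=> /(_ H) /len; rewrite subnn.
(* The product of the denominators for finitely many generators kills this degree, so it lies in the
   stable ideal and hence in [p]: a contradiction. *)
have [n [v [Zv vZ]]] := nX (i0 + k)%N (Z (i0 + k)%N) (sZ _).
have /choice [s sP] : forall i, exists s, ~ p s /\ B (i0 + k)%N (s *: v i).
  by move=> i; have [s ps Bs] := Ei0 _ (Zv i); exists s.
have ps : ~ p (\prod_i s i).
  by apply: (big_ind (~` p)) => // i _; have [] := sP i.
apply: ps; rewrite /p /= mulrC; apply: (subZ (sT i0)).
apply: (Tmax (T (i0 + k)%N)); [by exists (i0 + k)%N|exact: Tle (leq_addr _ _)|].
move=> e /vZ [c ->]; exists 1%N; rewrite expr1 scaler_sumr.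
apply: (sub_sum (sB _)) => i _; rewrite (bigD1 i) //= scalerA.
rewrite [s i * _]mulrC mulrAC -scalerA; apply: (subZ (sB _)).
by have [] := sP i.
Qed.

End Decay.
(** * Growth of cohomology along filtrations *)

Section Filtrations.
Variables (S : comPzRingType) (X : lmodType S) (V : set X).
Hypothesis sV : submod V.
Implicit Types (W : set X) (us : seq S).

Fixpoint addys W us : set X := if us is u :: us' then addys (addy W u) us' else W.

Lemma submod_addys W us : submod W -> submod (addys W us).
Proof. by elim: us W => //= u us IH W sW; apply: IH; exact: submod_addy. Qed.

Lemma addys_sub W us : W `<=` addys W us.
Proof.
elim: us W => [|u us IH] W //=; apply: subset_trans (IH _); exact: addyl.
Qed.

Lemma addys_cat W us us' : addys W (us ++ us') = addys (addys W us) us'.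
Proof. by elim: us W => //= u us IH W; exact: IH. Qed.

Lemma addysP W us x : addys W us x <->
  exists ns : nat -> X, W (x - \sum_(l < size us) us`_l *: ns l).
Proof.
elim: us W => [|u us IH] W /=.
  split=> [Wx|[ns]]; last by rewrite big_ord0 subr0.
  by exists (fun=> 0); rewrite big_ord0 subr0.
split=> [/IH [ns [n Wn]]|[ns]].
  exists (fun l => if l is l'.+1 then ns l' else n).
  by rewrite big_ord_recl /= opprD [- _ + _]addrC addrA.
rewrite big_ord_recl /= => Wn; apply/IH; exists (ns \o succn), (ns 0%N).
by move: Wn; rewrite opprD [- _ + _]addrC addrA.
Qed.

(* [W + (us) / W] has a filtration whose factors are copies of X / V. *)
Fixpoint filt W us : Prop :=
  if us is u :: us' then (forall n, W (u *: n) <-> V n) /\ filt (addy W u) us'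
  else True.

Lemma filt_cat W us us' : filt W (us ++ us') <-> filt W us /\ filt (addys W us) us'.
Proof.
elim: us W => [|u us IH] W /=; first by split=> [|[]].
split=> [[H /IH [H1 H2]]|[[H H1] H2]] //; split=> //; exact/IH.
Qed.

(** The multiplications by the members of [us] induce a well-defined map from a power of X/V to X/W
    (second clause), and this map is injective (first clause). *)
Definition indep W us : Prop :=
  (forall ns : nat -> X, W (\sum_(l < size us) us`_l *: ns l) ->
     forall l, (l < size us)%N -> V (ns l)) /\
  (forall u n, u \in us -> V n -> W (u *: n)).

Lemma free_filt W us : submod W -> indep W us -> filt W us.
Proof.
elim: us W => //= u us IH W sW [indW Wu]; split=> [n|].
  split=> [Wn|]; last by apply: Wu; rewrite inE eqxx.
  apply: (indW (fun l => if l is 0%N then n else 0) _ 0%N) => //.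
  rewrite big_ord_recl /= big1 ?addr0 // => l _; exact: scaler0.
apply: IH; first exact: submod_addy.
split=> [ns [n Wn] l lus|u' n us' Vn]; last first.
  by apply: addyl; apply: Wu => //; rewrite inE us' orbT.
apply: (indW (fun l => if l is l'.+1 then ns l' else - n) _ l.+1) => //.
by rewrite big_ord_recl /= scalerN addrC.
Qed.

End Filtrations.

Section Cohomology.
Variables (S : comPzRingType) (J : set S).
Hypothesis iJ : is_ideal J.
Variables (b : nat -> nat) (D : forall i, 'M[S]_(b i.+1, b i)) (c : nat).
Hypothesis cD : cpx D J.
Implicit Types (U V W : set 'rV[S]_c).

Definition Zc i U W : set 'M[S]_(b i.+1, c) :=
  [set v | rowsin U v /\ rowsin W (D i.+1 *m v)].
Definition Bc i U W : set 'M[S]_(b i.+1, c) :=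
  [set v | exists2 w : 'M[S]_(b i, c), rowsin U w & rowsin W (v - D i *m w)].

Arguments Zc : clear implicits.
Arguments Bc : clear implicits.

Lemma HzE i U W : Hz D i U W <-> Zc i U W `<=` Bc i U W.
Proof.
split=> H v; first by move=> [Uv /(H v Uv) [w [Uw Ww]]]; exists w.
by move=> Uv Wv; have [w Uw Ww] := H v (conj Uv Wv); exists w.
Qed.

Lemma submod_Zc i U W : submod U -> submod W -> submod (Zc i U W).
Proof.
move=> sU sW; apply: submodI; first exact: rowsin_submod.
exact: (submod_preimage (mulmx (D i.+1)) (rowsin_submod _ sW)).
Qed.

Lemma submod_Bc i U W : submod U -> submod W -> submod (Bc i U W).
Proof.
move=> sU sW; split=> [|a v v' [w Uw Ww] [w' Uw' Ww']].
  exists 0; first exact: (sub0 (rowsin_submod _ sU)).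
  by rewrite mulmx0 subrr; exact: (sub0 (rowsin_submod _ sW)).
exists (a *: w + w'); first exact: (rowsin_submod _ sU).2.
have -> : a *: v + v' - D i *m (a *: w + w') = a *: (v - D i *m w) + (v' - D i *m w').
  by mx_zmod.
exact: (rowsin_submod _ sW).2.
Qed.

Section Good.
Variables (W : set 'rV[S]_c).
Hypotheses (sW : submod W) (JW : JV J (c := c) `<=` W).

Lemma Bc_Zc i U : submod U -> W `<=` U -> Bc i U W `<=` Zc i U W.
Proof.
move=> sU WU v [w Uw Ww]; have vE : v = (v - D i *m w) + D i *m w by zmod.
split; rewrite vE.
  by apply: rowsinD => //; [exact: rowsin_sub WU _|exact: rowsinMl].
by rewrite mulmxDr; apply: rowsinD => //; [exact: rowsinMl|exact: (cpxW iJ)].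
Qed.

Lemma filt_Hz i V us : submod V -> filt V W us -> Hz D i setT V ->
  Hz D i (addys W us) W.
Proof.
move=> sV; elim: us W sW JW => /= [|u us IH] W' sW' JW'.
  move=> _ _ v Wv _; exists 0; split; first exact: (sub0 (rowsin_submod _ sW')).
  by rewrite mulmx0 subr0.
move=> [uV fV] hV; have sWu := submod_addy u sW'.
have WWu : W' `<=` addy W' u by exact: addyl.
apply: (@Hz_ext _ _ D _ iJ cD _ W' sW' JW' _ _ (addy W' u)) => //.
- exact: submod_addys.
- exact: addys_sub.
- exact: Hz_mul uV hV.
- by apply: IH => //; exact: subset_trans WWu.
Qed.

End Good.

Section Length.
Variable E : set S.
Hypotheses (E1 : E 1) (EM : forall s t, E s -> E t -> E (s * t)).

(** Length is subadditive along the filtration. As [ch] only gives lower bounds, a long chain yields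
    a chain for a single factor of at least the average length. *)
Lemma filt_ch i V W us n : submod V -> JV J (c := c) `<=` V -> submod W -> JV J (c := c) `<=` W ->
  filt V W us -> ch E (Bc i (addys W us) W) (Zc i (addys W us) W) n ->
  exists n', (n <= size us * n')%N /\ ch E (Bc i setT V) (Zc i setT V) n'.
Proof.
move=> sV JV'; elim: us W n => /= [|u us IH] W n sW JW.
  move=> _ cW; exists 0%N; split; last exact: Bc_Zc.
  case: n cW => // n [G [_ /ch_sub BG _ [e [We _] He]]]; case: (He 1 E1); rewrite scale1r.
  apply: BG; exists 0; first exact: (sub0 (rowsin_submod _ sW)).
  by rewrite mulmx0 subr0.
move=> [uV fV] cW; pose W' := addy W u; pose U := addys W' us.
have sW' : submod W' := submod_addy u sW.
have WW' : W `<=` W' by exact: addyl.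
have JW' := subset_trans JW WW'.
have sU : submod U by exact: submod_addys.
have W'U : W' `<=` U by exact: addys_sub.
have WU := subset_trans WW' W'U.
(* The kernel of the map in cohomology from U/W to U/W': the part of the chain inside it comes from
   the factor X/V through [u], the rest survives in U/W'. *)
pose K := Bc i U W'.
have sK : submod K by exact: submod_Bc.
have sZ : submod (Zc i U W) by exact: submod_Zc.
have VW r (A : 'M_(r, c)) : rowsin V A -> rowsin W (u *: A).
  by move=> VA k; rewrite rowZ; apply/uV; exact: VA.
have WV r (A : 'M_(r, c)) : rowsin W (u *: A) -> rowsin V A.
  by move=> VA k; apply/uV; rewrite -rowZ; exact: VA.
have uU r (A : 'M_(r, c)) : rowsin U (u *: A).
  by move=> k; apply: W'U; rewrite rowZ; exact: addyr.
have BK : Bc i U W `<=` K by move=> v [w Uw Ww]; exists w => //; exact: rowsin_sub Ww.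
have [n1 [n2 [nn c1 c2]]] := ch_split EM sZ sK cW.
have {}c2 : ch E (Bc i U W') (Zc i U W') n2.
  apply: (ch_mono _ (ch_anti _ c2)); last exact: addsmr (submod_Bc _ _ _).
  apply: addsm_sub; first exact: submod_Zc.
    by move=> v [Uv Wv]; split=> //; exact: rowsin_sub Wv.
  exact: Bc_Zc.
have [n2' [n2le c2']] := IH W' n2 sW' JW' fV c2.
pose f : {linear 'M[S]_(b i.+1, c) -> 'M[S]_(b i.+1, c)} := GRing.scale u.
have c1' : ch E (Bc i setT V) (Zc i setT V) n1.
  have sA := @submod_Zc i setT V (submodT _) sV.
  apply: (@ch_mono _ _ _ _ (Zc i setT V `&` f @^-1` (Zc i U W `&` K))); first by move=> v [].
  apply: (@ch_anti _ _ _ (Zc i setT V `&` f @^-1` (Bc i U W `&` K))).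
    move=> v Bv; have [w _ Vw] := Bv; split.
      split=> //; apply: WV.
      have -> : u *: (D i.+1 *m v) =
        D i.+1 *m (u *: (v - D i *m w)) + D i.+1 *m (D i *m (u *: w)) by mx_zmod.
      by apply: rowsinD => //; [apply: rowsinMl => //; exact: VW|exact: (cpxW iJ)].
    have BWv : Bc i U W (u *: v).
      exists (u *: w); first exact: uU.
      have -> : u *: v - D i *m (u *: w) = u *: (v - D i *m w) by mx_zmod.
      exact: VW.
    by split=> //; exact: BK.
  apply: ch_pull c1 => //; first exact: submodI.
  move=> z [[Uz Wz] Kz]; have [w Uw /rowsin_addy [a Wa]] := Kz.
  have BWz : Bc i U W (z - u *: a).
    exists w => //.
    by have -> : z - u *: a - D i *m w = z - D i *m w - u *: a by zmod.
  exists a; first split=> //.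
    apply: WV; have -> : u *: (D i.+1 *m a) = D i.+1 *m z -
       D i.+1 *m (D i *m w) - D i.+1 *m (z - D i *m w - u *: a) by mx_zmod.
    apply: rowsinB => //; last exact: rowsinMl.
    by apply: rowsinB => //; exact: (cpxW iJ).
  by split=> //; exact: BK.
have [n12|n21] := leqP n1 n2'.
  exists n2'; split=> //; apply: leq_trans nn _.
  by rewrite mulSn; exact: leq_add.
exists n1; split=> //; apply: leq_trans nn _.
rewrite mulSn leq_add2l; apply: leq_trans n2le _.
by rewrite leq_mul2l (ltnW n21) orbT.
Qed.

(* The connecting homomorphism H^{i+1}(N/V) -> H^{i+2}(V/W) is onto. *)
Lemma ch_connect i V W n : submod V -> submod W -> JV J (c := c) `<=` W ->
  W `<=` V -> Hz D i.+1 setT W -> ch E (Bc i.+1 V W) (Zc i.+1 V W) n ->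
  ch E (Bc i setT V) (Zc i setT V) n.
Proof.
move=> sV sW JW WV hW cVW.
pose f : {linear 'M[S]_(b i.+1, c) -> 'M[S]_(b i.+2, c)} := mulmx (D i.+1).
apply: (@ch_mono _ _ _ _ ([set: _] `&` f @^-1` (Zc i.+1 V W))).
  by move=> v [_ [Vv Wv]].
apply: (@ch_anti _ _ _ ([set: _] `&` f @^-1` (Bc i.+1 V W))).
  move=> v [w _ Vw]; split=> //=; exists (v - D i *m w) => //.
  have -> : f v - D i.+1 *m (v - D i *m w) = D i.+1 *m (D i *m w).
    by rewrite /f /=; mx_zmod.
  exact: (cpxW iJ).
apply: ch_pull cVW => //; first exact: submod_Zc.
move=> z [_ Wz]; have [//|w [_ Ww]] := hW z _ Wz; exists w => //.
exists 0; first exact: (sub0 (rowsin_submod _ sV)).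
by rewrite mulmx0 subr0.
Qed.

(** Independence makes [addys W us / W] a direct sum of copies of X/V, and cohomology commutes with
    finite sums. *)
Lemma ch_free i V W us n : submod V -> submod W -> JV J (c := c) `<=` W ->
  indep V W us -> ch E (Bc i setT V) (Zc i setT V) n ->
  ch E (Bc i (addys W us) W) (Zc i (addys W us) W) (size us * n).
Proof.
move=> sV sW JW [indW Wu] cV; pose U := addys W us.
have sU : submod U by exact: submod_addys.
have WU : W `<=` U by exact: addys_sub.
have VW r (A : 'M_(r, c)) u : u \in us -> rowsin V A -> rowsin W (u *: A).
  by move=> us_u VA k; rewrite rowZ; apply: Wu => //; exact: VA.
have uU r (A : 'M_(r, c)) u : u \in us -> rowsin U (u *: A).
  move=> us_u k; rewrite rowZ; apply/addysP.
  exists (fun l => if l == index u us then row k A else 0).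
  have ius : (index u us < size us)%N by rewrite index_mem.
  rewrite (bigD1 (Ordinal ius)) //= eqxx nth_index // big1 ?addr0.
    by rewrite subrr; exact: sub0.
  by move=> l; rewrite -val_eqE /= => /negbTE ->; rewrite scaler0.
(* The coboundaries together with the contributions of the first [l] copies; each new copy pushes a
   chain of length [n] forward. *)
pose K l := foldl (fun K u => addmul K (Zc i setT V) u) (Bc i U W) (take l us).
have KS l : (l < size us)%N -> K l.+1 = addmul (K l) (Zc i setT V) us`_l.
  by move=> lus; rewrite /K (take_nth 0) // -cats1 foldl_cat.
have sZ := @submod_Zc i setT V (submodT _) sV.
have sK l : (l <= size us)%N -> submod (K l).
  elim: l => [_|l IH lus]; first by rewrite /K take0; exact: submod_Bc.
  by rewrite KS //; apply: submod_addmul => //; apply: IH; exact: ltnW.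
have KP l x : (l <= size us)%N -> K l x -> exists ns : nat -> 'M[S]_(b i.+1, c),
    (forall k, Zc i setT V (ns k)) /\ Bc i U W (x - \sum_(k < l) us`_k *: ns k).
  elim: l x => [|l IH] x lus.
    rewrite /K take0 => Bx; exists (fun=> 0); rewrite big_ord0 subr0.
    by split=> // k; exact: (sub0 sZ).
  rewrite KS // => -[n0 Zn0 /(IH _ (ltnW lus)) [ns [Zns Bns]]].
  exists (fun k => if k == l then n0 else ns k); split=> [k|]; first by case: eqP.
  rewrite big_ord_recr /= eqxx (eq_bigr (fun k : 'I_l => us`_k *: ns k)).
    by rewrite opprD addrA [x - _ - _]addrAC.
  by move=> k _; rewrite (ltn_eqF (ltn_ord k)).
have Kind l x : (l < size us)%N -> Zc i setT V x -> K l (us`_l *: x) -> Bc i setT V x.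
  move=> lus Zx /(KP _ _ (ltnW lus)) [ns [Zns [w Uw]]].
  have /choice [f fP] : forall j, exists n0 : nat -> 'rV[S]_c,
      W (row j w - \sum_(k < size us) us`_k *: n0 k).
    by move=> j; apply/addysP; exact: Uw.
  pose w' k := \matrix_j f j k.
  have Ww' : rowsin W (w - \sum_(k < size us) us`_k *: w' k).
    move=> j; rewrite rowB; have := fP j; congr (W (_ - _)).
    by rewrite linear_sum; apply: eq_bigr => k _ /=; rewrite rowZ rowK.
  move=> Wn; exists (w' l) => //.
  (* The coefficient of the [k]-th member of [us] in the given relation. Independence puts all of
     them into [V], and the one at [l] shows that [x] is a coboundary. *)
  pose g k := (if k == l then x else if (k < l)%N then - ns k else 0) - D i *m w' k.
  have gW : rowsin W (\sum_(k < size us) us`_k *: g k).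
    have -> : \sum_(k < size us) us`_k *: g k =
       (us`_l *: x - \sum_(k < l) us`_k *: ns k - D i *m w) +
       D i *m (w - \sum_(k < size us) us`_k *: w' k).
      rewrite mulmxBr mulmx_sumr.
      rewrite (eq_bigr (fun k : 'I_(size us) => (us`_k *: (if k == l :> nat then x else 0)
         + (if (k < l)%N then - (us`_k *: ns k) else 0)) - D i *m (us`_k *: w' k))); last first.
        move=> k _; rewrite /g scalerBr -scalemxAr.
        case: (ltngtP k l) => kl; rewrite ?scaler0 ?scalerN; zmod.
      rewrite !big_split /= sumrN.
      have -> : \sum_(k < size us) us`_k *: (if k == l :> nat then x else 0) = us`_l *: x.
        rewrite (bigD1 (Ordinal lus)) //= eqxx big1 ?addr0 // => k.
        by rewrite -val_eqE /= => /negbTE ->; rewrite scaler0.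
      have -> : \sum_(k < size us) (if (k < l)%N then - (us`_k *: ns k) else 0)
         = - \sum_(k < l) us`_k *: ns k.
        rewrite -sumrN (big_ord_widen _ (fun k => - (us`_k *: ns k)) (ltnW lus)).
        by rewrite [RHS]big_mkcond.
      by zmod.
    by apply: rowsinD => //; exact: rowsinMl.
  move=> j; have := indW (fun k => row j (g k)) _ l lus.
  rewrite {2}/g eqxx; apply.
  have := gW j; rewrite linear_sum; congr (W _).
  by apply: eq_bigr => k _ /=; rewrite rowZ.
have cK l : (l <= size us)%N -> ch E (Bc i U W) (K l) (l * n).
  elim: l => [_|l IH lus]; first by rewrite /K take0.
  rewrite mulSn; apply: ch_cat (IH (ltnW lus)) _; rewrite KS //.
  apply: ch_push cV => //; first by apply: sK; exact: ltnW.
  by move=> x Zx; exact: Kind.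
apply: ch_mono (cK _ (leqnn _)) => x /KP -/(_ (leqnn _)) [ns [Zns Bns]].
rewrite -[x](subrK (\sum_(k < size us) us`_k *: ns k)).
apply: (subD (submod_Zc _ sU sW)); first exact: Bc_Zc.
apply: (sub_sum (submod_Zc _ sU sW)) => k _; have [_ Vk] := Zns k.
have us_k : us`_k \in us by rewrite mem_nth.
by split; [exact: uU|rewrite -scalemxAr; exact: VW].
Qed.

End Length.

(** By [hW] the connecting map from the cohomology of X/U to the next one of U/W is onto. The target
    consists of [size us] copies of the cohomology of X/V, and the source is filtered by [size us']
    of them. *)
Lemma growth_step i V W U us us' (E : set S) n :
  E 1 -> (forall s t, E s -> E t -> E (s * t)) ->
  submod V -> JV J (c := c) `<=` V -> submod W -> JV J (c := c) `<=` W ->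
  indep V W us -> U = addys W us -> filt V U us' -> addys U us' = setT ->
  Hz D i.+1 setT W -> ch E (Bc i.+1 setT V) (Zc i.+1 setT V) n ->
  exists n', ch E (Bc i setT V) (Zc i setT V) n' /\ (size us * n <= size us' * n')%N.
Proof.
move=> E1 EM sV JV' sW JW fus UE fus' UT hW cV.
have WU : W `<=` U by rewrite UE; exact: addys_sub.
have sU : submod U by rewrite UE; exact: submod_addys.
have := ch_free sV sW JW fus cV; rewrite -UE.
move=> /(ch_connect sU sW JW WU hW); rewrite -[in Bc i _ U]UT -[in Zc i _ U]UT.
move=> /(filt_ch E1 EM sV JV' sU (subset_trans JW WU) fus') [n' [nn' cn']].
by exists n'.
Qed.

(** Here X/W is the filtered module, [V] its first and [U] its deepest step: [us] indexes the copies
    of X/V in U/W, [us'] those in X/U, and [us''] those in V/W. *)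
Lemma growth a V W U us us' us'' : noetherian S ->
  submod V -> submod W -> JV J (c := c) `<=` W ->
  indep V W us -> U = addys W us -> filt V U us' -> addys U us' = setT ->
  filt V W us'' -> addys W us'' = V -> (size us' < size us)%N ->
  (forall i, (a <= i)%N -> Hz D i setT W) ->
  forall i, (a <= i)%N -> Hz D i setT V.
Proof.
move=> nS sV sW JW fus UE fus' UT fV VE us'us hW.
have WV : W `<=` V by rewrite -VE; exact: addys_sub.
have JV' := subset_trans JW WV.
have step i (E : set S) n : E 1 -> (forall s t, E s -> E t -> E (s * t)) ->
    (a <= i)%N -> ch E (Bc i.+1 setT V) (Zc i.+1 setT V) n ->
    exists n', ch E (Bc i setT V) (Zc i setT V) n' /\ (size us * n <= size us' * n')%N.
  move=> E1 EM ai; apply: (growth_step E1 EM sV JV' sW JW fus UE fus' UT).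
  by apply: hW; exact: leqW.
have BZ i : Bc i setT V `<=` Zc i setT V by exact: Bc_Zc.
have sB i : submod (Bc i setT V) by exact: submod_Bc.
have sZ i : submod (Zc i setT V) by exact: submod_Zc.
have [|i0 Z0] := @eventually_zero S (fun i => 'M[S]_(b (a + i).+1, c) : lmodType S)
   (fun i => Bc (a + i) setT V) (fun i => Zc (a + i) setT V) nS
   (fun i => @noethm_M S nS _ _) (fun i => sB _) (fun i => sZ _) (fun i => BZ _)
   (size us) (size us') us'us.
  move=> E E1 EM i n; rewrite addnS; apply: step => //; exact: leq_addr.
(* One zero forces the next: for [E = [set 1]] chains record plain strict inclusions. *)
have late0 k : Hz D (a + i0 + k) setT V.
  elim: k => [|k Zi]; first by rewrite addn0; apply/HzE.
  rewrite addnS; apply/HzE => z Zz; move/HzE in Zi.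
  have ai : (a <= a + i0 + k)%N by rewrite -addnA leq_addr.
  apply: contrapT => nBz.
  have c1 : ch [set 1] (Bc (a + i0 + k).+1 setT V) (Zc (a + i0 + k).+1 setT V) 1.
    by apply: (ch1 (sB _) (BZ _) Zz) => _ ->; rewrite scale1r.
  have [//|_ _ -> ->|n' [c' nn']] := step _ [set 1] 1%N _ _ ai c1; first by rewrite mulr1.
  case: n' c' nn' => [|n'] c' nn'; first by move: us'us; lia.
  have [H [sH BH HZ [e Ze He]]] := ch_leq c' (isT : (1 <= n'.+1)%N).
  by apply: (He 1 erefl); rewrite scale1r; apply: BH; exact: Zi.
have late i : (a + i0 <= i)%N -> Hz D i setT V.
  by move=> /subnKC <-.
(* Back down to [a]: vanishing for X/V in the next degree passes to V/W along the filtration, and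
   with that of X/W it gives vanishing for X/V. *)
have down k i : (a <= i)%N -> (a + i0 <= i + k)%N -> Hz D i setT V.
  elim: k i => [|k IH] i ai; first by rewrite addn0; exact: late.
  rewrite addnS -addSn => ik.
  apply: (@Hz_quot _ _ D _ iJ cD _ W sW JW i setT V) => //; first exact: hW.
  rewrite -VE; apply: (filt_Hz sW JW sV) => //.
  by apply: IH => //; exact: leqW.
move=> i ai; apply: (down i0 i ai); lia.
Qed.

End Cohomology.

(** * Powers of a regular sequence *)

Section Monomials.
Variable S : comPzRingType.
Implicit Types (zs us : seq S).

(** These are formal monomials: their values in [S] may repeat, so coefficients are indexed by
    positions in the list. *)
Fixpoint mons zs : nat -> seq S :=
  if zs is z :: zs' then
    fix aux k := if k is k'.+1 then map ( *%R z) (aux k') ++ mons zs' k else [:: 1]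
  else fun k => if k is k'.+1 then [::] else [:: 1].

Lemma mons0 zs : mons zs 0 = [:: 1]. Proof. by case: zs. Qed.

Lemma monsS z zs k :
  mons (z :: zs) k.+1 = map ( *%R z) (mons (z :: zs) k) ++ mons zs k.+1.
Proof. by []. Qed.

Lemma mons1 zs : mons zs 1 = zs.
Proof. by elim: zs => //= z zs ->; rewrite mulr1. Qed.

Lemma mons_sub z zs k : {subset mons zs k <= mons (z :: zs) k}.
Proof.
by case: k => [|k] u; rewrite ?mons0 // monsS mem_cat => ->; rewrite orbT.
Qed.

Lemma mons_mul zs k z u : z \in zs -> u \in mons zs k -> z * u \in mons zs k.+1.
Proof.
elim: zs k z u => // z0 zs IH; elim=> [|k IHk] z u.
  by move=> zzs; rewrite mons0 inE => /eqP ->; rewrite mons1 mulr1.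
rewrite inE => /orP [/eqP ->|zzs] us; rewrite [in X in _ \in X]monsS mem_cat.
  by rewrite map_f.
move: us; rewrite monsS mem_cat => /orP [/mapP [v vk ->]|uzs].
  by rewrite mulrCA map_f // IHk // inE zzs orbT.
by rewrite (IH k.+1) // orbT.
Qed.

Lemma mons_fact zs k v : v \in mons zs k.+1 ->
  exists z u, [/\ z \in zs, u \in mons zs k & v = z * u].
Proof.
elim: zs v => // z zs IH v; rewrite monsS mem_cat => /orP [/mapP [u uk ->]|].
  by exists z, u; rewrite inE eqxx.
move=> /IH [z' [u [z'zs uk ->]]]; exists z', u.
by rewrite inE z'zs orbT mons_sub.
Qed.

Lemma size_mons zs k : size (mons zs k.+1) = 'C(size zs + k, k.+1).
Proof.
elim: zs k => [|z zs IH] k; first by rewrite bin_small.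
elim: k => [|k IHk]; first by rewrite mons1 /= addn0 bin1.
rewrite monsS size_cat size_map IHk IH /=.
have -> : ((size zs).+1 + k = size zs + k.+1)%N by lia.
by rewrite [((size zs).+1 + _)%N]addSn binS addnC.
Qed.

(* The monomials of degrees [k - 1], ..., [j]. *)
Fixpoint monsrange zs j k : seq S :=
  if k is k'.+1 then if (j <= k')%N then mons zs k' ++ monsrange zs j k' else [::]
  else [::].

(** Homogenisation: the extra variable [z] pads a monomial of degree at most [k] to degree [k]. *)
Lemma size_monsrange z zs k : size (monsrange zs 0 k.+1) = size (mons (z :: zs) k).
Proof.
elim: k => [|k IH]; first by rewrite /= !mons0.
by rewrite monsS [RHS]size_cat size_map -IH addnC -size_cat.
Qed.

(** For positive [k] and [n = size zs] this is C(n+k-1, k-1) < C(n+k-1, k); it is used for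
    [k = s - 1], whence the condition s <= n. *)
Lemma monsrange_lt zs k : (k < size zs)%N ->
  (size (monsrange zs 0 k) < size (mons zs k))%N.
Proof.
case: k => [|k] kn; first by rewrite mons0.
rewrite (size_monsrange 0) size_mons; case: k kn => [|k] kn.
  by rewrite mons0 addn0 bin1.
rewrite size_mons /= addSn addnS.
have := mul_bin_left (size zs + k.+1) k.+1.
have -> : (size zs + k.+1 - k.+1 = size zs)%N by lia.
have : (0 < 'C(size zs + k.+1, k.+1))%N by rewrite bin_gt0; lia.
rewrite addnS; nia.
Qed.

End Monomials.

Section Quasiregular.
Variables (S : comPzRingType) (X : lmodType S).
Implicit Types (V W : set X) (zs us : seq S).

Definition dot us (ns : nat -> X) : X := \sum_(l < size us) us`_l *: ns l.

Fixpoint regs V zs : Prop :=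
  if zs is z :: zs' then reg_mod V z /\ regs (addy V z) zs' else True.

Lemma dot_cat us us' ns :
  dot (us ++ us') ns = dot us ns + dot us' (fun l => ns (size us + l)%N).
Proof.
rewrite /dot size_cat big_split_ord /=; congr (_ + _); apply: eq_bigr => l _.
  by rewrite nth_cat ltn_ord.
by rewrite nth_cat ltnNge leq_addr /= addKn.
Qed.

Lemma dot_map z us ns : dot (map ( *%R z) us) ns = z *: dot us ns.
Proof.
rewrite /dot size_map scaler_sumr; apply: eq_bigr => l _.
by rewrite (nth_map 0) ?ltn_ord // scalerA.
Qed.

Lemma dotD us ns ns' : dot us (fun l => ns l + ns' l) = dot us ns + dot us ns'.
Proof. by rewrite -big_split; apply: eq_bigr => l _; rewrite scalerDr. Qed.

Lemma dotB us ns ns' : dot us (fun l => ns l - ns' l) = dot us ns - dot us ns'.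
Proof. by rewrite -sumrB; apply: eq_bigr => l _; rewrite scalerBr. Qed.

Lemma dotZ us a ns : dot us (fun l => a *: ns l) = a *: dot us ns.
Proof.
by rewrite scaler_sumr; apply: eq_bigr => l _; rewrite !scalerA mulrC.
Qed.

Lemma eq_dot us ns ns' : (forall l, (l < size us)%N -> ns l = ns' l) ->
  dot us ns = dot us ns'.
Proof. by move=> e; apply: eq_bigr => l _; rewrite e. Qed.

Lemma dot_in V us ns : submod V ->
  (forall l, (l < size us)%N -> V (us`_l *: ns l)) -> V (dot us ns).
Proof. by move=> sV H; apply: (sub_sum sV) => l _; exact: H. Qed.

Lemma dot_pick us u n : u \in us -> exists ns : nat -> X,
  dot us ns = u *: n /\ forall l, ns l = n \/ ns l = 0.
Proof.
move=> uus; exists (fun l => if l == index u us then n else 0); split; last first.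
  by move=> l; case: eqP; [left|right].
have lt : (index u us < size us)%N by rewrite index_mem.
rewrite /dot (bigD1 (Ordinal lt)) //= eqxx nth_index // big1 ?addr0 // => l.
by rewrite -val_eqE /= => /negbTE ->; rewrite scaler0.
Qed.

Lemma addysE V us x : addys V us x <-> exists ns, V (x - dot us ns).
Proof. exact: addysP. Qed.

Lemma addys_mono V W us : V `<=` W -> addys V us `<=` addys W us.
Proof. by move=> VW x /addysE [ns /VW Wn]; apply/addysE; exists ns. Qed.

Lemma addys_min V W us : submod W -> V `<=` W ->
  (forall u n, u \in us -> W (u *: n)) -> addys V us `<=` W.
Proof.
move=> sW VW uW x /addysE [ns /VW Wx]; rewrite -[x](subrK (dot us ns)).
apply: (subD sW) => //; apply: dot_in => // l lus; apply: uW.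
exact: mem_nth.
Qed.

Lemma addys_mem V us u n : submod V -> u \in us -> addys V us (u *: n).
Proof.
move=> sV uus; have [ns [nsE _]] := dot_pick n uus; apply/addysE; exists ns.
by rewrite nsE subrr; exact: sub0.
Qed.

Let zX zs : set X := addys [set 0] zs.

Let submod0 : submod ([set 0] : set X).
Proof. by split=> // a u v -> ->; rewrite scaler0 addr0. Qed.

Let szX zs : submod (zX zs).
Proof. exact: submod_addys. Qed.

Let zX_mem zs z n : z \in zs -> zX zs (z *: n).
Proof. exact: addys_mem. Qed.

Let zX_cons z zs : zX zs `<=` zX (z :: zs).
Proof.
apply: addys_min => // [_ ->|u n uzs]; first exact: sub0.
by apply: zX_mem; rewrite inE uzs orbT.
Qed.

Lemma dot_lower zs k ns : exists ms : nat -> X,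
  (forall l, zX zs (ms l)) /\ dot (mons zs k.+1) ns = dot (mons zs k) ms.
Proof.
pose G := [set x | exists ms : nat -> X,
  (forall l, zX zs (ms l)) /\ x = dot (mons zs k) ms].
have sG : submod G.
  split=> [|a _ _ [ms [zms ->]] [ms' [zms' ->]]].
    exists (fun=> 0); split=> [l|]; first exact: sub0.
    by rewrite /dot big1 // => l _; rewrite scaler0.
  exists (fun l => a *: ms l + ms' l); split=> [l|]; first exact: (szX _).2.
  by rewrite dotD dotZ.
suff: G (dot (mons zs k.+1) ns) by [].
apply: dot_in => // l lt; have [z [u [zzs uk ->]]] := mons_fact (mem_nth 0 lt).
have [ms [msE msP]] := dot_pick (z *: ns l) uk; exists ms; split.
  by move=> j; case: (msP j) => ->; [exact: zX_mem|exact: sub0].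
by rewrite msE scalerA mulrC.
Qed.

(* Modulo [V], every relation among the monomials of degree [k] comes from a
   relation with coefficients in [(zs)] that holds for arbitrary [zs]. *)
Lemma quasiregular_lift zs k V ns : submod V -> regs V zs ->
  V (dot (mons zs k) ns) -> exists rs : nat -> X, [/\ forall l, zX zs (rs l),
    dot (mons zs k) rs = 0 &
    forall l, (l < size (mons zs k))%N -> V (ns l - rs l)].
Proof.
elim: zs k V ns => [|z zs IHz] k V ns sV.
  move=> _; case: k => [|k] Vn; exists (fun=> 0).
    split=> //; first by rewrite /dot big1 // => l _; rewrite scaler0.
    case=> // _; rewrite subr0; move: Vn.
    by rewrite /dot big_ord_recl big_ord0 addr0 scale1r.
  by split=> //; rewrite /dot big_ord0.
move=> [rz rzs]; elim: k ns => [|k IHk] ns.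
  rewrite mons0 => Vn; exists (fun=> 0); split=> [l||[]// _].
  - exact: sub0.
  - by rewrite /dot big1 // => l _; rewrite scaler0.
  by move: Vn; rewrite subr0 /dot big_ord_recl big_ord0 addr0 scale1r.
rewrite monsS dot_cat dot_map size_map; set A := mons (z :: zs) k; set B := mons zs k.+1.
set n2 := fun l => ns _ => Vn.
have [|r2 [z2 d2 V2]] := IHz k.+1 (addy V z) n2 (submod_addy z sV) rzs.
  by exists (- dot A ns); move: Vn; rewrite scalerN opprK addrC.
(* Modulo [V] the second half is [r2 + z e] with [dot B r2 = 0]. Rewriting [dot B e] as [dot A m']
   on the monomials of degree [k] lets [z] be cancelled, leaving a relation of degree [k] with
   coefficients [ns + m']. *)
have /choice [e eP] : forall l, exists e, (l < size B)%N -> V (n2 l - r2 l - z *: e).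
  move=> l; case: (ltnP l (size B)) => lB; last by exists 0.
  by have [e Ve] := V2 l lB; exists e.
have [m [zm mE]] := dot_lower zs k e; rewrite -/B in mE.
have [m' [zm' m'E]] : exists m' : nat -> X,
    (forall l, zX (z :: zs) (m' l)) /\ dot B e = dot A m'.
  rewrite mE; pose G := [set x | exists m' : nat -> X,
    (forall l, zX (z :: zs) (m' l)) /\ x = dot A m'].
  have sG : submod G.
    split=> [|a _ _ [ms [zms ->]] [ms' [zms' ->]]].
      exists (fun=> 0); split=> [l|]; first exact: sub0.
      by rewrite /dot big1 // => l _; rewrite scaler0.
    exists (fun l => a *: ms l + ms' l); split=> [l|]; first exact: (szX _).2.
    by rewrite dotD dotZ.
  suff: G (dot (mons zs k) m) by [].
  apply: dot_in => // l lt.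
  have [ms [msE msP]] := dot_pick (m l) (mons_sub z (mem_nth 0 lt)).
  exists ms; split=> // j; case: (msP j) => ->; last exact: sub0.
  exact: zX_cons.
have [|r1 [z1 d1 V1]] := IHk (fun l => ns l + m' l).
  apply: rz; rewrite dotD -m'E scalerDr.
  have -> : z *: dot A ns + z *: dot B e = (z *: dot A ns + dot B n2) -
     dot B (fun l => n2 l - r2 l - z *: e l).
    by rewrite !dotB dotZ d2; zmod.
  apply: (subB sV) => //; apply: dot_in => // l lB; apply: (subZ sV); exact: eP.
exists (fun l => if (l < size A)%N then r1 l - m' l
                 else r2 (l - size A)%N + z *: e (l - size A)%N); split.
- move=> l; case: ifP => _; first exact: subB.
  by apply: subD => //; [exact: zX_cons|apply: zX_mem; rewrite inE eqxx].
- rewrite dot_cat dot_map size_map (@eq_dot A _ (fun l => r1 l - m' l)) => [|l ->//].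
  rewrite dotB d1 (@eq_dot B _ (fun l => r2 l + z *: e l)) => [|l _]; last first.
    by rewrite ltnNge leq_addr /= addKn.
  by rewrite dotD dotZ d2 m'E; rewrite scalerBr scaler0; zmod.
move=> l; rewrite size_cat size_map => lAB; case: ifP => lA.
  by have := V1 l lA; congr V; zmod.
move/negbT: lA; rewrite -leqNgt => lA.
have lB : (l - size A < size B)%N by rewrite ltn_subLR.
have AB := subnKC lA.
by have := eP _ lB; rewrite /n2 AB; congr V; zmod.
Qed.

Lemma quasiregular zs k V ns : submod V -> regs V zs -> V (dot (mons zs k) ns) ->
  forall l, (l < size (mons zs k))%N -> addys V zs (ns l).
Proof.
move=> sV rV Vn l lk; have [rs [zrs _ Vr]] := quasiregular_lift sV rV Vn.
rewrite -[ns l](subrK (rs l)); apply: (subD (submod_addys _ sV)).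
  by apply: addys_sub; exact: Vr.
apply: addys_mono (zrs l) => _ ->; exact: sub0.
Qed.

Lemma powers_le V zs j k : submod V -> (j <= k)%N ->
  addys V (mons zs k) `<=` addys V (mons zs j).
Proof.
move=> sV; elim: k => [|k IH]; first by rewrite leqn0 => /eqP ->.
rewrite leq_eqVlt => /orP [/eqP -> //|]; rewrite ltnS => /IH; apply: subset_trans.
apply: addys_min; [exact: submod_addys|exact: addys_sub|].
move=> v n /mons_fact [z [u [_ uk ->]]]; rewrite mulrC -scalerA; exact: addys_mem.
Qed.

Lemma powers0 V zs : submod V -> addys V (mons zs 0) = setT.
Proof.
move=> sV; apply/seteqP; split=> // x _; rewrite -[x]scale1r mons0.
by apply: addys_mem; rewrite ?inE.
Qed.

Lemma powers_step V zs k : submod V ->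
  addys (addys V (mons zs k.+1)) (mons zs k) = addys V (mons zs k).
Proof.
move=> sV; apply/seteqP; split.
  apply: addys_min; [exact: submod_addys|exact: powers_le|].
  by move=> u n uk; exact: addys_mem.
by apply: addys_mono; exact: addys_sub.
Qed.

Lemma powers_mul V zs k u n : submod V -> u \in mons zs k -> addys V zs n ->
  addys V (mons zs k.+1) (u *: n).
Proof.
move=> sV uk /addysE [ns Vn]; rewrite -[n](subrK (dot zs ns)) scalerDr.
apply: (subD (submod_addys _ sV)); first by apply: addys_sub; exact: subZ.
rewrite /dot scaler_sumr; apply: (sub_sum (submod_addys _ sV)) => l _.
rewrite scalerA mulrC; apply: addys_mem => //; apply: mons_mul => //.
exact: mem_nth.
Qed.

(** Quasi-regularity, for relations up to degree [k.+1]: the terms of that degree are first absorbed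
    into the coefficients of degree [k] by [dot_lower]. *)
Lemma powers_indep V zs k : submod V -> regs V zs ->
  indep (addys V zs) (addys V (mons zs k.+1)) (mons zs k).
Proof.
move=> sV rV; split=> [ns /addysE [m Vm] l lk|u n uk]; last exact: powers_mul.
have [m' [zm' mE]] := dot_lower zs k m.
rewrite -[ns l](subrK (m' l)); apply: (subD (submod_addys _ sV)).
  apply: (@quasiregular _ k _ (fun l => ns l - m' l)) => //.
  by rewrite dotB -mE.
apply: addys_mono (zm' l) => _ ->; exact: sub0.
Qed.

Section Range.
Variables (V : nat -> set X) (zs : seq S) (s : nat).
Hypotheses (sV : forall k, submod (V k))
  (V_step : forall k, (k < s)%N -> addys (V k.+1) (mons zs k) = V k)
  (V_ind : forall k, (k < s)%N -> indep (V 1%N) (V k.+1) (mons zs k)).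

Lemma range_addys j k : (j <= k <= s)%N -> addys (V k) (monsrange zs j k) = V j.
Proof.
elim: k => [|k IH] /andP [jk ks]; first by move: jk; rewrite leqn0 => /eqP ->.
rewrite /=; case: leqP => [jk'|kj]; first by rewrite addys_cat V_step // IH // jk' ltnW.
by have -> : j = k.+1 by lia.
Qed.

Lemma range_filt j k : (j <= k <= s)%N -> filt (V 1%N) (V k) (monsrange zs j k).
Proof.
elim: k => [//|k IH] /andP [jk ks] /=; case: leqP => [jk'|//].
apply/filt_cat; split; first by apply: free_filt => //; exact: V_ind.
by rewrite V_step //; apply: IH; rewrite jk' ltnW.
Qed.

End Range.
End Quasiregular.

Section FilteredCohomology.
Variables (S : comPzRingType) (J : set S).
Hypothesis iJ : is_ideal J.
Variables (b : nat -> nat) (D : forall i, 'M[S]_(b i.+1, b i)) (c : nat).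
Hypothesis cD : cpx D J.
Variables (V : nat -> set 'rV[S]_c) (zs : seq S) (s : nat).
Hypotheses (sV : forall k, submod (V k))
  (V_step : forall k, (k < s)%N -> addys (V k.+1) (mons zs k) = V k)
  (V_ind : forall k, (k < s)%N -> indep (V 1%N) (V k.+1) (mons zs k)).
Hypotheses (V0 : V 0%N = setT) (JVs : JV J (c := c) `<=` V s) (s_gt0 : (0 < s)%N).

Lemma Hz_up i : Hz D i setT (V 1%N) -> Hz D i setT (V s).
Proof.
rewrite -V0 -(range_addys V_step (j := 0) (k := s)) ?leqnn // => h.
apply: (filt_Hz iJ cD (sV s) JVs (sV 1%N)).
  by apply: (range_filt sV V_step V_ind); rewrite leqnn.
by move: h; rewrite (range_addys V_step) ?leqnn // V0.
Qed.

Lemma Hz_down a : noetherian S -> (s <= size zs)%N ->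
  (forall i, (a <= i)%N -> Hz D i setT (V s)) ->
  forall i, (a <= i)%N -> Hz D i setT (V 1%N).
Proof.
move=> nS szs; case: s s_gt0 JVs V_step V_ind szs => // k _ JVk stp ind szs hV.
apply: (@growth S J iJ b D c cD a (V 1%N) (V k.+1) (V k) (mons zs k)
  (monsrange zs 0 k) (monsrange zs 1 k.+1)) => //.
- exact: ind.
- by rewrite stp.
- by apply: (range_filt sV stp ind); rewrite /= leqnSn.
- by rewrite (range_addys stp) //= leqnSn.
- by apply: (range_filt sV stp ind); rewrite /= leqnn.
- by rewrite (range_addys stp) //= leqnn.
- exact: monsrange_lt.
Qed.

End FilteredCohomology.

Section Ideals.
Variable S : comPzRingType.
Implicit Types (J K : set S) (us zs : seq S).

Definition adjoin J us : set S := addys (J : set S^o) us.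

Lemma ideal_adjoin J us : is_ideal J -> is_ideal (adjoin J us).
Proof. exact: (@submod_addys S S^o). Qed.

Lemma JV_adjoin J us c : JV (adjoin J us) (c := c) = addys (JV J (c := c)) us.
Proof.
elim: us J => [|u us IH] J //; rewrite /adjoin /=.
by rewrite -[LHS]/(JV (adjoin (addy (J : set S^o) u) us) (c := c)) IH JV_addy.
Qed.

Lemma imJ_adjoin J us p q (A : 'M[S]_(p, q)) :
  imJ (adjoin J us) A = addys (imJ J A) us.
Proof.
elim: us J => [|u us IH] J //; rewrite /adjoin /=.
by rewrite -[LHS]/(imJ (adjoin (addy (J : set S^o) u) us) A) IH imJ_addy.
Qed.

Lemma regs_JV J zs c : regs (J : set S^o) zs -> regs (JV J (c := c)) zs.
Proof.
elim: zs J => [//|z zs IH] J [rz /IH]; rewrite JV_addy => rzs.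
by split=> //; exact: reg_JV.
Qed.

Lemma JV_sub J K c : J `<=` K -> JV J (c := c) `<=` JV K (c := c).
Proof. by move=> JK v Jv j; apply: JK; exact: Jv. Qed.

Lemma dot_mulmx us p q (ms : nat -> 'rV[S]_p) (A : 'M[S]_(p, q)) :
  dot us (fun l => ms l *m A) = dot us ms *m A.
Proof. by rewrite /dot mulmx_suml; apply: eq_bigr => l _; rewrite scalemxAl. Qed.

Variables (b : nat -> nat) (D : forall i, 'M[S]_(b i.+1, b i)).

Lemma cpx_sub J K : J `<=` K -> cpx D J -> cpx D K.
Proof. by move=> JK cD i; apply: rowsin_sub (cD i); exact: JV_sub. Qed.

Lemma cpx_im J i u : is_ideal J -> cpx D J ->
  imJ J (D i.+1) u -> JV J (u *m D i).
Proof.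
move=> iJ cD [w Jw]; rewrite -[u](subrK (w *m D i.+1)) mulmxDl.
apply: (subD (submod_JV iJ _)); first exact: JVr.
rewrite -mulmxA; apply/rowsin1; apply: rowsinMl; [exact: submod_JV|exact: cD].
Qed.

Section Coefficients.
Variables (J : set S) (c : nat).
Hypotheses (iJ : is_ideal J) (cD : cpx D J).
Implicit Type W : set 'rV[S]_c.

Lemma Hz_addys W zs a : submod W -> JV J (c := c) `<=` W -> regs W zs ->
  (forall i, (a <= i)%N -> Hz D i setT W) ->
  forall i, (a <= i)%N -> Hz D i setT (addys W zs).
Proof.
elim: zs W => [//|z zs IH] W sW JW [rz rzs] hW; apply: IH => //.
- exact: submod_addy.
- by apply: subset_trans JW _; exact: addyl.
move=> i ai; apply: (Hz_addy iJ cD) => //; apply: hW => //; exact: leqW.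
Qed.

Lemma Hz_nakayamas (m : set S) W zs i : noetherian S -> local_ring m ->
  {in zs, forall z, m z} -> submod W -> JV J (c := c) `<=` W -> regs W zs ->
  Hz D i setT (addys W zs) -> Hz D i setT W.
Proof.
move=> nS lm; elim: zs W => [//|z zs IH] W mzs sW JW [rz rzs] hW.
apply: (Hz_nakayama iJ cD sW JW nS lm (mzs z _) rz); first by rewrite inE eqxx.
apply: IH => //.
- by move=> z' z'zs; apply: mzs; rewrite inE z'zs orbT.
- exact: submod_addy.
- by apply: subset_trans JW _; exact: addyl.
Qed.

End Coefficients.

Section Powers.
Variables (J : set S) (zs : seq S) (s : nat).
Hypotheses (iJ : is_ideal J) (rJ : regs (J : set S^o) zs).
Let P k : set S := adjoin J (mons zs k).
Let Q : set S := adjoin J zs.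
Hypothesis cD : cpx D (P s).
Hypothesis exQ : forall i u, JV Q (u *m D i) -> imJ Q (D i.+1) u.

Let iP k : is_ideal (P k) := ideal_adjoin _ iJ.
Let sJV c : submod (JV J (c := c)) := submod_JV iJ c.
Let JP k : J `<=` P k := @addys_sub _ S^o _ _.

Let JV_P k c : JV (P k) (c := c) = addys (JV J (c := c)) (mons zs k).
Proof. exact: JV_adjoin. Qed.

Let JV_Q c : JV Q (c := c) = addys (JV J (c := c)) zs.
Proof. exact: JV_adjoin. Qed.

Let P_le j k : (j <= k)%N -> P k `<=` P j.
Proof. exact: (@powers_le S S^o J zs j k iJ). Qed.

Let indJ c k : indep (JV Q (c := c)) (JV (P k.+1) (c := c)) (mons zs k).
Proof. rewrite JV_Q JV_P; apply: powers_indep => //; exact: regs_JV. Qed.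

(* Vanishing of Tor_{i+1}(M, S/Q) propagates along the filtration by powers,
   whose factors are free over S/Q. *)
Lemma powers_exact k i u : (k <= s)%N -> JV (P k) (u *m D i) -> imJ (P k) (D i.+1) u.
Proof.
elim: k i u => [|k IH] i u ks Pu.
  by exists 0; rewrite JV_P powers0.
have Pu' : JV (P k) (u *m D i) by apply: JV_sub Pu; apply: P_le.
have [w] := IH i u (ltnW ks) Pu'; rewrite JV_P => /addysE [ms Jm].
have PP : JV (P k.+1) (dot (mons zs k) (fun l => ms l *m D i)).
  have -> : dot (mons zs k) (fun l => ms l *m D i) =
      u *m D i - (w *m (D i.+1 *m D i) + (u - w *m D i.+1 - dot (mons zs k) ms) *m D i).
    by rewrite dot_mulmx !mulmxBl mulmxA; zmod.
  apply: (subB (submod_JV (iP _) _)) => //; apply: (subD (submod_JV (iP _) _)).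
    apply/rowsin1; apply: rowsinMl; first exact: submod_JV.
    by apply: rowsin_sub (@cD i); apply: JV_sub; exact: P_le.
  by apply: JVr => //; apply: JV_sub Jm; exact: JP.
have Qm l : (l < size (mons zs k))%N -> imJ Q (D i.+1) (ms l).
  by move=> lk; apply: exQ; exact: (indJ _ _).1 PP l lk.
have /choice [x xP] : forall l, exists x, (l < size (mons zs k))%N ->
    JV Q (ms l - x *m D i.+1).
  move=> l; case: (ltnP l (size (mons zs k))) => lk; last by exists 0.
  by have [x Qx] := Qm l lk; exists x.
exists (w + dot (mons zs k) x).
have -> : u - (w + dot (mons zs k) x) *m D i.+1 = (u - w *m D i.+1 - dot (mons zs k) ms)
    + dot (mons zs k) (fun l => ms l - x l *m D i.+1).
  by rewrite dotB dot_mulmx mulmxDl; zmod.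
apply: (subD (submod_JV (iP _) _)); first by apply: JV_sub Jm; exact: JP.
apply: dot_in => [|l lk]; first exact: submod_JV.
by apply: (indJ _ _).2; [exact: mem_nth|exact: xP].
Qed.

Lemma powers_res : Jres D (P s).
Proof. by move=> i u; split; [exact: powers_exact|exact: cpx_im]. Qed.

Hypothesis s_gt0 : (0 < s)%N.

Let imV k : set 'rV[S]_(b 0) := imJ (P k) (D 0).

Let P1 : P 1 = Q. Proof. by rewrite /P mons1. Qed.

Let imV_step k : addys (imV k.+1) (mons zs k) = imV k.
Proof.
have e : adjoin (P k.+1) (mons zs k) = P k := @powers_step S S^o J zs k iJ.
by rewrite /imV -imJ_adjoin e.
Qed.

(** The vector [w *m D 0] lies in [P k], so by exactness [w] is, modulo the image of [D 1] and [J],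
    a combination [ms] of monomials. Subtracting [ms l *m D 0] turns the relation into one over the
    free module, where [powers_indep] applies. *)
Let imV_ind k : (k < s)%N -> indep (imV 1) (imV k.+1) (mons zs k).
Proof.
move=> ks; rewrite /imV P1; split=> [ns [w Pw] l lk|u n uk [w Qw]]; last first.
  exists (u *: w); rewrite -scalemxAl -scalerBr.
  by apply: (indJ _ _).2.
have Pk : JV (P k) (w *m D 0).
  have -> : w *m D 0 = dot (mons zs k) ns - (dot (mons zs k) ns - w *m D 0) by zmod.
  apply: (subB (submod_JV (iP _) _)); last by apply: JV_sub Pw; exact: P_le.
  rewrite JV_P; apply/addysE; exists ns; rewrite subrr; exact: (sub0 (sJV _)).
have [x] := powers_exact (ltnW ks) Pk; rewrite JV_P => /addysE [ms Jm].
exists (ms l); apply: ((indJ _ k).1 (fun l => ns l - ms l *m D 0)) => //.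
suff : JV (P k.+1) (dot (mons zs k) (fun l => ns l - ms l *m D 0)) by [].
rewrite dotB; have -> : dot (mons zs k) ns - dot (mons zs k) (fun l => ms l *m D 0) =
   (dot (mons zs k) ns - w *m D 0) + (x *m (D 1 *m D 0) +
   (w - x *m D 1 - dot (mons zs k) ms) *m D 0).
  by rewrite dot_mulmx !mulmxBl mulmxA; zmod.
apply: (subD (submod_JV (iP _) _)) => //; apply: (subD (submod_JV (iP _) _)).
  apply/rowsin1; apply: rowsinMl; first exact: submod_JV.
  by apply: rowsin_sub (@cD 0); apply: JV_sub; exact: P_le.
by apply: JVr => //; apply: JV_sub Jm; exact: JP.
Qed.

Let imV0 : imV 0 = setT.
Proof.
by apply/seteqP; split=> // u _; exists 0; rewrite JV_P powers0.
Qed.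

Lemma powers_Hz_up i : Hz D i setT (imJ Q (D 0)) -> Hz D i setT (imJ (P s) (D 0)).
Proof.
rewrite -P1; apply: (@Hz_up _ _ (iP s) _ _ _ cD imV zs s) => //.
- by move=> k; exact: submod_imJ.
- exact: JV_imJ.
Qed.

Lemma powers_Hz_down a : noetherian S -> (s <= size zs)%N ->
  (forall i, (a <= i)%N -> Hz D i setT (imJ (P s) (D 0))) ->
  forall i, (a <= i)%N -> Hz D i setT (imJ Q (D 0)).
Proof.
move=> nS ss; rewrite -P1; apply: (@Hz_down _ _ (iP s) _ _ _ cD imV zs s) => //.
- by move=> k; exact: submod_imJ.
- exact: JV_imJ.
Qed.

End Powers.

Section PowersRing.
Variables (J : set S) (zs : seq S) (s : nat).
Hypotheses (iJ : is_ideal J) (rJ : regs (J : set S^o) zs).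
Hypothesis cD : cpx D (adjoin J (mons zs s)).
Hypothesis s_gt0 : (0 < s)%N.

#[local] Notation V c k := (JV (adjoin J (mons zs k)) (c := c)).

Let sV c k : submod (V c k).
Proof. by apply: submod_JV; exact: ideal_adjoin. Qed.

Let V_step c k : addys (V c k.+1) (mons zs k) = V c k.
Proof.
rewrite -JV_adjoin.
have e : adjoin (adjoin J (mons zs k.+1)) (mons zs k) = adjoin J (mons zs k).
  exact: (@powers_step S S^o J zs k iJ).
by rewrite e.
Qed.

Let V_ind c k : indep (V c 1) (V c k.+1) (mons zs k).
Proof.
rewrite !JV_adjoin mons1; apply: powers_indep; first exact: submod_JV.
exact: regs_JV.
Qed.

Let V0 c : V c 0 = setT.
Proof. rewrite JV_adjoin powers0 //; exact: submod_JV. Qed.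

Lemma HzJ_up i : HzJ D (adjoin J zs) i -> HzJ D (adjoin J (mons zs s)) i.
Proof.
have -> : adjoin J zs = adjoin J (mons zs 1) by rewrite mons1.
move=> h c; have := h c.
by apply: (@Hz_up _ _ (ideal_adjoin (mons zs s) iJ) _ _ _ cD (fun k => V c k) zs s).
Qed.

Lemma HzJ_down a : noetherian S -> (s <= size zs)%N ->
  (forall i, (a <= i)%N -> HzJ D (adjoin J (mons zs s)) i) ->
  forall i, (a <= i)%N -> HzJ D (adjoin J zs) i.
Proof.
move=> nS ss h i ai c.
have -> : adjoin J zs = adjoin J (mons zs 1) by rewrite mons1.
apply: (@Hz_down _ _ (ideal_adjoin (mons zs s) iJ) _ _ _ cD
  (fun k => V c k) zs s _ _ _ _ _ _ a) => //.
by move=> j aj; exact: h.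
Qed.

End PowersRing.
End Ideals.

(** The family [D'] is a tail of [D]; the inductive form spares the casts that dimensions
    [b (i + k)] would require. *)
Inductive shifted (S : comPzRingType) : forall b (D : forall i, 'M[S]_(b i.+1, b i))
    b' (D' : forall i, 'M[S]_(b' i.+1, b' i)), Prop :=
  | Shift0 b (D : forall i, 'M[S]_(b i.+1, b i)) : shifted D D
  | ShiftS b (D : forall i, 'M[S]_(b i.+1, b i))
    b' (D' : forall i, 'M[S]_(b' i.+1, b' i)) :
      shifted (fun i => D i.+1) D' -> shifted D D'.

Section Shifted.
Variable S : comPzRingType.
Implicit Types (J : set S) (b : nat -> nat).

Lemma shifted_Jres J b (D : forall i, 'M[S]_(b i.+1, b i))
    b' (D' : forall i, 'M[S]_(b' i.+1, b' i)) :
  shifted D D' -> Jres D J -> Jres D' J.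
Proof. by elim=> // {}b {}D {}b' {}D' _ IH res; exact: (IH (fun i => res i.+1)). Qed.

Lemma shifted_HzJ J b (D : forall i, 'M[S]_(b i.+1, b i))
    b' (D' : forall i, 'M[S]_(b' i.+1, b' i)) :
  shifted D D' -> (forall i, HzJ D J i) -> forall i, HzJ D' J i.
Proof. by elim=> // {}b {}D {}b' {}D' _ IH h; exact: (IH (fun i => h i.+1)). Qed.

Lemma shifted_Hz J b (D : forall i, 'M[S]_(b i.+1, b i))
    b' (D' : forall i, 'M[S]_(b' i.+1, b' i)) :
  is_ideal J -> shifted D D' -> Jres D J -> (forall i, HzJ D J i) ->
  forall i, Hz D i setT (imJ J (D 0%N)) <-> Hz D' i setT (imJ J (D' 0%N)).
Proof.
move=> iJ; elim=> // {}b {}D {}b' {}D' _ IH res h i.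
apply: (iff_trans (Hz_syzygy iJ (Jres_cpx iJ res) h (res 0%N) i)).
exact: (IH (fun j => res j.+1) (fun j => h j.+1)).
Qed.

Lemma shifted_reg J z b (D : forall i, 'M[S]_(b i.+1, b i))
    b' (D' : forall i, 'M[S]_(b' i.+1, b' i)) :
  reg_mod (J : set S^o) z -> shifted D D' -> Jres D J ->
  reg_mod (imJ J (D 0%N)) z -> reg_mod (imJ J (D' 0%N)) z.
Proof.
move=> rz; elim=> // {}b {}D {}b' {}D' _ IH res _.
by apply: (IH (fun i => res i.+1)); exact: (@Jres_reg _ _ _ rz _ _ 0%N res).
Qed.

(* Each syzygy gains one regular element. *)
Lemma shift_regular zs J b (D : forall i, 'M[S]_(b i.+1, b i)) : is_ideal J ->
  regs (J : set S^o) zs -> Jres D J ->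
  exists b' (D' : forall i, 'M[S]_(b' i.+1, b' i)),
    [/\ shifted D D', Jres D' (adjoin J zs) & regs (imJ J (D' 0%N)) zs].
Proof.
elim: zs J b D => [|z zs IH] J b D iJ.
  by move=> _ res; exists b, D; split=> //; exact: Shift0.
move=> [rz rzs] res.
have res1 := Jres_shift_addy iJ rz res.
have [b' [D' [sh res' r']]] := IH _ _ _ (ideal_addy z iJ) rzs res1.
exists b', D'; split=> //; first exact: ShiftS.
split; last by rewrite -imJ_addy.
have rzD : reg_mod (imJ J (D 1%N)) z := @Jres_reg _ _ _ rz _ _ 0%N res.
exact: (shifted_reg rz sh (fun i => res i.+1) rzD).
Qed.

End Shifted.

(* If Hom(D, S/J) is exact in positive degrees, then [D] is exact modulo [J] from
   degree [L + 1] on. *)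
Definition dual_exact (S : comPzRingType) (J : set S) L : Prop :=
  forall b (D : forall i, 'M[S]_(b i.+1, b i)), cpx D J ->
  (forall i, HzJ D J i) -> forall i u, (L <= i)%N ->
  JV J (u *m D i) -> imJ J (D i.+1) u.

(** The cone turns a complex modulo [(J, y)] into one modulo [J]; [cone_rows] returns exactness one
    degree higher, whence [L.+1]. *)
Lemma dual_exact_addy (S : comPzRingType) (J : set S) y L : is_ideal J ->
  reg_mod (J : set S^o) y -> dual_exact J L -> dual_exact (addy (J : set S^o) y) L.+1.
Proof.
move=> iJ ry gt b D cD hD [|i] // u Li.
have [h hh] := cone_homotopy iJ cD.
apply: (cone_rows iJ ry hh) => v; apply: (gt _ (cone y D h)) => //.
  exact: cone_cpx.
by move=> j; apply: (cone_HzJ iJ ry hh); exact: hD.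
Qed.

Lemma dual_exact_adjoin (S : comPzRingType) (J : set S) zs L : is_ideal J ->
  regs (J : set S^o) zs -> dual_exact J L -> exists L', dual_exact (adjoin J zs) L'.
Proof.
elim: zs J L => [|z zs IH] J L iJ; first by exists L.
move=> [rz rzs] /(dual_exact_addy iJ rz); apply: IH => //; exact: ideal_addy.
Qed.

(** * Transfer of (SAC) to and from powers of a regular sequence *)

Section PowersSAC.
Variables (S : comPzRingType) (m J : set S) (zs : seq S) (s : nat).
Hypotheses (nS : noetherian S) (lm : local_ring m) (mzs : {in zs, forall z, m z}).
Hypotheses (iJ : is_ideal J) (rJ : regs (J : set S^o) zs).
Hypotheses (s_gt0 : (0 < s)%N) (szs : (s <= size zs)%N).

Let P : set S := adjoin J (mons zs s).
Let Q : set S := adjoin J zs.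

Let PQ : P `<=` Q.
Proof.
have := @powers_le S S^o J zs 1 s iJ s_gt0; rewrite mons1; exact.
Qed.

Let iP : is_ideal P := ideal_adjoin _ iJ.
Let iQ : is_ideal Q := ideal_adjoin _ iJ.

(** On a syzygy where [zs] is regular, [D] is exact modulo [Q] and hence modulo [P]. Eventual
    vanishing passes from [J] to [Q] and along the filtration to [P], where (SAC) holds; the growth
    argument returns to [Q], and Nakayama to [J]. *)
Lemma SACrel_of_powers : SACrel P -> SACrel J.
Proof.
move=> sac b D0 res0 hJ0 [n hM0] i0.
have [b' [D [sh resQ rD]]] := shift_regular iJ rJ res0.
have res := shifted_Jres sh res0; have hJ := shifted_HzJ sh hJ0.
have equ i := shifted_Hz iJ sh res0 hJ0 i; apply/equ.
have hM i : (n <= i)%N -> Hz D i setT (imJ J (D 0%N)).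
  by move=> ni; apply/equ; exact: hM0.
have cD := Jres_cpx iJ res.
have cP : cpx D P by apply: cpx_sub cD; exact: (@addys_sub _ S^o).
have exQ i u : JV Q (u *m D i) -> imJ Q (D i.+1) u by move/resQ.
have sW := submod_imJ iJ (D 0%N); have JW := @JV_imJ _ J _ _ (D 0%N).
apply: (Hz_nakayamas iJ cD nS lm mzs sW JW rD); rewrite -imJ_adjoin.
apply: (powers_Hz_down iJ rJ cP exQ s_gt0 (a := 0%N) nS szs) => // i _.
apply: sac; first exact: powers_res.
  move=> j; apply: HzJ_up => // c; rewrite JV_adjoin.
  apply: (Hz_addys iJ cD (a := 0%N)) => //.
  - exact: submod_JV.
  - exact: regs_JV.
  - by move=> k _; exact: hJ.
exists n => j nj; apply: powers_Hz_up => //; rewrite imJ_adjoin.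
exact: (Hz_addys iJ cD (a := n)).
Qed.

(** Growth for the ring itself gives [hQ], so duality makes [D] exact modulo [Q] from degree [L] on.
    Induction on [L] replaces the module by its first syzygy until [D] is exact everywhere, and then
    the filtration of the module by copies of its reduction modulo [Q] is available. *)
Lemma SACrel_powers L : dual_exact Q L -> SACrel Q -> SACrel P.
Proof.
move=> gt sac b D res hJ [n hM].
have hQ : forall i, HzJ D Q i.
  move=> i; apply: (HzJ_down iJ rJ (Jres_cpx iP res) s_gt0 (a := 0%N) nS szs) => //.
have exL i u : (L <= i)%N -> JV Q (u *m D i) -> imJ Q (D i.+1) u.
  by apply: gt => //; apply: cpx_sub (Jres_cpx iP res).
elim: L n b D res hJ hQ hM exL {gt} => [|L IH] n b D res hJ hQ hM exL i; last first.
  have syz j := Hz_syzygy iP (Jres_cpx iP res) hJ (res 0%N) j; apply/syz.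
  apply: (IH n _ (fun j => D j.+1)).
  - by move=> j; exact: res.
  - by move=> j; exact: hJ.
  - by move=> j; exact: hQ.
  - by move=> j nj; apply/syz; exact: hM.
  - by move=> j u Lj; exact: exL.
have cP := Jres_cpx iP res.
have exQ j u : JV Q (u *m D j) -> imJ Q (D j.+1) u by exact: exL.
have cQ : cpx D Q := cpx_sub PQ cP.
apply: powers_Hz_up => //; apply: sac => //.
  by move=> j u; split; [exact: exQ|exact: cpx_im].
by exists n; apply: (powers_Hz_down iJ rJ cP exQ s_gt0).
Qed.

End PowersSAC.

(** * Duality over a Gorenstein ring *)

Section InjectiveResolution.
Variable S : comPzRingType.

Definition act (X : lmodType S) p q (u : 'I_p -> X) (A : 'M[S]_(p, q)) : 'I_q -> X :=
  fun j => \sum_l A l j *: u l.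

Lemma act_mul (X : lmodType S) p q r (u : 'I_p -> X) (A : 'M_(p, q)) (B : 'M_(q, r)) j :
  act u (A *m B) j = act (act u A) B j.
Proof.
rewrite /act.
under eq_bigr do rewrite mxE scaler_suml.
rewrite exchange_big /=; apply: eq_bigr => k _; rewrite scaler_sumr.
by apply: eq_bigr => l _; rewrite scalerA mulrC.
Qed.

Lemma act_lin (X Y : lmodType S) (f : {linear X -> Y}) p q (u : 'I_p -> X)
  (A : 'M_(p, q)) j : f (act u A j) = act (f \o u) A j.
Proof. by rewrite linear_sum; apply: eq_bigr => l _; rewrite linearZ. Qed.

Lemma actB (X : lmodType S) p q (u v : 'I_p -> X) (A : 'M_(p, q)) j :
  act (fun l => u l - v l) A j = act u A j - act v A j.
Proof. by rewrite -sumrB; apply: eq_bigr => l _; rewrite scalerBr. Qed.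

Lemma JV0 c (u : 'rV[S]_c) : JV [set 0] u <-> u = 0.
Proof.
split=> [H|-> j]; last by rewrite mxE.
by apply/rowP => j; rewrite mxE; exact: H.
Qed.

Variables (b : nat -> nat) (D : forall i, 'M[S]_(b i.+1, b i)).
Hypotheses (cD : forall i, D i.+1 *m D i = 0)
  (exD : forall i (v : 'cV_(b i.+1)), D i.+1 *m v = 0 -> exists w, v = D i *m w).

(** A tuple [u] is a map from columns to [X]. Vanishing on the image of [D i], the kernel of
    [D i.+1], it factors through the image of [D i.+1], which is the kernel of [D i.+2], and extends
    by injectivity. *)
Lemma injective_exact (X : lmodType S) i (u : 'I_(b i.+1) -> X) :
  injective_module X -> (forall j, act u (D i) j = 0) ->
  exists w : 'I_(b i.+2) -> X, forall l, u l = act w (D i.+1) l.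
Proof.
move=> injX uD; pose phi (v : 'cV[S]_(b i.+1)) : X := \sum_l v l 0 *: u l.
have phi_lin : linear phi.
  move=> a v v'; rewrite /phi scaler_sumr -big_split; apply: eq_bigr => l _ /=.
  by rewrite !mxE scalerDl scalerA.
pose phiM := GRing.isLinear.Build S _ _ _ phi phi_lin.
pose phiL : {linear 'cV[S]_(b i.+1) -> X} := HB.pack phi phiM.
have phiD w : phi (D i *m w) = 0.
  have -> : phi (D i *m w) = act u (D i *m w) 0 by [].
  by rewrite act_mul; apply: big1 => k _; rewrite uD scaler0.
pose K : lmodType S := ker_mod (mulmx (D i.+2) : {linear 'cV[S]_(b i.+2) -> 'cV_(b i.+3)}).
have KP (x : K) : exists v, D i.+1 *m v = val x.
  by have /eqP/exD [w xw] := ker_valP x; exists w; rewrite -xw.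
have [g gP] := choice KP.
(* Independent of the preimages chosen by [g]: two of them differ by some [D i *m w], on which [phi]
   vanishes. *)
pose f x := phi (g x).
have f_lin : linear f.
  move=> a x y; apply/eqP; rewrite -subr_eq0 -[f _]/(phiL _) -[f x]/(phiL _) -[f y]/(phiL _).
  rewrite -linearP -linearB /=.
  have [|w ->] := @exD i (g (a *: x + y) - (a *: g x + g y)); last by rewrite phiD.
  rewrite mulmxBr mulmxDr -scalemxAr !gP; apply/eqP; rewrite subr_eq0.
  by apply/eqP; exact: linearP.
pose fM := GRing.isLinear.Build S _ _ _ f f_lin.
pose fL : {linear K -> X} := HB.pack f fM.
have [h hE] := injX K 'cV[S]_(b i.+2) (val : {linear K -> _}) val_inj fL.
exists (fun k => h (delta_mx k 0)) => l.
have Kl : ker_pred (mulmx (D i.+2) : {linear 'cV[S]_(b i.+2) -> 'cV_(b i.+3)})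
    (D i.+1 *m delta_mx l 0).
  by apply/eqP; rewrite /= mulmxA cD mul0mx.
have hl : h (D i.+1 *m delta_mx l 0) = phi (g (KerMod Kl)) := hE (KerMod Kl).
have -> : u l = phi (delta_mx l 0).
  rewrite /phi (bigD1 l) //= mxE !eqxx scale1r big1 ?addr0 // => k /negbTE kl.
  by rewrite mxE kl scale0r.
have -> : phi (delta_mx l 0) = phi (g (KerMod Kl)).
  apply/eqP; rewrite -subr_eq0 -[phi _]/(phiL _) -[X in _ - X]/(phiL _) -linearB /=.
  have [|w ->] := @exD i (delta_mx l 0 - g (KerMod Kl)); last by rewrite phiD.
  by rewrite mulmxBr gP subrr.
rewrite -hl /= -colE.
have {1}-> : col l (D i.+1) = \sum_k D i.+1 k l *: delta_mx k 0.
  rewrite [LHS]matrix_sum_delta; apply: eq_bigr => k _.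
  by rewrite big_ord1 !mxE.
by rewrite linear_sum; apply: eq_bigr => k _; rewrite linearZ.
Qed.

(** Dimension shift along the injective resolution: the claim is proved for the kernel of each
    [d k], starting beyond [n] where everything is zero, for all degrees of [D] at once. *)
Lemma injdim_exact n : injdim_le (S^o : lmodType S) n ->
  forall i (u : 'rV_(b i.+1)), u *m D i = 0 -> exists w, u = w *m D i.+1.
Proof.
move=> [E [e [d [injE inje ex0 exS En]]]].
have X k j : (n < k + j)%N -> forall i (u : 'I_(b i.+1) -> E k),
    (forall l, d k (u l) = 0) -> (forall l, act u (D i) l = 0) ->
    exists w : 'I_(b i.+2) -> E k, (forall l, d k (w l) = 0) /\
      forall l, u l = act w (D i.+1) l.
  elim: j k => [|j IH] k nk i u du uD.
    have Ek (y : E k) : y = 0 by apply: En; rewrite -(addn0 k).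
    by exists (fun=> 0); split=> l; rewrite ?linear0 // [u l]Ek [RHS]Ek.
  have [w0 w0E] := injective_exact (injE k) uD.
  have [|||w1 [dw1 w1E]] := IH k.+1 _ i.+1 (d k \o w0).
  - by rewrite addSnnS.
  - by move=> l /=; apply/exS; exists (w0 l).
  - by move=> l; rewrite -act_lin -w0E.
  have /choice [w2 w2E] : forall l, exists x, d k x = w1 l by move=> l; apply/exS.
  (* By induction [d k \o w0] equals [act w1 (D i.+2)]; subtracting a lift of it lands in the kernel
     of [d k] and does not change [act w0 (D i.+1)]. *)
  exists (fun l => w0 l - act w2 (D i.+2) l); split=> l.
    rewrite linearB /= [d k (w0 l)]w1E act_lin.
    by apply/eqP; rewrite subr_eq0; apply/eqP/eq_bigr => k' _; rewrite /= w2E.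
  by rewrite actB -act_mul cD -w0E /act big1 ?subr0 // => k' _; rewrite mxE scale0r.
move=> i u uD; have [|||w [dw uw]] := X 0%N n.+1 _ i (fun l => e (u 0 l)).
- by rewrite add0n.
- by move=> l; apply/ex0; exists (u 0 l).
- move=> l; rewrite -(act_lin e (fun l => u 0 l : S^o)) -[RHS](linear0 e); congr (e _).
  have := congr1 (fun v : 'rV_ _ => v 0 l) uD; rewrite !mxE => <-.
  by apply: eq_bigr => k _; rewrite mulrC.
have /choice [w' w'E] : forall l, exists x, e x = w l by move=> l; apply/ex0.
exists (\row_l w' l); apply/rowP => l; apply: inje; rewrite uw !mxE linear_sum.
by apply: eq_bigr => k _; rewrite mxE -w'E -linearZ; congr (e _); rewrite mulrC.
Qed.

End InjectiveResolution.

Lemma ideal0 (S : comPzRingType) : is_ideal ([set 0] : set S).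
Proof. by split=> // a u v -> ->; rewrite mulr0 addr0. Qed.

Lemma dual_exact_gorenstein (S : comPzRingType) (m : set S) :
  gorenstein_local m -> dual_exact [set 0 : S] 0.
Proof.
move=> [_ _ [n inj]] b D cD hD i u _ /JV0 uD.
have cD' j : D j.+1 *m D j = 0.
  by apply/row_matrixP => k; rewrite row0; apply/JV0; exact: cD.
have [|w ->] := injdim_exact cD' _ inj uD; last first.
  by exists w; rewrite subrr; exact/JV0.
move=> j v vD; have [//||w [_ Jw]] := hD j 1%N v.
  by move=> k; apply/JV0; rewrite vD row0.
exists w; apply/eqP; rewrite -subr_eq0; apply/eqP/row_matrixP => k.
by rewrite row0; apply/JV0; exact: Jw.
Qed.

(** * Modules over quotients in terms of matrices *)

Section ImageModule.
Variables (R : pzRingType) (A B : lmodType R) (f : {linear A -> B}).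

Definition im_pred : {pred B} := fun y => `[< exists x, f x = y >].

Lemma im_submod_closed : submod_closed im_pred.
Proof.
split=> [|a y z /asboolP [x <-] /asboolP [x' <-]]; apply/asboolP.
  by exists 0; rewrite linear0.
by exists (a *: x + x'); rewrite linearP.
Qed.
HB.instance Definition _ :=
  GRing.isSubmodClosed.Build R B im_pred im_submod_closed.

Record im_mod := ImMod { im_val : B; im_valP : im_pred im_val }.
HB.instance Definition _ := [isSub of im_mod for im_val].
HB.instance Definition _ := [Choice of im_mod by <:].
HB.instance Definition _ := [SubChoice_isSubLmodule of im_mod by <:].
End ImageModule.

Lemma rV_projective (R : comPzRingType) n : projective_module 'rV[R]_n.
Proof.
move=> A B g g_surj f.
have [a ga] := choice (fun j => g_surj (f (delta_mx 0 j))).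
pose h (u : 'rV[R]_n) : A := \sum_j u 0 j *: a j.
have h_lin : linear h.
  move=> c u v; rewrite /h scaler_sumr -big_split; apply: eq_bigr => j _ /=.
  by rewrite !mxE scalerDl scalerA.
pose hM := GRing.isLinear.Build R _ _ _ h h_lin.
exists (HB.pack h hM : {linear 'rV[R]_n -> A}) => u /=.
rewrite /h linear_sum {2}[u]row_sum_delta linear_sum; apply: eq_bigr => j _.
by rewrite !linearZ ga.
Qed.

Section Translation.
Variables (S R : comPzRingType) (pi : {rmorphism S -> R}) (J : set S).
Hypotheses (pi_surj : forall a, exists x, pi x = a) (pi_ker : forall x, pi x = 0 <-> J x).

Let mp p q (A : 'M[S]_(p, q)) : 'M[R]_(p, q) := map_mx pi A.

Let mpM p q r (A : 'M[S]_(p, q)) (B : 'M_(q, r)) : mp (A *m B) = mp A *m mp B.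
Proof. exact: map_mxM. Qed.

Let mpB p q (A B : 'M[S]_(p, q)) : mp (A - B) = mp A - mp B.
Proof. exact: map_mxB. Qed.

Let mp_surj p q (A : 'M[R]_(p, q)) : exists B, mp B = A.
Proof.
have [f fE] := choice (fun ij : 'I_p * 'I_q => pi_surj (A ij.1 ij.2)).
by exists (\matrix_(i, j) f (i, j)); apply/matrixP => i j; rewrite !mxE fE.
Qed.

Let mp0 c (u : 'rV[S]_c) : mp u = 0 <-> JV J u.
Proof.
split=> [u0 j|Ju]; last by apply/rowP => j; rewrite !mxE; apply/pi_ker.
by apply/pi_ker; have := congr1 (fun v : 'rV_ _ => v 0 j) u0; rewrite !mxE.
Qed.

Variables (b : nat -> nat) (D : forall i, 'M[S]_(b i.+1, b i)).
Hypothesis res : Jres D J.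

Section Module.
Variables (M : lmodType R) (e : {linear 'rV[R]_(b 0) -> M}).
Hypotheses (e_surj : forall x, exists u, e u = x)
  (e_ker : forall u, e (mp u) = 0 <-> imJ J (D 0) u).

(** Reduction of [D] modulo [J] resolves [M] over [R]. As [f] presents [N] as ['rV[S]_c / W], every
    cochain lifts to a matrix over [S]. *)
Lemma matrix_resolution : exists P : proj_resolution M,
  forall (N : lmodType R) c (f : {linear 'rV[R]_c -> N}) (W : set 'rV[S]_c) i,
  (forall x, exists u, f u = x) -> (forall u, f (mp u) = 0 <-> W u) ->
  cohomology_eq0 N P i.+1 <-> Hz D i setT W.
Proof.
pose d i : {linear 'rV[R]_(b i.+1) -> 'rV_(b i)} := mulmxr (mp (D i)).
have ex0 : exact_at (d 0) e.
  move=> x; have [u <-] := mp_surj x; split=> [/e_ker [w /mp0]|[a <-]].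
    rewrite mpB mpM => /eqP; rewrite subr_eq0 => /eqP ->; by exists (mp w).
  have [w <-] := mp_surj a; rewrite /= -mpM; apply/e_ker; exists w.
  by apply/mp0; rewrite mpB subrr.
have exS i : exact_at (d i.+1) (d i).
  move=> x; have [u <-] := mp_surj x; split=> [|[a <-]].
    rewrite /= -mpM => /mp0/res [w /mp0].
    by rewrite mpB mpM => /eqP; rewrite subr_eq0 => /eqP ->; exists (mp w).
  have [w <-] := mp_surj a; rewrite /= -!mpM; apply/mp0/res; exists w.
  by apply/mp0; rewrite mpB subrr.
exists (@ProjResolution R M (fun i => 'rV[R]_(b i) : lmodType R) d e
  (fun i => @rV_projective R _) e_surj ex0 exS) => N c f W i f_surj f_ker.
have fW r (u : 'rV[R]_r) (A : 'M[S]_(r, c)) : rowsin W A -> f (u *m mp A) = 0.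
  move=> WA; rewrite mulmx_sum_row linear_sum big1 // => k _.
  by rewrite linearZ /= -map_row (f_ker _).2 ?scaler0.
have lift r (g : {linear 'rV[R]_r -> N}) : exists A : 'M[S]_(r, c),
    forall u, g u = f (u *m mp A).
  have /choice [a aE] : forall k, exists a : 'rV[S]_c, f (mp a) = g (delta_mx 0 k).
    move=> k; have [u <-] := f_surj (g (delta_mx 0 k)).
    by have [a <-] := mp_surj u; exists a.
  exists (\matrix_k a k) => u; rewrite {1}[u]row_sum_delta linear_sum mulmx_sum_row linear_sum.
  by apply: eq_bigr => k _; rewrite !linearZ /= -map_row rowK aE.
have fA r (A : 'M[S]_(r, c)) : (forall u : 'rV_r, f (u *m mp A) = 0) -> rowsin W A.
  by move=> H k; apply/f_ker; rewrite /mp map_row rowE.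
split=> H.
  move=> v _ Wv; pose g : {linear 'rV[R]_(b i.+1) -> N} := f \o mulmxr (mp v).
  have [|k kE] := H g; first by move=> p; rewrite /g /= -mulmxA -mpM fW.
  have [w wE] := lift _ k; exists w; split=> //; apply: fA => u.
  rewrite mpB mulmxBr linearB mpM mulmxA -wE -[f (u *m mp v)]/(g u) kE.
  by rewrite /= subrr.
move=> g gc; have [v vE] := lift _ g.
have [//||w [_ Ww]] := H v.
  by apply: fA => u; rewrite mpM mulmxA -vE; exact: gc.
exists (f \o mulmxr (mp w) : {linear 'rV[R]_(b i) -> N}) => u; rewrite /= vE.
apply/eqP; rewrite -subr_eq0 -linearB -mulmxA -mpM -mulmxBr -mpB.
by rewrite fW.
Qed.

Lemma HzJ_col i : is_ideal J -> Hz D i setT (JV J (c := 1)) <-> HzJ D J i.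
Proof.
move=> iJ; split=> [H c v _ Jv|]; last exact.
have /choice [w wE] : forall j, exists w : 'cV_(b i),
    rowsin (JV J (c := 1)) (col j v - D i *m w).
  move=> j; have [//||w [_ Jw]] := H (col j v); last by exists w.
  rewrite colE mulmxA; apply: (rowsin_JVr iJ) => //.
exists (\matrix_(k, j) w j k 0); split=> //; apply/rowsin_JV => k j.
have /rowsin_JV/(_ k 0) := wE j; congr J.
rewrite !mxE; congr (_ - _); apply: eq_bigr => l _; by rewrite !mxE.
Qed.

Lemma ext_Hz i : is_ideal J ->
  (ext_eq0 i.+1 M (R^o : lmodType R) <-> HzJ D J i) /\
  (ext_eq0 i.+1 M M <-> Hz D i setT (imJ J (D 0))).
Proof.
move=> iJ; have [P PE] := matrix_resolution; split.
  apply: (iff_trans (ext_eq0P _ P i.+1)); apply: (iff_trans _ (HzJ_col i iJ)).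
  pose f (u : 'rV[R]_1) : R^o := u 0 0.
  have f_lin : linear f by move=> a u v; rewrite /f !mxE.
  pose fM := GRing.isLinear.Build R _ _ _ f f_lin.
  apply: (PE R^o 1%N (HB.pack f fM : {linear 'rV[R]_1 -> R^o})) => [x|u] /=.
    by exists (const_mx x); rewrite /f mxE.
  rewrite /f mxE; split=> [/pi_ker Ju j|Ju]; first by rewrite ord1.
  by apply/pi_ker; exact: Ju.
by apply: (iff_trans (ext_eq0P _ P i.+1)); exact: PE.
Qed.

End Module.

End Translation.

Section SACTranslation.
Variables (S R : comPzRingType) (pi : {rmorphism S -> R}) (J : set S).
Hypotheses (pi_surj : forall a, exists x, pi x = a) (pi_ker : forall x, pi x = 0 <-> J x).
Hypotheses (iJ : is_ideal J) (nS : noetherian S).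

Lemma SAC_SACrel : SAC R -> SACrel J.
Proof.
move=> sac b D res hJ [n hM] i.
have syz j := Hz_syzygy iJ (Jres_cpx iJ res) hJ (res 0%N) j; apply/syz.
pose f : {linear 'rV[R]_(b 1) -> 'rV_(b 0%N)} := mulmxr (map_mx pi (D 0%N)).
(* The first syzygy stands in for the cokernel of [D 0]: it is a submodule rather than a quotient,
   and [syz] has moved the goal to it. *)
pose M : lmodType R := im_mod f.
have fP u : im_pred f (f u) by apply/asboolP; exists u.
pose g u : M := ImMod (fP u).
have g_lin : linear g by move=> a u v; apply: val_inj; exact: linearP.
pose gM := GRing.isLinear.Build R _ _ _ g g_lin.
pose e : {linear 'rV[R]_(b 1) -> M} := HB.pack g gM.
have e_surj x : exists u, e u = x.
  by have /asboolP [u ux] := im_valP x; exists u; apply: val_inj.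
have e_ker u : e (map_mx pi u) = 0 <-> imJ J (D 1%N) u.
  have H : e (map_mx pi u) = 0 <-> map_mx pi (u *m D 0%N) = 0.
    rewrite map_mxM; split=> [/(congr1 val) //|H]; exact: val_inj.
  apply: (iff_trans H); apply: iff_trans (res 0%N u); split=> [H1 j|H1].
    by apply/pi_ker; have := congr1 (fun v : 'rV_ _ => v 0 j) H1; rewrite !mxE.
  by apply/rowP => j; rewrite mxE [RHS]mxE; apply/pi_ker; exact: H1.
have res' : Jres (fun j => D j.+1) J by move=> j; exact: res.
have ext j := @ext_Hz _ _ pi J pi_surj pi_ker _ _ res' M e e_surj e_ker j iJ.
apply/(ext i).2; apply: sac => //.
- exists (b 1), (fun j => e (delta_mx 0 j)) => x; have [u <-] := e_surj x.
  exists (fun j => u 0 j); rewrite {1}[u]row_sum_delta linear_sum.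
  by apply: eq_bigr => j _; rewrite linearZ.
- by case=> // j _; apply/(ext j).1; exact: hJ.
- exists n.+1 => -[//|j] nj; apply/(ext j).2; apply/syz; exact: hM.
Qed.

Lemma fg_matrix n (G : set 'rV[S]_n) : submod G ->
  exists p (A : 'M[S]_(p, n)), forall u, G u <-> exists w, u = w *m A.
Proof.
move=> sG; have [p [v [Gv vG]]] := @noethm_rV S nS n G sG.
exists p, (\matrix_k v k) => u; split=> [/vG [c ->]|[w ->]].
  exists (\row_k c k); rewrite mulmx_sum_row; apply: eq_bigr => k _.
  by rewrite rowK mxE.
rewrite mulmx_sum_row; apply: (sub_sum sG) => k _; rewrite rowK; exact: subZ.
Qed.

Lemma SACrel_SAC : SACrel J -> SAC R.
Proof.
move=> sac M [n [v vM]] hR [N hM].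
pose e0 (u : 'rV[R]_n) : M := \sum_j u 0 j *: v j.
have e_lin : linear e0.
  move=> c u u'; rewrite /e0 scaler_sumr -big_split; apply: eq_bigr => j _ /=.
  by rewrite !mxE scalerDl scalerA.
pose eM := GRing.isLinear.Build R _ _ _ e0 e_lin.
have [e eE] : exists e : {linear 'rV[R]_n -> M}, forall u, e u = \sum_j u 0 j *: v j.
  by exists (HB.pack e0 eM : {linear 'rV[R]_n -> M}).
have e_surj x : exists u, e u = x.
  have [c ->] := vM x; exists (\row_j c j).
  by rewrite eE; apply: eq_bigr => j _; rewrite mxE.
have JvP c (u : 'rV[S]_c) : JV J u <-> map_mx pi u = 0.
  split=> [Ju|u0 j]; first by apply/rowP => j; rewrite !mxE; apply/pi_ker.
  by apply/pi_ker; have := congr1 (fun v : 'rV_ _ => v 0 j) u0; rewrite !mxE.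
have [p0 [A0 A0P]] : exists p (A : 'M[S]_(p, n)), forall u,
    e (map_mx pi u) = 0 <-> exists w, u = w *m A.
  apply: (@fg_matrix n [set u | e (map_mx pi u) = 0]); split=> [|a u u' /= eu eu'] /=.
    by rewrite map_mx0 linear0.
  by rewrite map_mxD map_mxZ linearP eu eu' scaler0 addr0.
(* The rows of [A'] generate over [S] every vector that [A] sends into [J], the vectors with entries
   in [J] included. *)
have nxt (p q : nat) (A : 'M[S]_(p, q)) : {p' & {A' : 'M[S]_(p', p) |
    forall u, JV J (u *m A) <-> exists w, u = w *m A'}}.
  have H := fg_matrix (submod_preimage (mulmxr A) (submod_JV iJ q)).
  by exists (sval (cid H)); exact: (cid (svalP (cid H))).
pose st := fix st i : {q & {p & 'M[S]_(p, q)}} :=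
  if i is i'.+1 then
    existT _ (projT1 (projT2 (st i'))) (existT _ (projT1 (nxt _ _ (projT2 (projT2 (st i')))))
      (sval (projT2 (nxt _ _ (projT2 (projT2 (st i')))))))
  else existT _ n (existT _ p0 A0).
pose b i := projT1 (st i).
pose D i : 'M[S]_(b i.+1, b i) := projT2 (projT2 (st i)).
have DP i u : JV J (u *m D i) <-> exists w, u = w *m D i.+1.
  exact: (svalP (projT2 (nxt _ _ (projT2 (projT2 (st i)))))).
have res : Jres D J.
  move=> i u; apply: (iff_trans (DP i u)); split=> [[w ->]|[w Jw]]; first exact: imJ_row.
  apply/DP; rewrite -[u](subrK (w *m D i.+1)) mulmxDl.
  by apply: (subD (submod_JV iJ _)); [exact: JVr|apply/DP; exists w].
have e_ker u : e (map_mx pi u) = 0 <-> imJ J (D 0%N) u.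
  apply: (iff_trans (A0P u)); split=> [[w ->]|[w /JvP]]; first exact: imJ_row.
  rewrite map_mxB => /eqP; rewrite subr_eq0 => /eqP uE.
  by apply/A0P; rewrite uE; apply/A0P; exists w.
have ext i := @ext_Hz _ _ pi J pi_surj pi_ker _ _ res M e e_surj e_ker i iJ.
case=> // i _; apply/(ext i).2; apply: sac => //.
  by move=> j; apply/(ext j).1; exact: hR.
by exists N => j Nj; apply/(ext j).2; apply: hM; exact: leqW.
Qed.

Lemma SAC_iff : SAC R <-> SACrel J.
Proof. by split; [exact: SAC_SACrel|exact: SACrel_SAC]. Qed.

End SACTranslation.

Lemma SAC_self (S : comPzRingType) : noetherian S -> SAC S <-> SACrel [set 0 : S].
Proof.
move=> nS; apply: (@SAC_iff S S idfun) => // [a|]; first by exists a.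
exact: ideal0.
Qed.

Lemma SAC_quotient (S : comPzRingType) (G : set S) : noetherian S ->
  SAC (quotient_ring G) <-> SACrel (ideal_span G).
Proof.
move=> nS; pose p : S -> quotient_ring G := fun x => (\pi_(quotient_ring G) x)%qT.
pose pM := GRing.isMonoidMorphism.Build S (quotient_ring G) p
  (quotient_ring_pi_is_monoid_morphism G).
pose pZ := GRing.isZmodMorphism.Build S (quotient_ring G) p
  (quotient_ring_pi_is_zmod_morphism G).
pose pR : {rmorphism S -> quotient_ring G} := HB.pack p pM pZ.
apply: (@SAC_iff S _ pR) => //.
- by move=> a; exists (repr a); exact: reprK.
- exact: quotient_ring_pi_eq0.
- exact: ideal_span_ideal.
Qed.

(** * Permuting and modifying regular sequences *)

Section RegularSequences.
Variables (S : comPzRingType) (m : set S).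
Hypotheses (nS : noetherian S) (lm : local_ring m).
Implicit Types (J : set S) (l : seq S).

Lemma regs_cat (X : lmodType S) (V : set X) l l' :
  regs V (l ++ l') <-> regs V l /\ regs (addys V l) l'.
Proof.
elim: l V => [|a l IH] V /=; first by split=> [|[]].
by split=> [[ra /IH [rl rl']]|[[ra rl] rl']] //; split=> //; exact/IH.
Qed.

(** Locality is needed for regularity of [b] modulo [J]: an element killed by [b] is, modulo [J],
    [a] times another such element, so Nakayama applies. *)
Lemma regs_swap J a b l : is_ideal J -> m a -> regs (J : set S^o) (a :: b :: l) ->
  regs (J : set S^o) (b :: a :: l).
Proof.
move=> iJ ma [ra [rb rl]].
have rb' : reg_mod (J : set S^o) b.
  pose Z : set S^o := [set k | J (b * (k : S))].
  have sZ : submod Z.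
    split=> [|c u v Zu Zv]; first by rewrite /Z /= mulr0; exact: iJ.1.
    rewrite /Z /= mulrDr -[c *: u]/(c * (u : S)) mulrCA; exact: iJ.2.
  move=> k Jk; apply: (@nakayama S nS m lm S^o Z J a (noethm_regular nS) sZ iJ ma _ k Jk).
  move=> z Zz; have [|z' Jz] := rb z; first exact: addyl.
  exists (z - a *: z'), z'; split=> //; last by zmod.
  apply: ra; have -> : a *: (b * (z' : S) : S^o) = b * (z : S) - b * ((z : S) - a * (z' : S)).
    by rewrite -[a *: _]/(a * (b * (z' : S))); ring.
  by apply: (@subB S S^o J iJ) => //; exact: (@subZ S S^o J iJ).
split=> //; split; last by rewrite addyC.
move=> n [k Jk].
have [|w Jw] := rb k.
  exists n; rewrite -opprB; exact: (@subN S S^o J iJ).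
exists w; apply: ra.
have -> : a *: (n - b *: w) = (a *: n - b *: k) + b *: (k - a *: w) :> S^o.
  by rewrite !scalerBr !scalerA [a * b]mulrC; zmod.
by apply: (@subD S S^o J iJ) => //; exact: (@subZ S S^o J iJ).
Qed.

Lemma regs_move J a l r : is_ideal J -> m a ->
  regs (J : set S^o) (a :: l ++ r) -> regs (J : set S^o) (l ++ a :: r).
Proof.
move=> iJ ma; elim: l J iJ => //= b l IH J iJ rJ.
have [rb [ra rlr]] := regs_swap iJ ma rJ; split=> //.
by apply: IH; [exact: ideal_addy|split].
Qed.

Lemma regs_perm J l l' : is_ideal J -> {in l, forall a, m a} -> perm_eq l l' ->
  regs (J : set S^o) l -> regs (J : set S^o) l'.
Proof.
move=> iJ ml pl rl.
suff [_ //] : {in l', forall a, m a} /\ regs (J : set S^o) l'.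
apply: (catCA_perm_ind (P := fun l => {in l, forall a, m a} /\ regs (J : set S^o) l) _ pl) => //.
move=> s1 s2 s3 [ms rs]; split.
  by move=> a; rewrite !mem_cat orbCA -!mem_cat; exact: ms.
elim: s1 J iJ {rl} ms rs => //= a s1 IH J iJ ms [ra rs].
have ma : m a by apply: ms; rewrite inE eqxx.
apply: regs_move => //; split=> //; apply: IH => //; first exact: ideal_addy.
by move=> c cs; apply: ms; rewrite inE cs orbT.
Qed.

Lemma reg_mod_exp J x k : reg_mod (J : set S^o) x -> reg_mod (J : set S^o) (x ^+ k).
Proof.
move=> rx; elim: k => [|k IH] n; first by rewrite expr0 scale1r.
by rewrite exprS -scalerA => /rx/IH.
Qed.

Lemma ideal_exp x k : m x -> (0 < k)%N -> m (x ^+ k).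
Proof.
case: k => // k mx _; rewrite exprSr; case: lm => -[im _ _] _.
exact: (@subZ S S^o m im).
Qed.

(** Only the last element can be raised to a power without affecting later conditions, so each is
    moved to the end in turn; [l'] lists those already treated. *)
Lemma regs_exp J (T : eqType) (f : T -> S) (alpha : T -> nat) (l : seq T) : is_ideal J ->
  (forall i, m (f i)) -> (forall i, (0 < alpha i)%N) ->
  regs (J : set S^o) (map f l) -> regs (J : set S^o) (map (fun i => f i ^+ alpha i) l).
Proof.
move=> iJ mf al; set g := fun i => _.
have mg i : m (g i) by apply: ideal_exp.
suff H (l' : seq T) : regs (J : set S^o) (map f l ++ map g l') ->
    regs (J : set S^o) (map g (l ++ l')).
  by move=> rl; rewrite -[l]cats0; apply: H; rewrite cats0.
have min (l1 l2 : seq T) : {in map f l1 ++ map g l2, forall a, m a}.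
  by move=> a; rewrite mem_cat => /orP [] /mapP [i _ ->].
elim: l l' => [|i l IH] l' rl; first exact: rl.
have rl1 : regs (J : set S^o) ((map f l ++ map g l') ++ [:: f i]).
  apply: (regs_perm iJ _ _ rl); first exact: (min (i :: l) l').
  by rewrite perm_sym perm_catC.
have rl2 : regs (J : set S^o) (map f l ++ map g (i :: l')).
  have r' : regs (J : set S^o) ((map f l ++ map g l') ++ [:: g i]).
    move: rl1 => /regs_cat [r1 [r2 _]]; apply/regs_cat; split=> //; split=> //.
    exact: (@reg_mod_exp (addys (J : set S^o) _)).
  apply: (regs_perm iJ _ _ r').
    move=> a; rewrite mem_cat => /orP [|]; first exact: min.
    by rewrite inE => /eqP ->.
  by rewrite -catA perm_cat2l -[map g (i :: l')]/([:: g i] ++ map g l') perm_catC.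
apply: (regs_perm iJ _ _ (IH _ rl2)); first by move=> a /mapP [j _ ->].
by apply: perm_map; rewrite -cat1s perm_catCA.
Qed.

Lemma regs_congr J (T : eqType) (f g : T -> S) (l : seq T) : is_ideal J ->
  (forall i, J (f i - g i)) -> regs (J : set S^o) (map f l) ->
  regs (J : set S^o) (map g l).
Proof.
elim: l J => //= i l IH J iJ fg.
have H p q : J (p - q) -> addy (J : set S^o) p `<=` addy (J : set S^o) q.
  move=> Jpq x [n Jx]; exists n.
  have -> : x - q *: n = (x - p *: n) + (n : S) * (p - q).
    by rewrite -[q *: n]/(q * n) -[p *: n]/(p * n); ring.
  by apply: (@subD S S^o J iJ) => //; exact: (@subZ S S^o J iJ).
have eqa : addy (J : set S^o) (f i) = addy (J : set S^o) (g i).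
  apply/seteqP; split; apply: H => //; rewrite -opprB; exact: (@subN S S^o J iJ).
move=> [rf rl]; split.
  move=> n Jn; apply: rf.
  have -> : f i *: n = g i *: n + (n : S) * (f i - g i).
    by rewrite -[f i *: n]/(f i * n) -[g i *: n]/(g i * n); ring.
  by apply: (@subD S S^o J iJ) => //; exact: (@subZ S S^o J iJ).
rewrite -eqa; apply: IH => //; first exact: ideal_addy.
by move=> j; apply: addyl.
Qed.

Lemma ideal_span_adjoin l : ideal_span [set` l] = adjoin [set 0] l.
Proof.
apply/seteqP; split=> [|x].
  apply: smallest_sub; first by apply: ideal_adjoin; exact: ideal0.
  move=> a al; rewrite -[a]mulr1; apply: (@addys_mem S S^o) => //; exact: ideal0.
have iI := @ideal_span_ideal S [set` l].
apply: (@addys_min S S^o [set 0]) => // [_ ->|u n ul]; first exact: iI.1.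
rewrite -[u *: n]/(u * (n : S)) mulrC; apply: (@subZ S S^o _ iI).
by move=> I [_]; apply.
Qed.

Lemma regs_nth (X : lmodType S) (V : set X) l :
  (forall k, (k < size l)%N -> reg_mod (addys V (take k l)) l`_k) -> regs V l.
Proof.
elim: l V => //= a l IH V H; split; first exact: (H 0%N).
by apply: IH => k kl; exact: (H k.+1).
Qed.

Lemma regular_sequence_regs l : regular_sequence m l -> regs ([set 0] : set S^o) l.
Proof.
move=> [_ H]; apply: regs_nth => k kl n; rewrite -[addys _ _]/(adjoin _ _).
rewrite -ideal_span_adjoin => Hn; apply: (H k kl).
by rewrite mulrC.
Qed.

End RegularSequences.

Lemma SACrel_regs (S : comPzRingType) (m J : set S) (l : seq S) :
  noetherian S -> local_ring m -> {in l, forall a, m a} -> is_ideal J ->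
  regs (J : set S^o) l -> SACrel J <-> SACrel (adjoin J l).
Proof.
move=> nS lm; elim: l J => //= a l IH J ml iJ [ra rl].
have := IH (addy (J : set S^o) a) _ (ideal_addy a iJ) rl.
case=> [b bl|H1 H2]; first by apply: ml; rewrite inE bl orbT.
split=> H; first by apply: H1; exact: SACrel_descend.
apply: (SACrel_lift nS lm (ml a _) iJ ra); first by rewrite inE eqxx.
exact: H2.
Qed.

(** * Relations among the maximal minors of a Toeplitz matrix *)

Section Relations.
Variable S : comPzRingType.

Definition delta (I : finType) (i : I) : I -> S^o := fun j => (j == i)%:R.

Lemma delta_decomp (I : finType) (c : I -> S^o) : c = \sum_i (c i : S) *: delta i.
Proof.
apply/funext => j; rewrite fct_sumE (bigD1 j) //= big1 => [|i /negbTE ij].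
  by rewrite addr0 -[RHS]/(c j * (j == j)%:R) eqxx mulr1.
by rewrite -[LHS]/(c i * (j == i)%:R) eq_sym ij mulr0.
Qed.

Section Matrix.
Variables (s t : nat) (A : 'M[S]_(s, t)).

(** Columns are selected by all maps, not only increasing ones; [RelPerm] and [RelDup] impose
    alternation. *)
Definition coef := {ffun 'I_s -> 'I_t} -> S^o.
Definition dlt (g : 'I_s -> 'I_t) : coef := delta (finfun g).

Definition minor (g : 'I_s -> 'I_t) : S := \det (colsub g A).

Definition ev (c : coef) : S := \sum_g (c g : S) * minor g.

(* [RelRow] is an Eagon-Northcott relation: the expansion of a determinant in which
   row [i] of [A] is repeated. *)
Inductive minor_rel : coef -> Prop :=
  | Rel0 : minor_rel 0
  | RelP a u v : minor_rel u -> minor_rel v -> minor_rel (a *: u + v)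
  | RelPerm g (p : 'S_s) : minor_rel (dlt (g \o p) - (-1) ^+ p *: dlt g)
  | RelDup g i j : i != j -> g i = g j -> minor_rel (dlt g)
  | RelRow i (h : 'I_s.+1 -> 'I_t) :
      minor_rel (\sum_(k < s.+1) ((-1) ^+ k * A i (h k)) *: dlt (h \o lift k)).

Lemma evP a u v : ev (a *: u + v) = a * ev u + ev v.
Proof.
rewrite /ev mulr_sumr -big_split; apply: eq_bigr => g _ /=.
by rewrite -[(a *: u + v) g]/(a * u g + v g) mulrDl mulrA.
Qed.

Lemma ev_dlt g : ev (dlt g) = minor g.
Proof.
rewrite /ev (bigD1 (finfun g)) //= /dlt /delta eqxx mul1r big1 ?addr0.
  by rewrite /minor; congr (\det _); apply/matrixP => i j; rewrite !mxE ffunE.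
by move=> h /negbTE ->; rewrite mul0r.
Qed.

Lemma ev0 : ev 0 = 0.
Proof. by rewrite /ev big1 // => g _; rewrite mul0r. Qed.

Lemma evD u v : ev (u + v) = ev u + ev v.
Proof. by have := evP 1 u v; rewrite scale1r mul1r. Qed.

Lemma evZ a u : ev (a *: u) = a * ev u.
Proof. by have := evP a u 0; rewrite ev0 !addr0. Qed.

Lemma evB u v : ev (u - v) = ev u - ev v.
Proof. by rewrite evD -scaleN1r evZ mulN1r. Qed.

Lemma ev_sum I (r : seq I) (F : I -> coef) :
  ev (\sum_(i <- r) F i) = \sum_(i <- r) ev (F i).
Proof. by apply: (big_morph ev evD ev0). Qed.

Lemma minor_perm g (p : 'S_s) : minor (g \o p) = (-1) ^+ p * minor g.
Proof.
have -> : minor (g \o p) = \det (col_perm p (colsub g A)).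
  by congr (\det _); apply/matrixP => i j; rewrite !mxE.
by rewrite col_permE det_mulmx det_perm odd_permV mulrC.
Qed.

Lemma minor_dup g i j : i != j -> g i = g j -> minor g = 0.
Proof.
move=> ij gij; rewrite /minor -det_tr; apply: (determinant_alternate ij) => k.
by rewrite !mxE gij.
Qed.

Lemma rel_ev c : minor_rel c -> ev c = 0.
Proof.
elim=> [||g p|g i j ij gij|i h].
- exact: ev0.
- by move=> a u v _ eu _ e_v; rewrite evP eu e_v mulr0 addr0.
- by rewrite evB evZ !ev_dlt minor_perm subrr.
- by rewrite ev_dlt (minor_dup ij gij).
pose B : 'M[S]_s.+1 := \matrix_(k, j) A (if unlift ord0 k is Some k' then k' else i) (h j).
have <- : \det B = 0.
  apply: (@determinant_alternate _ _ B ord0 (lift ord0 i)) => // j.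
  by rewrite !mxE unlift_none liftK.
rewrite (expand_det_row _ ord0) ev_sum; apply: eq_bigr => k _.
rewrite evZ ev_dlt mxE unlift_none /cofactor add0n mulrA [X in X * _ = _]mulrC.
congr (_ * \det _); apply/matrixP => i' j; by rewrite !mxE liftK.
Qed.

Definition relJ (J : set S) (c : coef) : Prop :=
  exists2 e, minor_rel e & forall g, J (c g - e g).

Lemma relJ_submod (J : set S) : is_ideal J -> @submod S coef (relJ J).
Proof.
move=> iJ; split=> [|a u v [e re Je] [f rf Jf]].
  by exists 0; [exact: Rel0|move=> g; rewrite subrr; exact: iJ.1].
exists (a *: e + f); first exact: RelP.
move=> g; rewrite -[(a *: u + v) g]/(a * u g + v g) -[(a *: e + f) g]/(a * e g + f g).
have -> : a * u g + v g - (a * e g + f g) = a * (u g - e g) + (v g - f g).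
  by rewrite mulrBr; zmod.
exact: iJ.2.
Qed.

Lemma relJ_rel (J : set S) c : is_ideal J -> minor_rel c -> relJ J c.
Proof. by move=> iJ rc; exists c => // g; rewrite subrr; exact: iJ.1. Qed.

Lemma relJ_J (J : set S) c : is_ideal J -> (forall g, J (c g)) -> relJ J c.
Proof.
move=> iJ Jc; exists 0 => [|g]; first exact: Rel0.
have -> : c g - (0 : coef) g = c g by exact: subr0.
exact: Jc.
Qed.

Lemma relJ_ev (J : set S) c : is_ideal J -> relJ J c -> J (ev c).
Proof.
move=> iJ [e re Je]; rewrite -[c](subrK e) evD (rel_ev re) addr0.
apply: (@sub_sum S S^o J iJ) => g _; rewrite mulrC.
apply: (@subZ S S^o J iJ); exact: Je.
Qed.

Lemma relJ_noninj (J : set S) g : is_ideal J -> ~ injective g -> relJ J (dlt g).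
Proof.
move=> iJ ninj; have [i [j [ij gij]]] : exists i j, i != j /\ g i = g j.
  apply: contrapT => no; apply: ninj => i j gij; apply/eqP; apply: contraT => ij.
  by case: no; exists i, j.
by apply: relJ_rel => //; exact: (RelDup ij gij).
Qed.

End Matrix.

Lemma dlt_ext s t (g h : 'I_s -> 'I_t) : g =1 h -> dlt g = dlt h.
Proof. by move=> gh; congr (delta _); apply/ffunP => i; rewrite !ffunE. Qed.

Definition linext (s t s' t' : nat) (F : ('I_s -> 'I_t) -> coef s' t')
  (c : coef s t) : coef s' t' := \sum_g (c g : S) *: F g.

Section LinExt.
Variables (s t s' t' : nat) (F : ('I_s -> 'I_t) -> coef s' t').
Hypothesis F_ext : forall g h, g =1 h -> F g = F h.

Lemma linextP a u v : linext F (a *: u + v) = a *: linext F u + linext F v.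
Proof.
rewrite /linext scaler_sumr -big_split; apply: eq_bigr => g _ /=.
by rewrite -[(a *: u + v) g]/(a * u g + v g) scalerDl scalerA.
Qed.

Lemma linext0 : linext F 0 = 0.
Proof. by rewrite /linext big1 // => g _; rewrite scale0r. Qed.

Lemma linextD u v : linext F (u + v) = linext F u + linext F v.
Proof. by have := linextP 1 u v; rewrite !scale1r. Qed.

Lemma linextZ a u : linext F (a *: u) = a *: linext F u.
Proof. by have := linextP a u 0; rewrite linext0 !addr0. Qed.

Lemma linextB u v : linext F (u - v) = linext F u - linext F v.
Proof. by rewrite linextD -scaleN1r linextZ scaleN1r. Qed.

Lemma linext_sum I (r : seq I) (G : I -> coef s t) :
  linext F (\sum_(i <- r) G i) = \sum_(i <- r) linext F (G i).
Proof. by apply: (big_morph (linext F) linextD linext0). Qed.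

Lemma linext_dlt g : linext F (dlt g) = F g.
Proof.
rewrite /linext (bigD1 (finfun g)) //= /dlt /delta eqxx scale1r big1 ?addr0.
  by apply: F_ext => i; rewrite ffunE.
by move=> h /negbTE ->; rewrite scale0r.
Qed.

End LinExt.

Definition cons0 s t (k : 'I_s -> 'I_t) : 'I_s.+1 -> 'I_t.+1 :=
  fun j => if unlift ord0 j is Some j' then lift ord0 (k j') else ord0.

Lemma cons0_0 s t (k : 'I_s -> 'I_t) : cons0 k ord0 = ord0.
Proof. by rewrite /cons0 unlift_none. Qed.

Lemma cons0_lift s t (k : 'I_s -> 'I_t) j : cons0 k (lift ord0 j) = lift ord0 (k j).
Proof. by rewrite /cons0 liftK. Qed.

Definition cons0_dlt s t (k : 'I_s -> 'I_t) : coef s.+1 t.+1 := dlt (cons0 k).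
Definition lift_dlt s t (g : 'I_s -> 'I_t) : coef s t.+1 := dlt (lift ord0 \o g).

Lemma cons0_dlt_ext s t (g h : 'I_s -> 'I_t) : g =1 h -> cons0_dlt g = cons0_dlt h.
Proof.
by move=> gh; apply: dlt_ext => j; rewrite /cons0; case: unliftP => // k _; rewrite gh.
Qed.

Lemma lift_dlt_ext s t (g h : 'I_s -> 'I_t) : g =1 h -> lift_dlt g = lift_dlt h.
Proof. by move=> gh; apply: dlt_ext => j /=; rewrite gh. Qed.

Lemma ord_split n (j : 'I_n.+1) : j = ord0 \/ exists j', j = lift ord0 j'.
Proof. by case: (unliftP ord0 j) => [j' ->|->]; [right; exists j'|left]. Qed.

Section Peel.
Variables (s t : nat) (A : 'M[S]_(s.+1, t.+1)) (J : set S).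
Hypothesis iJ : is_ideal J.
Let A1 : 'M[S]_(s.+1, t) := \matrix_(i, j) A i (lift ord0 j).
Let A2 : 'M[S]_(s, t) := \matrix_(i, j) A (lift ord0 i) (lift ord0 j).
Hypothesis col0 : forall i, J (A (lift ord0 i) ord0).

Let emb1 := linext (@lift_dlt s.+1 t).
Let emb2 := linext (@cons0_dlt s t).

Let emb1_dlt g : emb1 (dlt g) = lift_dlt g.
Proof. by apply: linext_dlt; exact: lift_dlt_ext. Qed.

Let emb2_dlt g : emb2 (dlt g) = cons0_dlt g.
Proof. by apply: linext_dlt; exact: cons0_dlt_ext. Qed.

Let sE : @submod S (coef _ _) (relJ A J) := relJ_submod A iJ.

Lemma rel_emb1 e : minor_rel A1 e -> minor_rel A (emb1 e).
Proof.
elim=> [||g p|g i j ij gij|i h].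
- by rewrite /emb1 linext0; exact: Rel0.
- by move=> a u v _ ru _ rv; rewrite /emb1 linextP; exact: RelP.
- by rewrite /emb1 linextB linextZ -/emb1 !emb1_dlt; exact: RelPerm.
- by rewrite emb1_dlt; apply: (RelDup _ ij) => /=; rewrite gij.
have := RelRow A i (lift ord0 \o h); congr (minor_rel _ _).
rewrite /emb1 linext_sum; apply: eq_bigr => k _.
by rewrite linextZ -/emb1 emb1_dlt mxE.
Qed.

Lemma cons0_lift_lift n (h : 'I_n.+1 -> 'I_t) k :
  cons0 h \o lift (lift ord0 k) =1 cons0 (h \o lift k).
Proof.
move=> j; case: (ord_split j) => [->|[j' ->]] /=.
  rewrite cons0_0 (_ : lift _ _ = ord0) ?cons0_0 //; exact: val_inj.
rewrite cons0_lift (_ : lift _ _ = lift ord0 (lift k j')) ?cons0_lift //.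
by apply: val_inj; rewrite /= /bump !leq0n !add1n ltnS addnS.
Qed.

Lemma RelRow_cons0 n i (h : 'I_n.+1 -> 'I_t) (B : 'M[S]_(n.+1, t.+1)) :
  minor_rel B (B i ord0 *: lift_dlt h -
    \sum_(k < n.+1) ((-1) ^+ k * B i (lift ord0 (h k))) *: cons0_dlt (h \o lift k)).
Proof.
have := RelRow B i (cons0 h); congr (minor_rel _ _).
rewrite big_ord_recl expr0 mul1r cons0_0; congr (_ *: _ + _).
  by apply: dlt_ext => j /=; rewrite cons0_lift.
rewrite -sumrN; apply: eq_bigr => k _.
rewrite lift0 exprS mulN1r mulNr scaleNr cons0_lift; congr (- (_ *: _)).
exact: dlt_ext (cons0_lift_lift _ _).
Qed.

Lemma rel_emb2 e : minor_rel A2 e -> relJ A J (emb2 e).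
Proof.
elim=> [||g p|g i j ij gij|i h].
- by rewrite /emb2 linext0; apply: relJ_rel => //; exact: Rel0.
- by move=> a u v _ ru _ rv; rewrite /emb2 linextP; exact: sE.2.
- rewrite /emb2 linextB linextZ -/emb2 !emb2_dlt; apply: relJ_rel => //.
  have := RelPerm A (cons0 g) (lift_perm ord0 ord0 p).
  rewrite odd_lift_perm /=; congr (minor_rel _ (_ - _)); apply: dlt_ext => j /=.
  case: (ord_split j) => [->|[j' ->]]; first by rewrite lift_perm_id !cons0_0.
  by rewrite lift_perm_lift !cons0_lift.
- rewrite emb2_dlt; apply: relJ_rel => //.
  apply: (@RelDup _ _ _ _ (lift ord0 i) (lift ord0 j)).
    by rewrite (inj_eq lift_inj).
  by rewrite !cons0_lift gij.
(* The corresponding row relation of [A] has one more term, whose coefficient lies below the top of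
   column 0 and hence in [J]. *)
have -> : emb2 (\sum_(k < s.+1) ((-1) ^+ k * A2 i (h k)) *: dlt (h \o lift k)) =
    A (lift ord0 i) ord0 *: lift_dlt h - (A (lift ord0 i) ord0 *: lift_dlt h -
    \sum_(k < s.+1) ((-1) ^+ k * A (lift ord0 i) (lift ord0 (h k))) *: cons0_dlt (h \o lift k)).
  rewrite opprB addrCA subrr addr0 /emb2 linext_sum; apply: eq_bigr => k _.
  by rewrite linextZ -/emb2 emb2_dlt mxE.
apply: (subB sE); last by apply: relJ_rel => //; exact: RelRow_cons0.
apply: relJ_J => // g; rewrite -[(_ *: _) g]/(_ * lift_dlt h g) mulrC.
exact: (@subZ S S^o J iJ).
Qed.

(** Modulo standard relations, [c] involves only minors that contain column 0. *)
Let good c := exists c4, relJ A J (c - emb2 c4).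

Let good_submod : @submod S (coef _ _) good.
Proof.
split=> [|a u v [c rc] [d rd]].
  by exists 0; rewrite /emb2 linext0 subrr; exact: (sub0 sE).
exists (a *: c + d); rewrite /emb2 linextP -/emb2.
have -> : a *: u + v - (a *: emb2 c + emb2 d) = a *: (u - emb2 c) + (v - emb2 d).
  by rewrite scalerBr; zmod.
exact: sE.2.
Qed.

Let good_rel c : relJ A J c -> good c.
Proof. by move=> rc; exists 0; rewrite /emb2 linext0 subr0. Qed.

Let good_cons0 g : good (cons0_dlt g).
Proof. by exists (dlt g); rewrite emb2_dlt subrr; exact: (sub0 sE). Qed.

Let good_zero g i0 : g i0 = ord0 -> good (dlt g).
Proof.
move=> gi0; have [inj|ninj] := pselect (injective g); last first.
  by apply: good_rel; exact: relJ_noninj.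
pose p := tperm ord0 i0; pose g' := g \o p.
have g'0 : g' ord0 = ord0 by rewrite /g' /= tpermL.
have /choice [k kE] : forall j, exists k, g' (lift ord0 j) = lift ord0 k.
  move=> j; case: (ord_split (g' (lift ord0 j))) => [|[k ->]]; last by exists k.
  by rewrite -g'0 => /inj/perm_inj/eqP; rewrite eq_sym (negbTE (neq_lift _ _)).
have g'E : dlt g' = cons0_dlt k.
  apply: dlt_ext => j; case: (ord_split j) => [->|[j' ->]].
    by rewrite cons0_0.
  by rewrite cons0_lift.
have -> : dlt g = (-1) ^+ p *: dlt g' - (-1) ^+ p *: (dlt g' - (-1) ^+ p *: dlt g).
  by rewrite scalerBr scalerA -expr2 sqrr_sign scale1r; zmod.
apply: (subB good_submod); apply: (subZ good_submod).
  by rewrite g'E; exact: good_cons0.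
by apply: good_rel; apply: relJ_rel => //; exact: RelPerm.
Qed.

(** The relation of row 0 has leading coefficient [z] modulo [J], and all its other terms contain
    column 0. *)
Lemma good_lift g (z : S) : J (A ord0 ord0 - z) -> good (z *: lift_dlt g).
Proof.
move=> Jz.
have -> : z *: lift_dlt g = - ((A ord0 ord0 - z) *: lift_dlt g) +
    ((A ord0 ord0 *: lift_dlt g -
     \sum_(k < s.+1) ((-1) ^+ k * A ord0 (lift ord0 (g k))) *: cons0_dlt (g \o lift k)) +
     \sum_(k < s.+1) ((-1) ^+ k * A ord0 (lift ord0 (g k))) *: cons0_dlt (g \o lift k)).
  by rewrite scalerBl; zmod.
apply: (subD good_submod).
  apply: good_rel; apply: (subN sE); apply: relJ_J => // g'.
  rewrite -[(_ *: _) g']/(_ * lift_dlt g g') mulrC; exact: (@subZ S S^o J iJ).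
apply: (subD good_submod).
  by apply: good_rel; apply: relJ_rel => //; exact: RelRow_cons0.
by apply: (sub_sum good_submod) => k _; apply: (subZ good_submod); exact: good_cons0.
Qed.

Lemma peel_lift (c : coef s.+1 t.+1) : exists c1 : coef s.+1 t, good (c - emb1 c1).
Proof.
pose G := [set c : coef s.+1 t.+1 | exists c1 : coef s.+1 t, good (c - emb1 c1)].
have sG : @submod S (coef _ _) G.
  split=> [|a u v [c1 gu] [d1 gv]].
    by exists 0; rewrite /emb1 linext0 subrr; exact: (sub0 good_submod).
  exists (a *: c1 + d1); rewrite /emb1 linextP -/emb1.
  have -> : a *: u + v - (a *: emb1 c1 + emb1 d1) = a *: (u - emb1 c1) + (v - emb1 d1).
    by rewrite scalerBr; zmod.
  exact: good_submod.2.
suff: G c by [].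
rewrite [c]delta_decomp; apply: (sub_sum sG) => g _; apply: (subZ sG).
have -> : delta g = dlt g by congr delta; apply/ffunP => i; rewrite ffunE.
have [[i gi]|no] := pselect (exists i, g i = ord0).
  by exists 0; rewrite /emb1 linext0 subr0; exact: good_zero gi.
have /choice [g' g'E] : forall i, exists k, g i = lift ord0 k.
  by move=> i; case: (ord_split (g i)) => // gi; case: no; exists i.
exists (dlt g'); rewrite emb1_dlt (_ : dlt g = lift_dlt g'); last exact: dlt_ext.
by rewrite subrr; exact: (sub0 good_submod).
Qed.

Lemma minor_cons0 k : J (minor A (cons0 k) - A ord0 ord0 * minor A2 k).
Proof.
rewrite /minor (expand_det_col _ ord0) big_ord_recl addrAC.
have -> : colsub (cons0 k) A ord0 ord0 * cofactor (colsub (cons0 k) A) ord0 ord0 =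
    A ord0 ord0 * \det (colsub k A2).
  rewrite mxE cons0_0 /cofactor expr0 mul1r; congr (_ * \det _).
  by apply/matrixP => i j; rewrite !mxE cons0_lift.
rewrite subrr add0r; apply: (@sub_sum S S^o J iJ) => i _.
rewrite mxE cons0_0 mulrC; exact: (@subZ S S^o J iJ).
Qed.

Lemma ev_emb1 c : ev A (emb1 c) = ev A1 c.
Proof.
rewrite /emb1 /linext ev_sum /ev; apply: eq_bigr => g _.
rewrite -/(ev _ _) evZ ev_dlt; congr (_ * \det _).
by apply/matrixP => i j; rewrite !mxE.
Qed.

Lemma ev_emb2 c : J (ev A (emb2 c) - A ord0 ord0 * ev A2 c).
Proof.
rewrite /emb2 /linext ev_sum /ev mulr_sumr -sumrB.
apply: (@sub_sum S S^o J iJ) => g _; rewrite -/(ev _ _) evZ ev_dlt.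
by rewrite mulrCA -mulrBr; apply: (@subZ S S^o J iJ); exact: minor_cons0.
Qed.

Lemma relJ_emb2 c : relJ A2 J c -> relJ A J (emb2 c).
Proof.
move=> [e re Je]; rewrite -[c](subrK e) /emb2 linextD -/emb2.
apply: (subD sE); last exact: rel_emb2.
apply: relJ_J => // g; rewrite /emb2 /linext fct_sumE.
apply: (@sub_sum S S^o J iJ) => g' _.
rewrite -[(_ *: _) g]/(_ * _) mulrC; apply: (@subZ S S^o J iJ); exact: Je.
Qed.

Variable z : S.
Hypotheses (Az : J (A ord0 ord0 - z)) (rz : reg_mod (J : set S^o) z).

(** Write [c] as [emb1 c1 + emb2 c3]. Modulo [z] the second part evaluates to 0, so [c1] is standard
    up to a multiple of [z], and [good_lift] moves that multiple to minors containing column 0. Thus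
    [c] becomes some [emb2 c4] with [z * ev A2 c4] in [J], and [z] cancels. *)
Lemma relations_peel c :
  (forall c1 : coef s.+1 t, addy (J : set S^o) z (ev A1 c1) ->
     relJ A1 (addy (J : set S^o) z) c1) ->
  (forall c2 : coef s t, J (ev A2 c2) -> relJ A2 J c2) ->
  J (ev A c) -> relJ A J c.
Proof.
move=> IH1 IH2 Jc; have iJz := ideal_addy z iJ.
have [c1 [c3 r3]] := peel_lift c.
have JA0 a : addy (J : set S^o) z (A ord0 ord0 * a).
  exists (a : S^o); have -> : A ord0 ord0 * a - z *: (a : S^o) = a * (A ord0 ord0 - z).
    by rewrite -[z *: (a : S^o)]/(z * a); ring.
  exact: (@subZ S S^o J iJ).
have [e1 re1 Je1] : relJ A1 (addy (J : set S^o) z) c1.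
  apply: IH1; rewrite -ev_emb1.
  have -> : ev A (emb1 c1) = ev A c - ev A (c - emb1 c1 - emb2 c3) -
     (ev A (emb2 c3) - A ord0 ord0 * ev A2 c3) - A ord0 ord0 * ev A2 c3.
    by rewrite !evB; zmod.
  apply: (@subB S S^o _ iJz) => //; apply: addyl; apply: (@subB S S^o J iJ).
    by apply: (@subB S S^o J iJ) => //; exact: relJ_ev.
  exact: ev_emb2.
have /choice [f fE] : forall g, exists f : S, J (c1 g - e1 g - z * f).
  by move=> g; have [f Jf] := Je1 g; exists f.
have g1 : good (emb1 c1).
  have -> : emb1 c1 = emb1 e1 + (\sum_g f g *: (z *: lift_dlt g) +
      emb1 (fun g => c1 g - e1 g - z * f g : S^o)).
    rewrite /emb1 /linext -!big_split; apply: eq_bigr => g _ /=.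
    rewrite scalerA -!scalerDl; congr (_ *: _).
    by rewrite [f g * z]mulrC; zmod.
  apply: (subD good_submod).
    by apply: good_rel; apply: relJ_rel => //; exact: rel_emb1.
  apply: (subD good_submod).
    by apply: (sub_sum good_submod) => g _; apply: (subZ good_submod); exact: good_lift.
  apply: good_rel; apply: relJ_J => // g; rewrite /emb1 /linext fct_sumE.
  apply: (@sub_sum S S^o J iJ) => g' _.
  rewrite -[(_ *: _) g]/(_ * _) mulrC; apply: (@subZ S S^o J iJ); exact: fE.
have [c4 r4] : good c.
  rewrite -[c](subrK (emb1 c1)); apply: (subD good_submod) => //.
  by exists c3.
have Jc4 : J (ev A2 c4).
  apply: rz; rewrite -[_ *: _]/(z * ev A2 c4).
  have -> : z * ev A2 c4 = ev A c - ev A (c - emb2 c4) -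
     (ev A (emb2 c4) - A ord0 ord0 * ev A2 c4) - ev A2 c4 * (A ord0 ord0 - z).
    by rewrite evB; ring.
  apply: (@subB S S^o J iJ); last exact: (@subZ S S^o J iJ).
  apply: (@subB S S^o J iJ); last exact: ev_emb2.
  by apply: (@subB S S^o J iJ) => //; exact: relJ_ev.
rewrite -[c](subrK (emb2 c4)); apply: (subD sE) => //.
by apply: relJ_emb2; exact: IH2.
Qed.

End Peel.

(* Junk value: beyond the end of [zs] the entries are 0. *)
Definition toep (zs : seq S) (i j : nat) : S := if (i <= j)%N then zs`_(j - i) else 0.

(** Without column 0 the matrix is, modulo [z], Toeplitz on the tail of the sequence; without row 0
    as well, it is a smaller one on the whole sequence. For empty [zs] one has t < s and no
    selection of columns is injective; for s = 0 the only minor is 1. *)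
Lemma toeplitz_relations zs s t (A : 'M[S]_(s, t)) (J : set S) c : is_ideal J ->
  regs (J : set S^o) zs -> t.+1 = (s + size zs)%N ->
  (forall i j, J (A i j - toep zs i j)) -> J (ev A c) -> relJ A J c.
Proof.
elim: zs s t A J c => [|z zs IHz] s t A J c iJ.
  rewrite addn0 => _ ts _ _; rewrite [c]delta_decomp.
  have sE := relJ_submod A iJ.
  apply: (sub_sum sE) => g _; apply: (subZ sE).
  have -> : delta g = dlt g by congr delta; apply/ffunP => i; rewrite ffunE.
  apply: relJ_noninj => // /leq_card; rewrite !card_ord => st; lia.
elim: s t A c => [|s IHs] t A c.
  move=> rz ts AJ Jc; apply: relJ_J => // g.
  move: Jc; rewrite /ev (bigD1 g) //= big1 ?addr0 /minor ?det_mx00 ?mulr1 // => h.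
  by case/eqP; apply/ffunP => -[].
case: t A c => [|t] A c; first by move=> _ /= ts; lia.
move=> [rz rzs] ts AJ; have A0 : J (A ord0 ord0 - z) by have := AJ ord0 ord0.
have col0 i : J (A (lift ord0 i) ord0).
  by have := AJ (lift ord0 i) ord0; rewrite /toep /= subr0.
apply: (relations_peel iJ col0 A0 rz) => [c1|c2].
  apply: IHz => //; first exact: ideal_addy.
    by move: ts => /=; lia.
  move=> i j; rewrite mxE; have := AJ i (lift ord0 j); rewrite /toep /= /bump leq0n add1n.
  case: (leqP i j) => ij; first by rewrite leqW // subSn //= => Jij; apply: addyl.
  rewrite subr0 leq_eqVlt => Jij; case: eqVneq Jij => [->|ne].
    rewrite subnn /= => Jz; exists 1; by rewrite -[_ *: _]/(z * 1) mulr1.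
  have -> : (i < j.+1)%N = false by lia.
  by rewrite /= subr0 => Jij; apply: addyl.
apply: IHs; [by split|by move: ts => /=; lia|].
move=> i j; rewrite mxE; have := AJ (lift ord0 i) (lift ord0 j).
by rewrite /toep /= /bump !leq0n !add1n ltnS subSS.
Qed.

End Relations.

(** * Maximal minors of a Toeplitz matrix and powers of its entries *)

Section ToeplitzMinors.
Variable S : comPzRingType.
Implicit Types (J : set S) (zs : seq S).

Lemma adjoin_mul J zs k x y : is_ideal J -> adjoin J zs x ->
  adjoin J (mons zs k) y -> adjoin J (mons zs k.+1) (x * y).
Proof.
move=> iJ Qx /(@addysE S S^o) [ns Jy]; have iP := ideal_adjoin (mons zs k.+1) iJ.
rewrite -[y](subrK (dot (mons zs k) ns : S)) mulrDr.
apply: (@subD S S^o _ iP).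
  by apply: (@addys_sub S S^o); apply: (@subZ S S^o J iJ).
rewrite /dot mulr_sumr; apply: (@sub_sum S S^o _ iP) => l _.
have -> : x * ((mons zs k)`_l *: ns l : S) = (ns l : S) * ((mons zs k)`_l * x).
  by rewrite -[_ *: ns l]/((mons zs k)`_l * (ns l : S)); ring.
apply: (@subZ S S^o _ iP).
by apply: (@powers_mul S S^o J zs k _ (x : S^o)) => //; exact: mem_nth.
Qed.

Lemma adjoin_prod J zs k (a : 'I_k -> S) : is_ideal J ->
  (forall i, adjoin J zs (a i)) -> adjoin J (mons zs k) (\prod_i a i).
Proof.
move=> iJ; elim: k a => [|k IH] a Qa.
  by rewrite /adjoin (@powers0 S S^o).
by rewrite big_ord_recl; apply: adjoin_mul => //; exact: IH.
Qed.

(** Telescoping: each difference trades one factor for a multiple of [z] and leaves [k] factors in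
    the ideal, which the perturbed factors do not leave since it contains [z]. *)
Lemma prod_perturb J zs z k (a n : 'I_k.+1 -> S) : is_ideal J ->
  adjoin J zs z -> (forall i, adjoin J zs (a i)) ->
  exists2 y, adjoin J (mons zs k) y & \prod_i (a i + z * n i) - \prod_i a i = z * y.
Proof.
move=> iJ Qz; have iQ := ideal_adjoin zs iJ.
have Qzn i (b c : 'I_i -> S) j : adjoin J zs (b j) -> adjoin J zs (b j + z * c j).
  move=> Qb; apply: (@subD S S^o _ iQ) => //; rewrite mulrC; exact: (@subZ S S^o _ iQ).
elim: k a n => [|k IH] a n Qa.
  exists (n ord0); first by rewrite /adjoin (@powers0 S S^o).
  by rewrite !big_ord_recl !big_ord0; ring.
have [y Py yE] := IH (a \o lift ord0) (n \o lift ord0) (fun i => Qa _).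
set p' := \prod_i _ in yE; set p := \prod_i _ in yE.
exists ((a ord0 + z * n ord0) * y + n ord0 * p).
  have iP := ideal_adjoin (mons zs k.+1) iJ; apply: (@subD S S^o _ iP).
    by apply: adjoin_mul => //; exact: (@Qzn _ a n ord0 (Qa ord0)).
  apply: (@subZ S S^o _ iP); apply: adjoin_prod => // i; exact: Qa.
rewrite big_ord_recl [X in _ - X]big_ord_recl -/p -/p'.
have -> : p' = p + z * y by rewrite -yE; ring.
by ring.
Qed.

Definition toep_mx zs s t : 'M[S]_(s, t) := \matrix_(i, j) toep zs i j.

Lemma toep_mem zs i j : adjoin [set 0] zs (toep zs i j).
Proof.
have i0 := ideal_adjoin zs (ideal0 S); rewrite /toep; case: ifP => _; last exact: i0.1.
have [jz|jz] := ltnP (j - i) (size zs); last by rewrite nth_default //; exact: i0.1.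
rewrite -[_`_ _]mulr1; apply: (@addys_mem S S^o [set 0] zs _ 1); first exact: ideal0.
exact: mem_nth.
Qed.

Lemma toep_perturb z zs i j : toep (z :: zs) i j.+1 = toep zs i j + z * (i == j.+1)%:R.
Proof.
rewrite /toep; case: (ltngtP i j.+1) => ij.
- by rewrite -ltnS ij subSn //= mulr0 addr0.
- have -> : (i <= j)%N = false by lia.
  by rewrite mulr0 addr0.
- by rewrite ij subnn ltnn mulr1 add0r.
Qed.

(* A monomial [z * u'] comes from minors containing the first column; the others come
   from the minors of the matrix on [zs], which [toep_perturb] changes by [z (z, zs)^s]. *)
Lemma toep_powers zs s t u : t.+1 = (s + size zs)%N -> u \in mons zs s ->
  exists c, u = ev (toep_mx zs s t) c.
Proof.
elim: zs s t u => [|z zs IHz] s t u; first by case: s => // + _; rewrite addn0.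
elim: s t u => [|s IHs] t u.
  rewrite mons0 inE => _ /eqP ->; exists (fun=> 1 : S^o).
  rewrite /ev (bigD1 [ffun i : 'I_0 => match i with Ordinal _ H => False_rect _ (notF H) end]) //=.
  rewrite /minor det_mx00 mulr1 big1 ?addr0 // => h.
  by case/eqP; apply/ffunP => -[].
case: t => [|t] ts; first by move: ts => /=; lia.
set T := toep_mx (z :: zs) s.+1 t.+1.
pose A2 : 'M[S]_(s, t) := \matrix_(i, j) T (lift ord0 i) (lift ord0 j).
pose A1 : 'M[S]_(s.+1, t) := \matrix_(i, j) T i (lift ord0 j).
have col0 i : [set 0] (T (lift ord0 i) ord0) by rewrite /T mxE.
have A2E : A2 = toep_mx (z :: zs) s t.
  by apply/matrixP => i j; rewrite !mxE /toep /= /bump !leq0n !add1n ltnS subSS.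
have lead y : adjoin [set 0] (mons (z :: zs) s) y -> exists c, z * y = ev T c.
  move=> /(@addysE S S^o) [ns /= /eqP]; rewrite subr_eq0 => /eqP ->.
  have /choice [c cE] : forall l, exists c, (l < size (mons (z :: zs) s))%N ->
      (mons (z :: zs) s)`_l = ev A2 c.
    move=> l; case: ltnP => ls; last by exists 0.
    rewrite A2E; have [|c ->] := IHs t _ _ (mem_nth 0 ls); last by exists c.
    by move: ts => /=; lia.
  exists (linext (@cons0_dlt S s t) (\sum_(l < size (mons (z :: zs) s)) (ns l : S) *: c l)).
  have := ev_emb2 (ideal0 S) col0 (\sum_(l < size (mons (z :: zs) s)) (ns l : S) *: c l).
  move=> /= /eqP; rewrite subr_eq0 => /eqP ->.
  rewrite [T ord0 ord0]mxE /toep /=; congr (_ * _); rewrite ev_sum; apply: eq_bigr => l _.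
  by rewrite evZ -cE // -[_ *: ns l]/((mons (z :: zs) s)`_l * (ns l : S)) mulrC.
rewrite monsS mem_cat => /orP [/mapP [u' u's ->]|us].
  by apply: lead; rewrite -[u']mulr1; apply: (@addys_mem S S^o [set 0] _ _ 1) => //; exact: ideal0.
have [|c ->] := IHz s.+1 t u _ us; first by move: ts => /=; lia.
have iQ k := ideal_adjoin (mons (z :: zs) k) (ideal0 S).
have Qsub : adjoin [set 0] zs `<=` adjoin [set 0] (z :: zs).
  by apply: (@addys_mono S S^o) => _ ->; exact: (@submod_addy S S^o [set 0] z (ideal0 S)).1.
have Qz : adjoin [set 0] (z :: zs) z.
  rewrite -[z in X in _ X]mulr1.
  apply: (@addys_mem S S^o [set 0] (z :: zs) z 1); first exact: ideal0.
  by rewrite inE eqxx.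
have diff g : exists2 y, adjoin [set 0] (mons (z :: zs) s) y &
    minor A1 g - minor (toep_mx zs s.+1 t) g = z * y.
  have /choice [y yP] : forall p : 'S_s.+1, exists y, adjoin [set 0] (mons (z :: zs) s) y /\
    \prod_i A1 i (g (p i)) - \prod_i toep_mx zs s.+1 t i (g (p i)) = z * y.
    move=> p.
    have [y Py yE] := @prod_perturb [set 0] (z :: zs) z s (fun i => toep zs i (g (p i)))
      (fun i => (nat_of_ord i == (g (p i)).+1)%:R) (ideal0 S) Qz (fun i => Qsub _ (toep_mem _ _ _)).
    exists y; split=> //; rewrite -yE; congr (_ - _); apply: eq_bigr => i _.
      by rewrite !mxE lift0 toep_perturb.
    by rewrite mxE.
  exists (\sum_(p : 'S_s.+1) (-1) ^+ p * y p).
    apply: (@sub_sum S S^o _ (iQ s)) => p _; apply: (@subZ S S^o _ (iQ s)).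
    by have [] := yP p.
  rewrite /minor /determinant -sumrB mulr_sumr; apply: eq_bigr => p _.
  have [_ yE] := yP p; rewrite mulrCA -yE mulrBr.
  by congr (_ * _ - _ * _); apply: eq_bigr => i _; rewrite mxE.
have /choice [y yP] : forall g, exists y, adjoin [set 0] (mons (z :: zs) s) y /\
    minor A1 g - minor (toep_mx zs s.+1 t) g = z * y.
  by move=> g; have [y Py yE] := diff g; exists y.
have [|d dE] := lead (\sum_g (c g : S) * y g).
  apply: (@sub_sum S S^o _ (iQ s)) => g _; apply: (@subZ S S^o _ (iQ s)).
  by have [] := yP g.
exists (linext (@lift_dlt S s.+1 t) c - d); rewrite evB -dE.
rewrite (ev_emb1 T) -/A1 /ev mulr_sumr -sumrB; apply: eq_bigr => g _.
have [_ yE] := yP g; rewrite mulrCA -yE; ring.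
Qed.

Lemma minor_congr J s t (A B : 'M[S]_(s, t)) g : is_ideal J ->
  (forall i j, J (A i j - B i j)) -> J (minor A g - minor B g).
Proof.
move=> iJ AB.
have prodJ k (a b : 'I_k -> S) : (forall i, J (a i - b i)) -> J (\prod_i a i - \prod_i b i).
  elim: k a b => [|k IH] a b ab; first by rewrite !big_ord0 subrr; exact: iJ.1.
  rewrite !big_ord_recl.
  set p := \prod_i _; set q := \prod_i _.
  have -> : a ord0 * p - b ord0 * q = p * (a ord0 - b ord0) + b ord0 * (p - q) by ring.
  by apply: (@subD S S^o J iJ); apply: (@subZ S S^o J iJ) => //; exact: IH.
rewrite /minor /determinant -sumrB; apply: (@sub_sum S S^o J iJ) => p _.
rewrite -mulrBr; apply: (@subZ S S^o J iJ); apply: prodJ => i; rewrite !mxE; exact: AB.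
Qed.

Definition minor_ideal J s t (A : 'M[S]_(s, t)) : set S :=
  [set x | exists c, J (x - ev A c)].

Lemma minor_ideal_powers J zs s t (A : 'M[S]_(s, t)) : is_ideal J ->
  t.+1 = (s + size zs)%N -> (forall i j, J (A i j - toep zs i j)) ->
  minor_ideal J A = adjoin J (mons zs s).
Proof.
move=> iJ ts AJ; have iP := ideal_adjoin (mons zs s) iJ.
have iQ := ideal_adjoin zs iJ.
have QA i j : adjoin J zs (A i j).
  rewrite -[A i j](subrK (toep zs i j)); apply: (@subD S S^o _ iQ).
    exact: (@addys_sub S S^o).
  by apply: (@addys_mono S S^o) (toep_mem _ _ _) => _ ->; exact: iJ.1.
apply/seteqP; split=> x.
  move=> [c Jx]; rewrite -[x](subrK (ev A c)); apply: (@subD S S^o _ iP).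
    exact: (@addys_sub S S^o).
  apply: (@sub_sum S S^o _ iP) => g _; apply: (@subZ S S^o _ iP).
  apply: (@sub_sum S S^o _ iP) => p _; apply: (@subZ S S^o _ iP).
  by apply: adjoin_prod => // i; rewrite mxE.
have evJ c : J (ev (toep_mx zs s t) c - ev A c).
  rewrite /ev -sumrB; apply: (@sub_sum S S^o J iJ) => g _; rewrite -mulrBr.
  apply: (@subZ S S^o J iJ); apply: minor_congr => // i j.
  rewrite mxE -opprB; exact: (@subN S S^o J iJ).
have sM : @submod S S^o (minor_ideal J A).
  split=> [|a u v [c Ju] [d Jv]]; first by exists 0; rewrite ev0 subr0; exact: iJ.1.
  exists (a *: c + d); rewrite evP.
  have -> : a *: u + v - (a * ev A c + ev A d) = a * (u - ev A c) + (v - ev A d).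
    by rewrite -[a *: u]/(a * (u : S)); ring.
  exact: iJ.2.
apply: (@addys_min S S^o J) => // [y Jy|u n us]; first by exists 0; rewrite ev0 subr0.
have [c uE] := toep_powers ts us.
rewrite -[u *: n]/(u * (n : S)) mulrC; apply: (@subZ S S^o _ sM).
by exists c; rewrite {1}uE.
Qed.

End ToeplitzMinors.

(** * Lifting relations, and the determinantal ideal *)

Section MinorIdeal.
Variables (S : comPzRingType) (m : set S).
Hypotheses (nS : noetherian S) (lm : local_ring m).
Variables (s t : nat) (A : 'M[S]_(s, t)).
Implicit Types (K : set S).

Lemma ideal_minor_ideal K : is_ideal K -> is_ideal (minor_ideal K A).
Proof.
move=> iK; split=> [|a u v [c Ku] [d Kv]]; first by exists 0; rewrite ev0 subr0; exact: iK.1.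
exists (a *: c + d); rewrite evP.
have -> : a * u + v - (a * ev A c + ev A d) = a * (u - ev A c) + (v - ev A d) by ring.
exact: iK.2.
Qed.

Lemma minor_ideal_addy K a :
  minor_ideal (addy (K : set S^o) a) A = addy (minor_ideal K A : set S^o) a.
Proof.
by apply/seteqP; split=> x [c [d Kx]]; exists d, c; move: Kx;
  rewrite -!addrA [- _ - _]addrC.
Qed.

Lemma minor_ideal_adjoin K l :
  minor_ideal (adjoin K l) A = adjoin (minor_ideal K A) l.
Proof.
elim: l K => // a l IH K.
transitivity (adjoin (minor_ideal (addy (K : set S^o) a) A) l); first exact: IH.
by rewrite minor_ideal_addy.
Qed.

(* By Nakayama's lemma, relations that are standard modulo the regular sequence
   [l] are standard; hence [l] is regular modulo the minors. *)
Lemma regs_minor_ideal K l : is_ideal K -> {in l, forall a, m a} ->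
  regs (K : set S^o) l ->
  (forall c, adjoin K l (ev A c) -> relJ A (adjoin K l) c) ->
  (forall c, K (ev A c) -> relJ A K c) /\ regs (minor_ideal K A : set S^o) l.
Proof.
elim: l K => [|a l IH] K iK ml; first by move=> _ H; split.
move=> [ra rl] H; have iKa := ideal_addy a iK.
have [|H1 r1] := IH _ iKa _ rl H; first by move=> b bl; apply: ml; rewrite inE bl orbT.
(* A relation that is standard modulo [a] is [a *: f] plus a standard one modulo [K], so that
   [ev A c] and [a * ev A f] agree modulo [K]. *)
have step c : addy (K : set S^o) a (ev A c) -> exists2 f : coef S s t,
    relJ A K (c - a *: f) & K (ev A (c - a *: f)).
  move=> /H1 [e re Ke].
  have /choice [f fE] : forall g, exists f : S, K (c g - e g - a * f).
    by move=> g; have [f Kf] := Ke g; exists f.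
  have rf : relJ A K (c - a *: (f : coef S s t)).
    exists e => // g; rewrite -[(c - _) g]/(c g - a * f g).
    by have := fE g; congr (K _); zmod.
  by exists f => //; exact: relJ_ev.
split; last split.
- pose Z : set (coef S s t) := [set c | K (ev A c)].
  have sZ : @submod S (coef S s t) Z.
    split=> [|b u v Ku Kv]; first by rewrite /Z /= ev0; exact: iK.1.
    by rewrite /Z /= evP; exact: iK.2.
  move=> c Kc.
  apply: (@nakayama S nS m lm (coef S s t) Z (relJ A K) a _ sZ (relJ_submod A iK) _ _ c Kc).
  + exact: noethm_fun.
  + by apply: ml; rewrite inE eqxx.
  move=> z Kz; have [|f rf Kf] := step z; first exact: (@addyl S S^o).
  exists (z - a *: f), f; split=> //; last by zmod.
  apply: ra; rewrite -[_ *: _]/(a * ev A f).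
  have -> : a * ev A f = ev A z - ev A (z - a *: f) by rewrite evB evZ; ring.
  exact: (@subB S S^o K iK).
- move=> n [c Kc]; have [|f _ Kf] := step c.
    by exists n; rewrite -opprB; exact: (@subN S S^o K iK).
  exists f; apply: ra.
  have -> : a *: (n - ev A f) = (a *: n - ev A c) + ev A (c - a *: f) :> S^o.
    rewrite evB evZ -[a *: (_ - _)]/(a * ((n : S) - ev A f)) -[a *: n]/(a * (n : S)).
    by ring.
  exact: (@subD S S^o K iK).
- by rewrite -minor_ideal_addy.
Qed.

Lemma increasing_perm (g : 'I_s -> 'I_t) : injective g ->
  exists p : 'S_s, increasing_ord (g \o p).
Proof.
move=> inj; pose r : s.-tuple 'I_t := [tuple g i | i < s].
pose leT : rel 'I_t := fun i j => (i <= j)%N.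
have /tuple_permP [p pE] : perm_eq (sort leT r) r by rewrite perm_sort.
exists p => i j ij /=.
have s_r : size (sort leT r) = s by rewrite size_sort size_tuple.
have nthE k : nth (g i) (sort leT r) (k : 'I_s) = g (p k).
  by rewrite pE -tnth_nth !tnth_mktuple.
have : leT (g (p i)) (g (p j)).
  rewrite -!nthE; apply: (sorted_ltn_nth (leT := leT)) => //.
  - by move=> a b c; exact: leq_trans.
  - by apply: sort_sorted => a b; exact: leq_total.
  - by rewrite inE s_r.
  - by rewrite inE s_r.
rewrite /leT leq_eqVlt => /orP [/eqP/val_inj/inj/perm_inj ijE|//].
by rewrite ijE ltnn in ij.
Qed.

Lemma determinantal_idealE : determinantal_ideal s A = minor_ideal [set 0] A.
Proof.
apply/seteqP; split=> [|x [c /= /eqP]].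
  apply: smallest_sub; first exact: ideal_minor_ideal (ideal0 S).
  move=> d [f [g [finc _ ->]]].
  have finj : injective f.
    move=> i j fij; have [ij|ji|/val_inj //] := ltngtP i j.
      by have := finc i j ij; rewrite fij ltnn.
    by have := finc j i ji; rewrite fij ltnn.
  exists ((-1) ^+ (perm finj) *: dlt S g); rewrite evZ ev_dlt /=.
  have -> : mxsub f g A = row_perm (perm finj) (colsub g A).
    by apply/matrixP => i j; rewrite !mxE permE.
  by rewrite row_permE det_mulmx det_perm subrr.
rewrite subr_eq0 => /eqP ->; have iI := @ideal_span_ideal S (minors s A).
apply: (@sub_sum S S^o _ iI) => g _; apply: (@subZ S S^o _ iI).
have [inj|ninj] := pselect (injective g); last first.
  suff -> : minor A g = 0 by exact: iI.1.
  apply: contrapT => m0; apply: ninj => i j gij; apply/eqP; apply: contraT => ij.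
  by case: m0; exact: minor_dup ij gij.
have [p pinc] := increasing_perm inj.
have -> : minor A g = (-1) ^+ p * minor A (g \o p).
  by rewrite minor_perm mulrA -expr2 sqrr_sign mul1r.
apply: (@subZ S S^o _ iI) => I [_]; apply.
by exists id, (g \o p); split.
Qed.

End MinorIdeal.

Theorem corollary4p10 (s t : nat) (s_gt0 : (0 < s)%N) (t_gt0 : (0 < t)%N)
    (st : (2 * s <= t + 1)%N)
    (alpha : 'I_s -> 'I_t -> nat) (alpha_gt0 : forall i j, (0 < alpha i j)%N)
    (S : comPzRingType) (m : set S) (gorS : gorenstein_local m)
    (x : 'M[S]_(s, t))
    (regx : regular_sequence m [seq x i j | i <- enum 'I_s, j <- enum 'I_t]) :
  let I := determinantal_ideal s (\matrix_(i < s, j < t) x i j ^+ alpha i j) in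
  SAC S <-> SAC (quotient_ring I).
Proof.
set A := \matrix_(i, j) _; move=> I; have [nS lm _] := gorS.
have [[im m1 _] _] := lm; have i0 := ideal0 S.
pose n := (t.+1 - s)%N.
have nt : (n <= t)%N by rewrite /n; lia.
(* This is what [2 * s <= t + 1] amounts to; the growth argument rests on it. *)
have sn : (s <= n)%N by rewrite /n; lia.
have tsn : t.+1 = (s + n)%N by rewrite /n; lia.
pose pairs := [seq (i, j) | i <- enum 'I_s, j <- enum 'I_t].
pose F (p : 'I_s * 'I_t) := A p.1 p.2.
have in_pairs p : p \in pairs.
  by case: p => i j; apply/allpairsP; exists (i, j); rewrite !mem_enum.
have mF p : m (F p).
  rewrite /F mxE; apply: (ideal_exp lm) => //; apply: regx.1.
  by apply/allpairsP; exists p; rewrite !mem_enum.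
have rF : regs ([set 0] : set S^o) (map F pairs).
  have -> : map F pairs = map (fun p => x p.1 p.2 ^+ alpha p.1 p.2) pairs.
    by apply: eq_map => p; rewrite /F mxE.
  apply: (@regs_exp S m nS lm [set 0] _ (fun p => x p.1 p.2) (fun p => alpha p.1 p.2)) => //.
    by move=> p; apply: regx.1; apply/allpairsP; exists p; rewrite !mem_enum.
  by rewrite map_allpairs; exact: regular_sequence_regs regx.
pose z0 : 'I_s := Ordinal s_gt0.
pose zp := [seq (z0, widen_ord nt j) | j <- enum 'I_n].
pose yp := [seq p <- pairs | p \notin zp].
pose zs := map F zp.
have szs : size zs = n by rewrite size_map size_map size_enum_ord.
have nth_zs (j : 'I_t) : (j < n)%N -> zs`_j = A z0 j.
  move=> jn; have jn' : (j < size (enum 'I_n))%N by rewrite size_enum_ord.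
  have jz : (j < size zp)%N by rewrite size_map.
  rewrite (nth_map (z0, j) _ _ jz) (nth_map (Ordinal jn) _ _ jn') /F /=.
  congr (A _ _).
  by apply: val_inj; rewrite /= nth_enum_ord.
have pz : perm_eq pairs (zp ++ yp).
  apply: uniq_perm => [||p].
  - by apply: allpairs_uniq; rewrite ?enum_uniq // => -[? ?] [? ?] _ _ [-> ->].
  - rewrite cat_uniq filter_uniq ?andbT.
      rewrite map_inj_uniq ?enum_uniq => [|j k [/val_inj //]].
      by apply/hasPn => p; rewrite mem_filter => /andP [].
    by apply: allpairs_uniq; rewrite ?enum_uniq // => -[? ?] [? ?] _ _ [-> ->].
  - by rewrite mem_cat mem_filter in_pairs andbT orbN.
pose G (p : 'I_s * 'I_t) := F p - toep zs p.1 p.2.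
pose ys := map G yp.
have mzs : {in zs, forall z, m z} by move=> z /mapP [p _ ->].
have mtoep i j : m (toep zs i j).
  apply: (@addys_min S S^o [set 0] m zs) (toep_mem _ _ _) => // [_ ->|u k uzs].
    exact: im.1.
  by rewrite -[_ *: k]/(u * (k : S)) mulrC; apply: (@subZ S S^o m im); exact: mzs.
have mys : {in ys, forall y, m y}.
  by move=> y /mapP [p _ ->]; exact: (@subB S S^o m im).
have rzy : regs ([set 0] : set S^o) (zs ++ ys).
  have : regs ([set 0] : set S^o) (map F (zp ++ yp)).
    apply: (@regs_perm S m nS lm _ _ _ i0 _ _ rF); last exact: perm_map.
    by move=> a /mapP [p _ ->].
  rewrite map_cat => /regs_cat [rz ry]; apply/regs_cat; split=> //.
  (* The Toeplitz entries lie in the ideal of [zs], so modulo [zs] the differences agree with the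
     entries; this is why [zs] is put first before the order is reversed. *)
  apply: (@regs_congr S (adjoin [set 0] zs) _ F G) ry; first exact: ideal_adjoin.
  by move=> p; rewrite /G opprB addrCA subrr addr0; exact: toep_mem.
have /regs_cat [ry rz] : regs ([set 0] : set S^o) (ys ++ zs).
  apply: (@regs_perm S m nS lm _ _ _ i0 _ _ rzy); last by rewrite perm_catC.
  by move=> a; rewrite mem_cat => /orP [/mzs|/mys].
pose J0 := adjoin [set 0] ys; have iJ0 : is_ideal J0 by exact: ideal_adjoin.
have AJ i j : J0 (A i j - toep zs i j).
  have [/mapP [k _ [-> ->]]|ijy] := boolP ((i, j) \in zp).
    rewrite /toep leq0n subn0 (nth_zs (widen_ord nt k)) ?subrr; first exact: iJ0.1.
    exact: (ltn_ord k).
  rewrite -[_ - _]mulr1; apply: (@addys_mem S S^o [set 0] ys _ 1) => //.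
  by apply/mapP; exists (i, j); rewrite // mem_filter ijy in_pairs.
have tsz : t.+1 = (s + size zs)%N by rewrite szs.
have [_ rIy] : (forall c, [set 0] (ev A c) -> relJ A [set 0] c) /\
    regs (minor_ideal [set 0] A : set S^o) ys.
  apply: (regs_minor_ideal nS lm i0 mys ry) => c.
  exact: toeplitz_relations iJ0 rz tsz AJ.
(* [quotient_ring] divides by the span of its argument, and [I] is already an ideal. *)
have IE : ideal_span I = minor_ideal [set 0] A.
  rewrite -determinantal_idealE; apply/seteqP; split.
    by apply: smallest_sub => //; exact: ideal_span_ideal.
  exact: sub_smallest.
have PE : adjoin (minor_ideal [set 0] A) ys = adjoin J0 (mons zs s).
  by rewrite -minor_ideal_adjoin; exact: minor_ideal_powers.
have sR : SAC (quotient_ring I) <-> SACrel (adjoin J0 (mons zs s)).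
  apply: (iff_trans (SAC_quotient I nS)); rewrite IE -PE.
  by apply: (SACrel_regs nS lm mys _ rIy); exact: ideal_minor_ideal.
have sS : SAC S <-> SACrel J0.
  by apply: (iff_trans (SAC_self nS)); exact: (SACrel_regs nS lm mys i0 ry).
apply: (iff_trans sS); apply: iff_sym; apply: (iff_trans sR).
have szs' : (s <= size zs)%N by rewrite szs.
split; first exact: (SACrel_of_powers nS lm mzs iJ0 rz s_gt0 szs').
move=> /(SACrel_regs nS lm mzs iJ0 rz) sQ.
have [L0 gt0] := dual_exact_adjoin i0 ry (dual_exact_gorenstein gorS).
have [L gt] := dual_exact_adjoin iJ0 rz gt0.
exact: (SACrel_powers nS iJ0 rz s_gt0 szs' gt sQ).
Qed.
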